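(* Let $X$ be a real Hausdorff locally convex space, $\gamma$ a Radon centered Gaussian measure on $X$, $p\in[1,\infty)$ and $\alpha\in(0,1]$. For any function $f\in B^\alpha_p(\gamma)$ and any $t\ge0$, one has $$\|f-T_tf\|_p\le2^{1-\alpha}C(p)^\alpha c_t^\alpha\,V_\gamma^{p,\alpha}(f),$$ where $$c_t:=\int_0^t\frac{e^{-\tau}}{\sqrt{1-e^{-2\tau}}}\,d\tau,\qquad C(p):=\biggl((2\pi)^{-1/2}\int_{\mathbb{R}}|s|^pe^{-\frac{s^2}{2}}\,ds\biggr)^{1/p}.$$
   Context: A Radon centered Gaussian measure is a Radon probability measure $\gamma$ on the Borel $\sigma$-algebra of $X$ such that every $l\in X^*$ is a centered Gaussian random variable (possibly degenerate) on $(X,\gamma)$. $X_\gamma^*$ is the closure of $X^*$ in $L^2(\gamma)$. The Cameron--Martin space $H\subset X$ is the set of vectors $h$ such that $\gamma(\cdot-h)$ is equivalent to $\gamma$; it is a separable Hilbert space with norm $|h|_H=\sup\{l(h):\ l\in X^*,\ \int_Xl^2\,d\gamma\le1\}$ and inner product $\langle\cdot,\cdot\rangle_H$. $\|\cdot\|_p$ is the norm of $L^p(\gamma)$; for an $H$-valued field $\Phi$, $\|\Phi\|_p$ is the $L^p(\gamma)$-norm of $|\Phi|_H$. The Ornstein--Uhlenbeck semigroup is $T_tf(x):=\int_Xf(e^{-t}x+\sqrt{1-e^{-2t}}\,y)\,\gamma(dy)$, $t\ge0$. $\mathcal{FC}_0^\infty(X,H)$ is the set of vector fields $\Phi(x)=\sum_{i=1}^n\Psi_i(g_1(x),\dots,g_n(x))h_i$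 with $n\in\mathbb{N}$, $\Psi_i\in C_0^\infty(\mathbb{R}^n)$, $g_i\in X^*$, $h_i\in H$, where the representation is taken with $g_1,\dots,g_n$ orthonormal in $X_\gamma^*$, $h_1,\dots,h_n$ orthonormal in $H$ and $g_i(h_j)=\delta_{ij}$. For such $\Phi$ the Gaussian divergence is the bounded function $\mathrm{div}_\gamma\Phi(x)=\sum_{j=1}^n\bigl[\partial_{x_j}\Psi_j(g_1(x),\dots,g_n(x))-g_j(x)\Psi_j(g_1(x),\dots,g_n(x))\bigr]$ (minus the adjoint of the $H$-gradient with respect to $\gamma$). A function $f\in L^p(\gamma)$ belongs to the Gaussian Nikolskii--Besov class $B^\alpha_p(\gamma)$ if there is a number $C\ge0$ such that $\int_Xf\,\mathrm{div}_\gamma\Phi\,d\gamma\le C\|\Phi\|_q^\alpha\|\mathrm{div}_\gamma\Phi\|_q^{1-\alpha}$ for all $\Phi\in\mathcal{FC}_0^\infty(X,H)$, where $1/p+1/q=1$ ($q=\infty$ if $p=1$; $0^0=1$). $V_\gamma^{p,\alpha}(f)$ is the infimum of such $C$. *)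

(* Defs.v *)
From HB Require Import structures.
From mathcomp Require Import all_boot all_order all_algebra.
From mathcomp Require Import all_classical all_reals all_analysis.

Set Implicit Arguments.
Unset Strict Implicit.
Unset Printing Implicit Defensive.

Import Order.TTheory GRing.Theory Num.Theory.
Import numFieldNormedType.Exports.

Local Open Scope classical_set_scope.
Local Open Scope ring_scope.

(* The cast to [zmodType] only supplies the point 0 that [measurableType]
   requires. *)
Definition borel (R : realType) (X : tvsType R) :=
  @g_sigma_algebraType (X : zmodType) (@open X).

Section smooth_functions.
Context {R : realType} {n : nat}.
Implicit Type f : 'rV[R]_n -> R.

Definition partial (j : 'I_n) f : 'rV[R]_n -> R :=
  fun x => 'D_(delta_mx 0 j) f x.

Definition iter_partial (s : seq 'I_n) f := foldr partial f s.

Definition smooth f := forall s : seq 'I_n,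
  continuous (iter_partial s f) /\
  forall (j : 'I_n) (x : 'rV[R]_n),
    derivable (iter_partial s f) x (delta_mx 0 j).

(* C_0^oo(R^n): smooth functions with compact support. *)
Definition smooth_compact_support f :=
  smooth f /\ compact (closure [set x | f x != 0]).

End smooth_functions.

Section gaussian_measures.
Context {R : realType} {X : tvsType R}.
Implicit Type gamma : probability (borel X) R.

Definition dual (l : X -> R) := scalar l /\ continuous l.

Definition radon gamma := forall (B : set X) (e : R),
  measurable (B : set (borel X)) -> 0 < e ->
  exists K : set X, [/\ compact K, K `<=` B & (gamma (B `\` K) < e%:E)%E].

(* [normal_prob 0 0] is not the point mass at 0 (it is the uniform law on
   [0, 1]), so the degenerate case is treated separately. *)
Definition centered_gaussian_law (mu : set R -> \bar R) :=
  exists2 s : R, 0 <= s & forall A : set R, measurable A ->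
    mu A = if s == 0 then dirac (0 : R) A else normal_prob 0 s A.

Definition centered_gaussian gamma := forall l : X -> R, dual l ->
  centered_gaussian_law (pushforward gamma (l : borel X -> R)).

(* The measure A |-> gamma (A - h). *)
Definition shift_measure gamma (h : X) : set (borel X) -> \bar R :=
  pushforward gamma ((fun x : X => x + h) : borel X -> borel X).

Definition cameron_martin gamma : set X :=
  [set h | shift_measure gamma h `<< gamma /\ gamma `<< shift_measure gamma h].

Definition cm_norm gamma (h : X) : \bar R :=
  ereal_sup [set (l h)%:E | l in
    [set l | dual l /\ (\int[gamma]_x ((l x) ^+ 2)%:E <= 1)%E]].

(* [cm_norm] is finite on the Cameron-Martin space; the inner product is
   recovered from the norm by polarization. *)
Definition cm_inner gamma (h k : X) : R :=
  (fine (cm_norm gamma (h + k)) ^+ 2 - fine (cm_norm gamma (h - k)) ^+ 2) / 4.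

(* An element of FC_0^oo(X, H), given by a representation. Since g_1, ..., g_n
   belong to X^*, their orthonormality in the L^2(gamma)-closure of X^* is
   orthonormality in L^2(gamma). *)
Record cyl_field gamma := CylField {
  cyl_dim : nat ;
  cyl_psi : 'I_cyl_dim -> 'rV[R]_cyl_dim -> R ;
  cyl_g : 'I_cyl_dim -> X -> R ;
  cyl_h : 'I_cyl_dim -> X ;
  cyl_psi_smooth : forall i, smooth_compact_support (cyl_psi i) ;
  cyl_g_dual : forall i, dual (cyl_g i) ;
  cyl_h_cm : forall i, cameron_martin gamma (cyl_h i) ;
  cyl_g_orthonormal : forall i j,
    (\int[gamma]_x (cyl_g i x * cyl_g j x)%:E = ((i == j)%:R)%:E)%E ;
  cyl_h_orthonormal : forall i j,
    cm_inner gamma (cyl_h i) (cyl_h j) = (i == j)%:R ;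
  cyl_gh : forall i j, cyl_g i (cyl_h j) = (i == j)%:R }.

Definition cyl_coord gamma (Phi : cyl_field gamma) (x : X) :
  'rV[R]_(cyl_dim Phi) := \row_i cyl_g i x.

Definition cyl_val gamma (Phi : cyl_field gamma) (x : X) : X :=
  \sum_(i < cyl_dim Phi) cyl_psi i (cyl_coord Phi x) *: cyl_h i.

Definition div_gamma gamma (Phi : cyl_field gamma) (x : X) : R :=
  \sum_(j < cyl_dim Phi)
    (partial j (cyl_psi j) (cyl_coord Phi x)
     - cyl_g j x * cyl_psi j (cyl_coord Phi x)).

(* Elements of L^p(gamma) are taken as Borel representatives, [Lfun]. *)
Definition besov_const gamma (p alpha : R) (f : X -> R) : set R :=
  let q := hoelder_conjugate p%:E in
  [set C | 0 <= C /\ forall Phi : cyl_field gamma,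
    (\int[gamma]_x (f x * div_gamma Phi x)%:E
     <= C%:E * Lnorm gamma q (fun x => cm_norm gamma (cyl_val Phi x)) `^ alpha
        * Lnorm gamma q (fun x => (div_gamma Phi x)%:E) `^ (1 - alpha))%E].

Definition besov gamma (p alpha : R) : set (X -> R) :=
  [set f | (f : borel X -> R) \in Lfun gamma p%:E /\
           besov_const gamma p alpha f !=set0].

Definition besov_norm gamma (p alpha : R) (f : X -> R) : R :=
  inf (besov_const gamma p alpha f).

(* For f integrable the integral converges for gamma-almost every x; elsewhere
   the value is that of the total operator [Rintegral]. *)
Definition ornstein_uhlenbeck gamma (t : R) (f : X -> R) (x : X) : R :=
  \int[gamma]_y
    f (expR (- t) *: x + Num.sqrt (1 - expR (- (2 * t))) *: (y : X)).

End gaussian_measures.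

Definition ou_time {R : realType} (t : R) : R :=
  \int[lebesgue_measure]_(tau in `[0, t])
    (expR (- tau) / Num.sqrt (1 - expR (- (2 * tau)))).

Definition gaussian_moment {R : realType} (p : R) : R :=
  ((2 * pi) `^ (- 2^-1) *
   \int[lebesgue_measure]_s (`|s| `^ p * expR (- (s ^+ 2 / 2)))) `^ p^-1.

(* Main.v *)
Require Import Defs.
From HB Require Import structures.
From mathcomp Require Import all_boot all_order all_algebra.
From mathcomp Require Import all_classical all_reals all_analysis.
From mathcomp Require Import measurable_realfun ess_sup_inf.
From mathcomp Require Import ring lra.
Set Implicit Arguments.
Unset Strict Implicit.
Unset Printing Implicit Defensive.
Import Order.TTheory GRing.Theory Num.Theory.
Import numFieldNormedType.Exports.
Local Open Scope classical_set_scope.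
Local Open Scope ring_scope.

(* Put M_s f(x) = E f(cos s x + sin s y), so that T_t = M_a with cos a = exp(-t).
   By duality it is enough to bound the integral of (f - M_a f) phi by
   2^(1 - alpha) (C(p) a)^alpha V |phi|_q for phi in the span of the functions
   cos(l + c), l in X^*, which are dense, with explicit Gaussian integrals.
   M_a is symmetric, so f may be tested against phi - M_a phi instead. By
   Gram-Schmidt in L^2(gamma), phi is almost everywhere a function P(g_1, ..., g_n)
   of orthonormal coordinates, dual to an orthonormal system h_1, ..., h_n of H.
   Then M_a phi - phi is the divergence of the field with components
   Phi_j = int_0^a E[P(g(cos s x + sin s y)) g_j(y)] ds; by the Hoelder inequality
   in y and the rotation invariance of gamma x gamma, |Phi|_q <= C(p) a |phi|_q,
   and the divergence is at most 2 |phi|_q. A smooth cutoff makes the field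
   admissible up to an error that vanishes in the limit. Finally a <= c_t (there is
   equality), since s -> acos(exp(-s)) is a primitive of the integrand of c_t. *)

(** * Continuous linear forms separate points *)

(** The obstacle is measurability. [X] need not be separable, so the product of two copies of
    [borel X] can be smaller than the Borel sigma-algebra of the product, and the map taking (x, y)
    to cos s x + sin s y need not be measurable for it. Rotation invariance is therefore an identity
    between iterated integrals, checked on the functions cos(l + c) and carried to all Borel
    functions by compact sets and Urysohn functions made of the same cosines. Joint measurability is
    used only for functions of finitely many linear forms. The cosines also make the field explicit:
    its components are one-variable integrals that can be differentiated indefinitely. The same
    Urysohn functions, with the Radon property, yield the vectors h_i inside X itself. C(p) is the
    L^p norm of a standard Gaussian variable, here any unit combination of the g_i; the factor 2^(1
    - alpha) is the triangle inequality for M_a phi - phi. For p = 1 the dual norm is a supremum, so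
    P must be bounded at every point of R^n, not only almost everywhere along the coordinates;
    moving along the h_i gives this. *)

Section sublinear.
Context {R : realType} {X : lmodType R}.
Implicit Types q : X -> R.

(** Homogeneity is asked as an inequality, which is easy to check for the infima below; [sublinearZ]
    recovers equality by applying it to the inverse factor. *)
Definition sublinear q := (forall x y, q (x + y) <= q x + q y) /\
  (forall a x, 0 < a -> q (a *: x) <= a * q x).

Lemma sublinear0 q : sublinear q -> q 0 = 0.
Proof.
move=> [qD qZ]; have := qD 0 0; rewrite addr0 => h.
have := @qZ 2^-1 0 ltac:(lra); rewrite scaler0 => h2; apply/eqP; rewrite eq_le.
by apply/andP; split; lra.
Qed.

Lemma sublinearZ q a x : sublinear q -> 0 <= a -> q (a *: x) = a * q x.
Proof.
move=> qs; rewrite le0r => /orP[/eqP->|a0].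
  by rewrite scale0r mul0r sublinear0.
apply/eqP; rewrite eq_le qs.2//= -ler_pdivlMl//.
rewrite -[x in q x <= _](@scalerK _ _ a) ?gt_eqF//.
by apply: qs.2; rewrite invr_gt0.
Qed.

Lemma sublinearN q x : sublinear q -> - q (- x) <= q x.
Proof. by move=> qs; have := qs.1 x (- x); rewrite subrr sublinear0//; lra. Qed.

(** A functional below [q] (take [t = 0]) whose value at [- z] is at most [- q z] (take [t = 1]), so
    that an odd functional below it is at least [q z] at [z]. *)
Definition direction_inf q z y := inf [set q (y + t *: z) - t * q z | t in [set t | 0 <= t]].

Section direction_inf.
Variables (q : X -> R) (z : X).
Hypothesis qs : sublinear q.

Lemma direction_inf_has_inf y :
  has_inf [set q (y + t *: z) - t * q z | t in [set t | 0 <= t]].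
Proof.
split; first by exists (q (y + 0 *: z) - 0 * q z), 0 => //=.
exists (- q (- y)) => _ [t /= t0 <-].
have := qs.1 (y + t *: z) (- y); rewrite addrAC subrr add0r sublinearZ//; lra.
Qed.

Lemma direction_inf_le y t : 0 <= t -> direction_inf q z y <= q (y + t *: z) - t * q z.
Proof. by move=> t0; apply: (ge_inf (direction_inf_has_inf y).2); exists t. Qed.

Lemma le_direction_inf y a : (forall t, 0 <= t -> a <= q (y + t *: z) - t * q z) ->
  a <= direction_inf q z y.
Proof.
move=> h; apply: lb_le_inf; first by case: (direction_inf_has_inf y).
by move=> _ [t /= t0 <-]; exact: h.
Qed.

Lemma sublinear_direction_inf : sublinear (direction_inf q z).
Proof.
split=> [x y|a x a0].
  rewrite -lerBlDr; apply: le_direction_inf => t t0.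
  rewrite lerBlDr -lerBlDl; apply: le_direction_inf => s s0.
  rewrite lerBlDl; apply: (le_trans (@direction_inf_le _ (t + s) _)).
    by rewrite addr_ge0.
  have := qs.1 (x + t *: z) (y + s *: z); rewrite addrACA -scalerDl; lra.
rewrite -ler_pdivrMl//; apply: le_direction_inf => t t0.
rewrite ler_pdivrMl//; apply: (le_trans (@direction_inf_le _ (a * t) _)).
  by rewrite mulr_ge0// ltW.
by rewrite -scalerA -scalerDr (sublinearZ _ qs (ltW a0)) mulrBr mulrA.
Qed.

End direction_inf.

(* A pointwise minimal sublinear functional is linear, since it coincides with
   all its [direction_inf]. *)
Lemma sublinear_minimal p : sublinear p ->
  exists q, [/\ sublinear q, (forall x, q x <= p x) & forall x, q (- x) = - q x].
Proof.
move=> ps.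
pose T := {q : X -> R | sublinear q /\ forall x, q x <= p x}.
pose r (a b : T) := `[< forall x, sval b x <= sval a x >].
have [|||A Atot|[q [qs qp]] qmin] := @Zorn T r.
- by move=> t; apply/asboolP.
- move=> a b c /asboolP ba /asboolP cb; apply/asboolP => x.
  exact: le_trans (cb x) (ba x).
- move=> [a [as_ ap]] [b [bs bp]] /asboolP/= h1 /asboolP/= h2.
  apply: eq_exist => /=; apply/funext => x; apply/eqP; rewrite eq_le h1 h2//.
- have [[a0 Aa0]|A0] := pselect (A !=set0); last first.
    have pT : sublinear p /\ forall x, p x <= p x by [].
    by exists (exist _ p pT) => s As; case: A0; exists s.
  (* The order is reversed, so a chain is bounded by its pointwise infimum. This is finite because
     every member is at least [- p (- x)] at [x]; for subadditivity, two members are replaced by the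
     smaller one. *)
  pose V x := [set sval a x | a in A].
  have Vinf x : has_inf (V x).
    split; first by exists (sval a0 x), a0.
    exists (- p (- x)) => _ [[a [as_ ap]] Aa <-] /=.
    by have := sublinearN x as_; have := ap (- x); lra.
  have infV x a : A a -> inf (V x) <= sval a x.
    by move=> Aa; apply: (ge_inf (Vinf x).2); exists a.
  have mT : sublinear (fun x => inf (V x)) /\ forall x, inf (V x) <= p x.
    split; last first.
      by move=> x; apply: (le_trans (infV x _ Aa0)); case: a0 Aa0 => ? [].
    split=> [x y|c x c0].
      rewrite -lerBlDr; apply: lb_le_inf; first by case: (Vinf x).
      move=> _ [a Aa <-]; rewrite lerBlDr -lerBlDl.
      apply: lb_le_inf; first by case: (Vinf y).
      move=> _ [b Ab <-]; rewrite lerBlDl.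
      have : exists2 d, A d & (sval d x <= sval a x) /\ (sval d y <= sval b y).
        have [/asboolP h|/asboolP h] := Atot _ _ Aa Ab; first by exists b.
        by exists a.
      move=> [d Ad [da db]]; apply: (le_trans (infV _ _ Ad)).
      case: d {Ad} da db => d [[dD _] _] /= da db.
      by have := dD x y; lra.
    rewrite -ler_pdivrMl//; apply: lb_le_inf; first by case: (Vinf x).
    move=> _ [a Aa <-]; rewrite ler_pdivrMl//; apply: (le_trans (infV _ _ Aa)).
    by case: a {Aa} => a [[_ aZ] _] /=; exact: aZ.
  by exists (exist _ (fun x => inf (V x)) mT : T) => s As; apply/asboolP => x /=; exact: infV.
exists q; split => // z.
have dle x : direction_inf q z x <= q x.
  by have := @direction_inf_le q z qs x 0 (lexx _); rewrite scale0r addr0; lra.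
have dT : sublinear (direction_inf q z) /\ forall x, direction_inf q z x <= p x.
  split; first exact: sublinear_direction_inf.
  by move=> x; apply: le_trans (dle x) (qp x).
have /(congr1 sval)/= dq := qmin (exist _ (direction_inf q z) dT : T) ltac:(by apply/asboolP).
have := @direction_inf_le q z qs (- z) 1 ler01.
rewrite dq scale1r addNr sublinear0//.
have := qs.1 z (- z); rewrite subrr sublinear0// => h1 h2.
by apply/eqP; rewrite eq_le; apply/andP; split; lra.
Qed.

(** No form is extended from a line: a minimal functional below [direction_inf p x] is odd, hence
    linear, and the value of [direction_inf p x] at [- x] forces [p x <= l x]. *)
Lemma hahn_banach p x : sublinear p ->
  exists l, [/\ scalar l, (forall y, l y <= p y) & p x <= l x].
Proof.
move=> ps; have [q [qs qp qN]] := sublinear_minimal (sublinear_direction_inf x ps).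
have dp y : direction_inf p x y <= p y.
  by have := @direction_inf_le p x ps y 0 (lexx _); rewrite scale0r addr0; lra.
exists q; split.
- have qD u v : q (u + v) = q u + q v.
    apply/eqP; rewrite eq_le qs.1/=.
    by have := qs.1 (- u) (- v); rewrite -opprD !qN; lra.
  move=> a u v; rewrite qD; congr (_ + _).
  have [a0|a0] := leP 0 a; first exact: sublinearZ.
  by rewrite -[a]opprK scaleNr qN sublinearZ// ?mulNr// oppr_ge0 ltW.
- by move=> y; exact: le_trans (qp y) (dp y).
- have := qp (- x); rewrite qN.
  have := @direction_inf_le p x ps (- x) 1 ler01.
  rewrite scale1r addNr sublinear0//; lra.
Qed.

End sublinear.

Lemma convex_setP (R : realType) (X : lmodType R) (W : set X) (a : R) x y :
  convex_set (W : set (convex_lmodType X)) ->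
  0 <= a -> a <= 1 -> W x -> W y -> W (a *: x + (1 - a) *: y).
Proof.
move=> Wc a0 a1 Wx Wy.
by have := Wc x y (Itv01 a0 a1) (mem_set Wx) (mem_set Wy); rewrite inE.
Qed.

Section gauge.
Context {R : realType} {X : tvsType R}.
Variable W : set X.
Hypotheses (Wc : convex_set (W : set (convex_lmodType X))) (W0 : nbhs (0 : X) W).

Definition gauge x := inf [set r | 0 < r /\ W (r^-1 *: x)].

Lemma gauge_has_inf x : has_inf [set r : R | 0 < r /\ W (r^-1 *: x)].
Proof.
split; last by exists 0 => r [/ltW].
have : (fun r : R^o => r *: x) @ (0 : R) --> (0 *: x : X).
  apply: (@continuous_comp R^o (R^o * X)%type X (fun r => (r, x)) (fun z => z.1 *: z.2)).
    by apply: (@cvg_pair _ _ _ _ (nbhs (0 : R^o))); [exact: cvg_id|exact: cvg_cst].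
  exact: scale_continuous.
rewrite scale0r => /(_ _ W0) /= [e /= e0 eW].
exists (e / 2)^-1; split; first by rewrite invr_gt0; lra.
rewrite invrK; apply: eW => /=; rewrite sub0r normrN gtr0_norm; lra.
Qed.

Lemma gauge_le x r : 0 < r -> W (r^-1 *: x) -> gauge x <= r.
Proof. by move=> r0 Wr; exact: (ge_inf (gauge_has_inf x).2). Qed.

Lemma sublinear_gauge : sublinear gauge.
Proof.
split=> [x y|a x a0].
  rewrite -lerBlDr; apply: lb_le_inf; first by case: (gauge_has_inf x).
  move=> r [r0 Wr]; rewrite lerBlDr -lerBlDl.
  apply: lb_le_inf; first by case: (gauge_has_inf y).
  move=> s [s0 Ws]; rewrite lerBlDl; apply: gauge_le; first lra.
  (* The weight [r / (r + s)] exhibits the point as a convex combination of two points of [W]. *)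
  have -> : (r + s)^-1 *: (x + y) =
      (r / (r + s)) *: (r^-1 *: x) + (1 - r / (r + s)) *: (s^-1 *: y).
    rewrite !scalerA scalerDr; congr (_ *: _ + _ *: _); field; lra.
  apply: convex_setP => //; first by rewrite divr_ge0//; lra.
  rewrite ler_pdivrMr; lra.
rewrite -ler_pdivrMl//; apply: lb_le_inf; first by case: (gauge_has_inf x).
move=> r [r0 Wr]; rewrite ler_pdivrMl//; apply: gauge_le; first by rewrite mulr_gt0.
by rewrite invfM mulrC scalerA -mulrA mulVf ?mulr1// gt_eqF.
Qed.

End gauge.

(** A convex open neighbourhood [V] of 0 that misses [x] has gauge at least 1 at [x], and
    Hahn-Banach gives a form below this gauge. The form is at most e in absolute value on e times
    the intersection of [V] and [- V]; the intersection is taken because [V] need not be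
    symmetric. *)
Lemma dual_separates (R : realType) (X : tvsType R) (x : X) :
  hausdorff_space X -> x != 0 -> exists2 l : X -> R, dual l & l x != 0.
Proof.
move=> hX x0.
have [U [U0 Ux]] : exists U, nbhs (0 : X) U /\ ~ U x.
  apply: contrapT => /forallNP h; have := hX 0 x; apply/not_implyP; split; last first.
    by move=> /eqP; rewrite eq_sym; apply/negP.
  move=> A B A0 Bx; exists x; split; last exact: nbhs_singleton.
  by apply: contrapT => nA; apply: (h A).
have [Bs Bc [Bo Bb]] := @locally_convex R X.
have [V /= [BV V0] VU] := Bb 0 U U0.
have Vc : convex_set (V : set (convex_lmodType X)) by apply: Bc; rewrite inE.
have Vn : nbhs (0 : X) V by apply: open_nbhs_nbhs; split => //; exact: Bo.
pose p := gauge V.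
have ps : sublinear p := sublinear_gauge Vc Vn.
have [l [ll lp lx]] := hahn_banach x ps.
have lN y : l (- y) = - l y.
  by have := ll (-1) y 0; rewrite addr0 scaleN1r mulN1r => ->;
     have := ll 1 0 0; rewrite scale1r mul1r addr0; lra.
have l0 : l 0 = 0 by have := ll 1 0 0; rewrite scale1r mul1r addr0; lra.
have lD y z : l (y + z) = l y + l z by have := ll 1 y z; rewrite scale1r mul1r.
exists l; last first.
  have : 1 <= p x.
    apply: lb_le_inf; first by case: (gauge_has_inf Vn x).
    move=> r [r0 Vr]; rewrite leNgt; apply/negP => r1; apply: Ux; apply: VU.
    have := @convex_setP R X V r _ 0 Vc (ltW r0) (ltW r1) Vr V0.
    by rewrite scaler0 addr0 scalerA divff ?gt_eqF// scale1r.
  by move=> h; rewrite gt_eqF//; lra.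
split=> // y; apply/cvgrPdist_le => e e0.
have W0 : nbhs (0 : X) ( *:%R e @` (V `&` (-%R @` V))).
  apply: nbhs0Z; first by rewrite gt_eqF.
  by apply: filterI => //; exact: nbhs0N.
have := nbhsT y W0; apply: filterS => _ [_ [w [wV [v vV vw]] <-] <-].
rewrite lD opprD addNKr normrN ler_norml.
have h1 : p (e *: w) <= e.
  by apply: gauge_le => //; rewrite scalerA mulVf ?scale1r// gt_eqF.
have h2 : p (- (e *: w)) <= e.
  apply: gauge_le => //.
  by rewrite -vw !scalerN opprK scalerA mulVf ?scale1r// gt_eqF.
have := lp (e *: w); have := lp (- (e *: w)); rewrite lN.
by move=> *; apply/andP; split; lra.
Qed.

(** * Trigonometric polynomials and their uniform closure *)

(** If [P K] failed, the sets S such that [P] holds for K minus S would form a proper filter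
    containing [K]; a cluster point in [K] contradicts the local hypothesis. *)
Lemma compact_induction (T : topologicalType) (K : set T) (P : set T -> Prop) :
  compact K -> P set0 -> (forall A B, P A -> P B -> P (A `|` B)) ->
  (forall A B, A `<=` B -> P B -> P A) ->
  (forall x, K x -> exists2 U, nbhs x U & P U) -> P K.
Proof.
move=> Kc P0 PU PS Pn; apply: contrapT => nPK.
pose F : set_system T := [set S | P (K `\` S)].
have FF : ProperFilter F.
  split.
    by rewrite /F/= setD0.
  split.
  - by rewrite /F/= setDT.
  - by move=> A B FA FB; rewrite /F/= setDIr; exact: PU.
  - by move=> A B AB; apply: PS; exact: setDS.
have [] := Kc F FF; first by rewrite /F/= setDv.
move=> x [Kx clx]; have [U xU PUU] := Pn x Kx.
have [] := clx (~` U) U _ xU; last by move=> y [].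
by rewrite /F/= setDE setCK; apply: PS PUU => y [].
Qed.

Section trig_poly.
Context {R : realType} {T : Type}.
Variable F : set (T -> R).
Implicit Types u v : T -> R.

(** The phase [th] lets cosines alone produce sines and products. [F] is abstract because it stands
    in turn for X^*, for the linear forms of R^n, for a finite family of forms and for a family of
    functions on [X * X]. *)
Inductive trig_poly : (T -> R) -> Prop :=
| TrigCos a l th : F l -> trig_poly (fun x => a * cos (l x + th))
| TrigAdd u v : trig_poly u -> trig_poly v -> trig_poly (fun x => u x + v x).

Definition unif_trig v :=
  forall e, 0 < e -> exists2 u, trig_poly u & forall x, `|v x - u x| <= e.

Lemma trig_poly_bounded u : trig_poly u -> exists2 M, 0 < M & forall x, `|u x| <= M.
Proof.
elim=> [a l th _|{}u v _ [M M0 hM] _ [N N0 hN]].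
  exists (`|a| + 1); first by rewrite ltr_wpDl.
  move=> x; rewrite normrM -[leRHS]mulr1 mulrDl mul1r.
  have := cos_max (l x + th) => h; have := normr_ge0 a; nra.
by exists (M + N) => [|x]; [lra|apply: (le_trans (ler_normD _ _)); exact: lerD].
Qed.

Lemma unif_trig_bounded v : unif_trig v -> exists2 M, 0 < M & forall x, `|v x| <= M.
Proof.
move=> /(_ 1 ltr01) [u /trig_poly_bounded [M M0 hM] hv].
exists (M + 1) => [|x]; first lra.
have := ler_normD (v x - u x) (u x); rewrite subrK.
by have := hM x; have := hv x; lra.
Qed.

Lemma trig_unif u : trig_poly u -> unif_trig u.
Proof. by move=> hu e e0; exists u => // x; rewrite subrr normr0 ltW. Qed.

Lemma unif_trig_closed v :
  (forall e, 0 < e -> exists2 u, unif_trig u & forall x, `|v x - u x| <= e) -> unif_trig v.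
Proof.
move=> h e e0; have [u hu uv] := h (e / 2) ltac:(lra).
have [w tw wu] := hu (e / 2) ltac:(lra); exists w => // x.
have := ler_normD (v x - u x) (u x - w x); rewrite addrA subrK.
by have := uv x; have := wu x; lra.
Qed.

Lemma unif_trigD u v : unif_trig u -> unif_trig v -> unif_trig (fun x => u x + v x).
Proof.
move=> hu hv e e0; have [u' tu du] := hu (e / 2) ltac:(lra).
have [v' tv dv] := hv (e / 2) ltac:(lra).
exists (fun x => u' x + v' x); first exact: TrigAdd.
move=> x; rewrite opprD addrACA; have := ler_normD (u x - u' x) (v x - v' x).
by have := du x; have := dv x; lra.
Qed.

Lemma trig_polyZ a u : trig_poly u -> trig_poly (fun x => a * u x).
Proof.
elim=> [b l th Fl|{}u v _ hu _ hv].
  have -> : (fun x => a * (b * cos (l x + th))) = (fun x => (a * b) * cos (l x + th)).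
    by apply/funext => x; rewrite mulrA.
  exact: TrigCos.
have -> : (fun x => a * (u x + v x)) = (fun x => a * u x + a * v x).
  by apply/funext => x; rewrite mulrDr.
exact: TrigAdd.
Qed.

Lemma unif_trigZ a v : unif_trig v -> unif_trig (fun x => a * v x).
Proof.
move=> hv e e0; have [v' tv dv] := hv (e / (`|a| + 1)) ltac:(by rewrite divr_gt0// ltr_wpDl).
exists (fun x => a * v' x); first exact: trig_polyZ.
move=> x; rewrite -mulrBr normrM; have := dv x; rewrite ler_pdivlMr ?ltr_wpDl//.
by have := normr_ge0 (v x - v' x); have := normr_ge0 a; nra.
Qed.

Hypothesis F0 : F (fun=> 0).
Hypothesis FD : forall a l m, F l -> F m -> F (fun x => a * l x + m x).

Lemma trig_cst a : trig_poly (fun=> a).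
Proof.
have -> : (fun _ : T => a) = (fun x : T => a * cos ((fun=> 0) x + 0)).
  by apply/funext => x; rewrite addr0 cos0 mulr1.
exact: TrigCos.
Qed.

Lemma trig_polyM u v : trig_poly u -> trig_poly v -> trig_poly (fun x => u x * v x).
Proof.
move=> hu; elim: hu v => [a l th Fl|{}u1 u2 _ hu1 _ hu2] v; last first.
  move=> hv; under eq_fun do rewrite mulrDl.
  by apply: TrigAdd; [exact: hu1|exact: hu2].
elim=> [b m th' Fm|v1 v2 _ hv1 _ hv2]; last first.
  by under eq_fun do rewrite mulrDr; exact: TrigAdd.
have -> : (fun x => a * cos (l x + th) * (b * cos (m x + th'))) =
  (fun x => (a * b / 2) * cos ((1 * l x + m x) + (th + th')) +
            (a * b / 2) * cos (((-1) * m x + l x) + (th - th'))).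
  apply/funext => x.
  have -> : 1 * l x + m x + (th + th') = (l x + th) + (m x + th') by ring.
  have -> : -1 * m x + l x + (th - th') = (l x + th) - (m x + th') by ring.
  by move: (l x + th) (m x + th') => A B; rewrite cosD cosB; field.
by apply: TrigAdd; apply: TrigCos; exact: FD.
Qed.

Lemma unif_trig_cst a : unif_trig (fun=> a).
Proof. exact/trig_unif/trig_cst. Qed.

Lemma unif_trigM u v : unif_trig u -> unif_trig v -> unif_trig (fun x => u x * v x).
Proof.
move=> hu hv e e0; have [M M0 vM] := unif_trig_bounded hv.
have [u' tu du] := hu (e / (2 * M)) ltac:(by rewrite divr_gt0// mulr_gt0).
(* [N] has to bound the approximation [u'] and not [u], since the error splits as
   [(u - u') v + u' (v - v')]. *)
have [N N0 uN] := trig_poly_bounded tu.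
have [v' tv dv] := hv (e / (2 * N)) ltac:(by rewrite divr_gt0// mulr_gt0).
exists (fun x => u' x * v' x); first exact: trig_polyM.
move=> x; have -> : u x * v x - u' x * v' x = (u x - u' x) * v x + u' x * (v x - v' x) by ring.
apply: (le_trans (ler_normD _ _)); rewrite !normrM.
have := du x; have := dv x; rewrite !ler_pdivlMr ?mulr_gt0//.
have := vM x; have := uN x; have := normr_ge0 (v x - v' x); have := normr_ge0 (u x - u' x).
have := normr_ge0 (v x); have := normr_ge0 (u' x); nra.
Qed.

(* [norm_iter t n] increases to [|t|] for [|t| <= 1]. *)
Fixpoint norm_iter (t : R) (n : nat) : R :=
  if n is n'.+1 then norm_iter t n' + (t ^+ 2 - norm_iter t n' ^+ 2) / 2 else 0.

(** Each step multiplies the error by 1 - (|t| + w) / 2. This factor tends to 1 as t tends to 0, so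
    no geometric rate is uniform; the third bound says that the error is at most |t| / (1 + n |t| /
    2), hence at most 2 / n for all t. *)
Lemma norm_iterP t n : `|t| <= 1 ->
  [/\ 0 <= norm_iter t n, norm_iter t n <= `|t| &
      (`|t| - norm_iter t n) * (1 + n%:R * (`|t| / 2)) <= `|t|].
Proof.
move=> t1; have t0 := normr_ge0 t; have tt : t ^+ 2 = `|t| ^+ 2 by rewrite real_normK// num_real.
elim: n => [|n [h1 h2 h3]] /=; first by split=> //; rewrite mul0r addr0 mulr1 subr0.
set w := norm_iter t n in h1 h2 h3 *.
have e1 : `|t| - (w + (t ^+ 2 - w ^+ 2) / 2) = (`|t| - w) * (1 - (`|t| + w) / 2).
  by rewrite tt; field.
split.
- rewrite tt; nra.
- by rewrite -subr_ge0 e1; apply: mulr_ge0; lra.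
- rewrite e1; apply: le_trans h3; rewrite -mulrA; apply: ler_wpM2l; first lra.
  rewrite -(natr1 n); have : 0 <= n%:R :> R by [].
  move: (n%:R) => N N0; have h4 : 0 <= N * `|t| by rewrite mulr_ge0.
  have : 0 <= N * `|t| * (`|t| + w) by rewrite mulr_ge0//; lra.
  have : 0 <= `|t| * w by rewrite mulr_ge0.
  have : 0 <= `|t| * `|t| by rewrite mulr_ge0.
  nra.
Qed.

(** The uniform closure is an algebra, so it contains the iterates of [v] rescaled to [-1, 1], and
    these converge uniformly. This is the lattice step of Stone-Weierstrass, from which maxima and
    minima follow. *)
Lemma unif_trig_norm v : unif_trig v -> unif_trig (fun x => `|v x|).
Proof.
move=> hv; have [M M0 vM] := unif_trig_bounded hv.
suff : unif_trig (fun x => `|M^-1 * v x|).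
  move=> /(unif_trigZ M); have -> // : (fun x => M * `|M^-1 * v x|) = (fun x => `|v x|).
  apply/funext => x; rewrite normrM gtr0_norm ?invr_gt0// mulrA divff ?gt_eqF//.
  by rewrite mul1r.
apply: unif_trig_closed => e e0.
have hn n : unif_trig (fun x => norm_iter (M^-1 * v x) n).
  elim: n => [|n IH] /=; first exact: unif_trig_cst.
  apply: unif_trigD => //.
  have -> : (fun x => ((M^-1 * v x) ^+ 2 - norm_iter (M^-1 * v x) n ^+ 2) / 2) =
    (fun x => 2^-1 * ((M^-1 * v x) * (M^-1 * v x) +
       (-1) * (norm_iter (M^-1 * v x) n * norm_iter (M^-1 * v x) n))).
    by apply/funext => x; field; rewrite gt_eqF.
  apply: unif_trigZ; apply: unif_trigD; first by apply: unif_trigM; exact: unif_trigZ.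
  by apply: unif_trigZ; exact: unif_trigM.
pose n := Num.Def.archi_bound (2 / e).
have hne : 2 / e < n%:R by apply: archi_boundP; rewrite divr_ge0// ltW.
exists (fun x => norm_iter (M^-1 * v x) n) => // x.
set t := M^-1 * v x; have t1 : `|t| <= 1.
  by rewrite normrM gtr0_norm ?invr_gt0// mulrC ler_pdivrMr// mul1r.
have [h1 h2 h3] := norm_iterP n t1.
rewrite ger0_norm ?subr_ge0//; rewrite ltr_pdivrMr// in hne.
have t0 := normr_ge0 t; move: h1 h2 h3 hne; move: (norm_iter t n) (`|t|) (n%:R) t0 => w s N s0.
move=> h1 h2 h3 hne; rewrite leNgt; apply/negP => h.
have s1 : 0 < s by lra.
have : e * (N * (s / 2)) < s.
  apply: lt_le_trans h3; have : 0 <= N * (s / 2) by apply: mulr_ge0; nra.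
  nra.
nra.
Qed.

Lemma unif_trig_max u v : unif_trig u -> unif_trig v -> unif_trig (fun x => Num.max (u x) (v x)).
Proof.
move=> hu hv.
have -> : (fun x => Num.max (u x) (v x)) =
    (fun x => 2^-1 * ((u x + v x) + `|u x + (-1) * v x|)).
  by apply/funext => x; rewrite mulN1r maxr_absE mulrC.
apply: unif_trigZ; apply: unif_trigD; first exact: unif_trigD.
by apply: unif_trig_norm; apply: unif_trigD => //; exact: unif_trigZ.
Qed.

Lemma unif_trig_min u v : unif_trig u -> unif_trig v -> unif_trig (fun x => Num.min (u x) (v x)).
Proof.
move=> hu hv.
have -> : (fun x => Num.min (u x) (v x)) =
    (fun x => 2^-1 * ((u x + v x) + (-1) * `|u x + (-1) * v x|)).
  by apply/funext => x; rewrite !mulN1r minr_absE mulrC.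
apply: unif_trigZ; apply: unif_trigD; first exact: unif_trigD.
by apply/unif_trigZ/unif_trig_norm; apply: unif_trigD => //; exact: unif_trigZ.
Qed.

End trig_poly.

Section urysohn_trig.
Context {R : realType} {T : topologicalType}.
Variable F : set (T -> R).
Hypothesis F0 : F (fun=> 0).
Hypothesis FD : forall a l m, F l -> F m -> F (fun x => a * l x + m x).
Hypothesis Fc : forall l, F l -> continuous l.

Lemma trig_poly_continuous u : trig_poly F u -> continuous u.
Proof.
elim=> [a l th Fl|{}u v _ cu _ cv] x; last by apply: cvgD; [exact: cu|exact: cv].
apply: cvgMr; apply: continuous_cvg; first exact: continuous_cos.
by apply: cvgD; [exact: Fc|exact: cvg_cst].
Qed.

Lemma unif_trig_continuous v : unif_trig F v -> continuous v.
Proof.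
move=> hv x; apply/cvgrPdist_le => e e0.
have [u tu du] := hv (e / 3) ltac:(lra).
have cu : continuous u := trig_poly_continuous tu.
have := cu x => /cvgrPdist_le /(_ (e / 3) ltac:(lra)).
apply: filterS => y hy.
have -> : v x - v y = (v x - u x) + (u x - u y) + (u y - v y) by ring.
have := ler_normD ((v x - u x) + (u x - u y)) (u y - v y).
have := ler_normD (v x - u x) (u x - u y).
by have := du x; have := du y; rewrite (distrC (v y)); lra.
Qed.

(** Compactness is used twice: for fixed [x] in [K] a finite sum of functions vanishing at [x] is at
    least 1 on [K']; then a finite sum of the functions max(0, 1 - a) is at least 1/2 on [K] and
    still 0 on [K']. Doubling and truncating at 1 gives exact values. *)
Lemma urysohn_trig (K K' : set T) : compact K -> compact K' ->
  (forall x y, K x -> K' y -> exists2 l, F l & l x != l y) ->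
  exists v, [/\ unif_trig F v, (forall x, 0 <= v x <= 1),
    (forall x, K x -> v x = 1) & (forall x, K' x -> v x = 0)].
Proof.
move=> cK cK' sep.
have step x : K x -> exists a, [/\ unif_trig F a, (forall y, 0 <= a y), a x = 0 &
    forall y, K' y -> 1 <= a y].
  move=> Kx.
  (* The compact induction passes through neighbourhoods that are not contained in [K'], hence the
     intersection with [K'] in the property. *)
  suff : exists a, [/\ unif_trig F a, (forall y, 0 <= a y), a x = 0 &
      forall y, (K' y /\ K' y) -> 1 <= a y].
    by move=> [a [a1 a2 a3 a4]]; exists a; split=> // y Ky; exact: a4.
  apply: (@compact_induction _ K' (fun A => exists a, [/\ unif_trig F a,
      (forall y, 0 <= a y), a x = 0 & forall y, (A y /\ K' y) -> 1 <= a y])) => //.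
  - by exists (fun=> 0); split=> // [|y []//]; exact: unif_trig_cst.
  - move=> A B [a [a1 a2 a3 a4]] [b [b1 b2 b3 b4]].
    exists (fun y => a y + b y); split.
    + exact: unif_trigD.
    + by move=> y; rewrite addr_ge0.
    + by rewrite a3 b3 addr0.
    + move=> y [[Ay|By] Ky]; first by have := a4 y (conj Ay Ky); have := b2 y; lra.
      by have := b4 y (conj By Ky); have := a2 y; lra.
  - by move=> A B AB [a [a1 a2 a3 a4]]; exists a; split=> // y [/AB]By Ky; exact: a4.
  - move=> y Ky; have [l Fl lxy] := sep x y Kx Ky.
    (* With this frequency, [a z = 1 - cos (c (l z - l x))] is nonnegative, is 0 at [x] and is 1 -
       cos pi = 2 at [y]. *)
    pose c := pi / (l y - l x).
    pose a z := 1 + (-1) * cos ((c * l z + (fun=> 0) z) + - (c * l x)).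
    have ua : unif_trig F a.
      apply: unif_trigD; first exact: unif_trig_cst.
      by apply: trig_unif; apply: TrigCos; exact: FD.
    have ay : a y = 2.
      rewrite /a addr0 -mulrBr /c divfK ?cospi; first lra.
      by rewrite subr_eq0 eq_sym.
    exists [set z | 1 < a z].
      have ca : continuous a := unif_trig_continuous ua.
      by apply: (cvgr_gt _ (ca y)); rewrite ay; lra.
    exists a; split=> //.
    + by move=> z; rewrite /a; have := cos_le1 ((c * l z + (fun=> 0) z) + - (c * l x)); lra.
    + by rewrite /a addr0 subrr cos0; lra.
    + by move=> z [/ltW].
have [b [b1 b2 b3 b4]] : exists b, [/\ unif_trig F b, (forall y, 0 <= b y),
    (forall y, K' y -> b y = 0) & forall y, K y -> 2^-1 <= b y].
  apply: (@compact_induction _ K (fun A => exists b, [/\ unif_trig F b, (forall y, 0 <= b y),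
    (forall y, K' y -> b y = 0) & forall y, A y -> 2^-1 <= b y])) => //.
  - by exists (fun=> 0); split=> //; exact: unif_trig_cst.
  - move=> A B [a [a1 a2 a3 a4]] [b [b1 b2 b3 b4]].
    exists (fun y => a y + b y); split.
    + exact: unif_trigD.
    + by move=> y; rewrite addr_ge0.
    + by move=> y Ky; rewrite a3// b3// addr0.
    + move=> y [Ay|By]; first by have := a4 y Ay; have := b2 y; lra.
      by have := b4 y By; have := a2 y; lra.
  - by move=> A B AB [a [a1 a2 a3 a4]]; exists a; split=> // y /AB; exact: a4.
  - move=> x Kx; have [a [a1 a2 a3 a4]] := step x Kx.
    pose b y := Num.max ((fun=> 0) y) (1 + (-1) * a y).
    have ub : unif_trig F b.
      apply: unif_trig_max => //; first exact: unif_trig_cst.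
      by apply: unif_trigD; [exact: unif_trig_cst|exact: unif_trigZ].
    exists [set y | 2^-1 < b y].
      have cb : continuous b := unif_trig_continuous ub.
      apply: (cvgr_gt _ (cb x)).
      by rewrite /b a3 mulr0 addr0 lt_max; apply/orP; right; lra.
    exists b; split=> //.
    + by move=> y; rewrite /b le_max lexx.
    + by move=> y /a4 h; rewrite /b; apply/max_idPl; lra.
    + by move=> y /ltW.
exists (fun y => Num.min ((fun=> 1) y) (2 * b y)); split.
- by apply: unif_trig_min => //; [exact: unif_trig_cst|exact: unif_trigZ].
- by move=> x; rewrite le_min ge_min lexx ler01/= andbT mulr_ge0.
- by move=> x /b4 h; apply/min_idPl; lra.
- by move=> x /b3 ->; rewrite mulr0; apply/min_idPr; lra.
Qed.

End urysohn_trig.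

(** * Density of trigonometric polynomials for Radon measures *)

Section bounded_measurable.
Context d (T : measurableType d) (R : realType) (P : probability T R).
Implicit Types f g : T -> R.

Definition bounded_measurable f :=
  measurable_fun [set: T] f /\ exists M, forall x, `|f x| <= M.

Lemma bounded_measurable_integrable f : bounded_measurable f ->
  P.-integrable [set: T] (EFin \o f).
Proof.
move=> [mf [M fM]].
apply: (@le_integrable _ _ _ P _ measurableT _ (EFin \o cst M)).
- exact/measurable_EFinP.
- by move=> x _ /=; rewrite lee_fin (le_trans (fM x))// ler_norm.
- exact: finite_measure_integrable_cst.
Qed.

Lemma bounded_measurable_cst (c : R) : bounded_measurable (fun=> c).
Proof. by split; [exact: measurable_cst|exists `|c|]. Qed.

Lemma bounded_measurableD f g : bounded_measurable f -> bounded_measurable g ->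
  bounded_measurable (fun x => f x + g x).
Proof.
move=> [mf [M fM]] [mg [N gN]]; split; first exact: measurable_funD.
by exists (M + N) => x; rewrite (le_trans (ler_normD _ _))// lerD.
Qed.

Lemma bounded_measurableM f g : bounded_measurable f -> bounded_measurable g ->
  bounded_measurable (fun x => f x * g x).
Proof.
move=> [mf [M fM]] [mg [N gN]]; split; first exact: measurable_funM.
by exists (M * N) => x; rewrite normrM ler_pM.
Qed.

Lemma bounded_measurableZ c f : bounded_measurable f ->
  bounded_measurable (fun x => c * f x).
Proof. by move=> hf; apply: bounded_measurableM => //; exact: bounded_measurable_cst. Qed.

Lemma bounded_measurableB f g : bounded_measurable f -> bounded_measurable g ->
  bounded_measurable (fun x => f x - g x).
Proof.
move=> hf hg; under eq_fun do rewrite -mulN1r.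
by apply: bounded_measurableD => //; exact: bounded_measurableZ.
Qed.

Lemma bounded_measurable_indic A : measurable A -> bounded_measurable \1_A.
Proof.
move=> mA; split; first exact: measurable_indic.
by exists 1 => x; rewrite indicE; case: (_ \in _); rewrite ?normr1 ?normr0.
Qed.

Lemma Rintegral_prob_cst (c : R) : \int[P]_x c = c.
Proof.
by rewrite /Rintegral integral_cst// [X in (_ * X)%E](@probability_setT _ _ _ P) mule1.
Qed.

Lemma Rintegral_prob_indic A : measurable A -> \int[P]_x \1_A x = fine (P A).
Proof. by move=> mA; rewrite /Rintegral integral_indic// setIT. Qed.

Lemma le_norm_Rintegral f (M : R) : P.-integrable setT (EFin \o f) ->
  (forall x, `|f x| <= M) -> `|\int[P]_x f x| <= M.
Proof.
move=> fi fM; apply: (le_trans (le_normr_Rintegral measurableT fi)).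
rewrite -[leRHS]Rintegral_prob_cst; apply: le_Rintegral => //; first exact: (integrable_abse fi).
by apply: bounded_measurable_integrable; exact: bounded_measurable_cst.
Qed.

Lemma Rintegral_norm_le0 f (e : R) : 0 <= e -> measurable_fun setT f ->
  (\int[P]_x `|f x|%:E <= e%:E)%E -> P.-integrable setT (EFin \o f).
Proof.
move=> e0 mf fe; apply/integrableP; split; first exact/measurable_EFinP.
by under eq_integral do rewrite abse_EFin; rewrite (le_lt_trans fe)// ltry.
Qed.

Lemma le_norm_Rintegral_norm f (e : R) : 0 <= e -> measurable_fun setT f ->
  (\int[P]_x `|f x|%:E <= e%:E)%E -> `|\int[P]_x f x| <= e.
Proof.
move=> e0 mf fe; have fi := Rintegral_norm_le0 e0 mf fe.
apply: (le_trans (le_normr_Rintegral measurableT fi)).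
by rewrite /Rintegral -lee_fin fineK//; apply/integrable_fin_num => //; exact: (integrable_abse fi).
Qed.

End bounded_measurable.

(** * Mixtures of probability kernels *)

Section kernel_mixture.
Context d1 d2 (T1 : measurableType d1) (T2 : measurableType d2) (R : realType).
Variables (P : probability T1 R) (k : T1 -> {measure set T2 -> \bar R}).
Hypothesis k1 : forall x, k x setT = 1%E.
Hypothesis mk : forall U, measurable U -> measurable_fun setT (k ^~ U).

Let kerl (_ : unit) : {measure set T1 -> \bar R} := P.

Let measurable_kerl U : measurable U -> measurable_fun setT (kerl ^~ U).
Proof. by move=> _; exact: measurable_cst. Qed.

HB.instance Definition _ := isKernel.Build _ _ _ _ _ kerl measurable_kerl.

Let kerl1 x : kerl x setT = 1%E. Proof. exact: probability_setT. Qed.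

HB.instance Definition _ := Kernel_isProbability.Build _ _ _ _ _ kerl kerl1.

Let kerr (xy : unit * T1) : {measure set T2 -> \bar R} := k xy.2.

Let measurable_kerr U : measurable U -> measurable_fun setT (kerr ^~ U).
Proof. by move=> mU; apply: (measurableT_comp (mk mU)); exact: measurable_snd. Qed.

HB.instance Definition _ := isKernel.Build _ _ _ _ _ kerr measurable_kerr.

Let kerr1 x : kerr x setT = 1%E. Proof. exact: k1. Qed.

HB.instance Definition _ := Kernel_isProbability.Build _ _ _ _ _ kerr kerr1.

(** The law of a point drawn from [k x] when [x] is drawn from [P]. It is written as a composition
    of kernels out of a one-point space, so that integration against it is the formula for composed
    kernels. *)
Definition mixture : {measure set T2 -> \bar R} := kcomp kerl kerr tt.

Lemma mixtureE U : mixture U = (\int[P]_x k x U)%E.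
Proof. by []. Qed.

Lemma ge0_integral_mixture (f : T2 -> \bar R) : (forall z, 0 <= f z)%E ->
  measurable_fun setT f -> (\int[mixture]_z f z = \int[P]_x \int[k x]_z f z)%E.
Proof. by move=> f0 mf; exact: (@integral_kcomp _ _ _ _ _ _ _ kerl kerr tt f). Qed.

End kernel_mixture.

Section borel_facts.
Context {R : realType} {X : tvsType R}.

Lemma open_borel (U : set X) : open U -> measurable (U : set (borel X)).
Proof. by move=> oU; exact: sub_sigma_algebra. Qed.

Lemma closed_borel (C : set X) : closed C -> measurable (C : set (borel X)).
Proof. by move=> cC; rewrite -(setCK C); apply: measurableC; apply: (@open_borel (~` C)); exact: closed_openC. Qed.

Lemma compact_borel (K : set X) : hausdorff_space X -> compact K ->
  measurable (K : set (borel X)).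
Proof. by move=> hX cK; apply: (@closed_borel K); exact: compact_closed. Qed.

Lemma continuous_borel (f : X -> R) : continuous f ->
  measurable_fun [set: borel X] (f : borel X -> R).
Proof.
move=> cf; apply: (measurability _ (RGenOInfty.measurableE R)) => /= _ [_ [a ->] <-].
rewrite setTI; apply: (@open_borel (f @^-1` `]a, +oo[)).
apply: open_comp; first by move=> x _; exact: cf.
rewrite (_ : `]a, +oo[%classic = [set y | a < y]); first exact: open_gt.
by apply/seteqP; split=> y /=; rewrite in_itv/= andbT.
Qed.

Lemma continuous_borel2 (f : X -> X) : continuous f ->
  measurable_fun [set: borel X] (f : borel X -> borel X).
Proof.
move=> cf; apply: (measurability (@open X : set (set (borel X))) erefl) => //= _ [U oU <-].
by rewrite setTI; apply: (@open_borel (f @^-1` U)); apply: open_comp.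
Qed.

Lemma lsc_borel (f : X -> \bar R) : (forall c : R, open [set x | c%:E < f x]%E) ->
  measurable_fun [set: borel X] (f : borel X -> \bar R).
Proof.
move=> h; apply: (measurability _ (ErealGenOInfty.measurableE R)) => /= _ [_ [a ->] <-].
rewrite setTI; apply: open_borel; rewrite (_ : _ @^-1` _ = [set x | a%:E < f x]%E)//.
by apply/seteqP; split=> x /=; rewrite in_itv/= andbT.
Qed.

Lemma dual0 : dual (fun _ : X => 0 : R).
Proof. by split=> [a x y|x]; [rewrite mulr0 addr0|exact: cvg_cst]. Qed.

Lemma dual_lincomb (a : R) (l m : X -> R) : dual l -> dual m ->
  dual (fun x => a * l x + m x).
Proof.
move=> [sl cl] [sm cm]; split=> [b x y|x]; first by rewrite sl sm; ring.
by apply: cvgD; [apply: cvgMr; exact: cl|exact: cm].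
Qed.

Lemma dual_continuous (l : X -> R) : dual l -> continuous l. Proof. by case. Qed.

Lemma dual_measurable (l : X -> R) : dual l ->
  measurable_fun [set: borel X] (l : borel X -> R).
Proof. by move=> [_ cl]; exact: continuous_borel. Qed.

Lemma trig_bounded_measurable (u : X -> R) : trig_poly dual u ->
  bounded_measurable (u : borel X -> R).
Proof.
move=> tu; split; last by have [M _ hM] := trig_poly_bounded tu; exists M.
by apply: continuous_borel; apply: (trig_poly_continuous _ tu) => l; exact: dual_continuous.
Qed.

Lemma unif_trig_bounded_measurable (u : X -> R) : unif_trig dual u ->
  bounded_measurable (u : borel X -> R).
Proof.
move=> tu; split; last by have [M _ hM] := unif_trig_bounded tu; exists M.
by apply: continuous_borel; apply: (unif_trig_continuous _ tu) => l; exact: dual_continuous.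
Qed.

Lemma urysohn_dual (hX : hausdorff_space X) (K K' : set X) : compact K -> compact K' ->
  [disjoint K & K'] ->
  exists v : X -> R, [/\ unif_trig dual v, (forall x, 0 <= v x <= 1),
    (forall x, K x -> v x = 1) & (forall x, K' x -> v x = 0)].
Proof.
move=> cK cK' KK'; apply: urysohn_trig => //.
- exact: dual0.
- exact: dual_lincomb.
- exact: dual_continuous.
- move=> x y Kx Ky.
  have xy : x - y != 0.
    rewrite subr_eq0; apply/eqP => xy; rewrite -xy in Ky.
    by have : (K `&` K') x by []; move/disj_setPS : KK' => /[apply].
  have [l dl lxy] := dual_separates hX xy; exists l => //.
  apply: contra lxy => /eqP lxy; have [sl _] := dl.
  by have := sl (-1) y x; rewrite scaleN1r (addrC (- y)) => ->; rewrite lxy; apply/eqP; ring.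
Qed.

End borel_facts.

Import HBSimple.

Section radon_density.
Context {R : realType} {X : tvsType R} (hX : hausdorff_space X).
Variable gamma : probability (borel X) R.
Hypothesis gamma_radon : radon gamma.

(** Compact subsets of [B] and of its complement exhaust both up to e / 2. A Urysohn function for
    the two compacts differs from the indicator only outside them, and by at most 1. *)
Lemma unif_trig_approx_indic (B : set X) (e : R) : measurable (B : set (borel X)) -> 0 < e ->
  exists2 v : X -> R, unif_trig dual v & (\int[gamma]_x (`|\1_B x - v x|)%:E <= e%:E)%E.
Proof.
move=> mB e0; have mB' := measurableC mB.
have [K [cK KB Ke]] := @gamma_radon _ (e / 2) mB ltac:(lra).
have [K' [cK' KB' Ke']] := @gamma_radon _ (e / 2) mB' ltac:(lra).
have KK' : [disjoint K & K'] by apply/disj_setPS => x [/KB ? /KB'].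
have [v [tv v01 v1 v0]] := urysohn_dual hX cK cK' KK'.
exists v => //.
have mK := compact_borel hX cK; have mK' := compact_borel hX cK'.
have mBK : measurable (B `\` K : set (borel X)) by exact: measurableD.
have mBK' : measurable (~` B `\` K' : set (borel X)) by exact: measurableD.
have [mv _] := unif_trig_bounded_measurable tv.
apply: (@le_trans _ _ (\int[gamma]_x ((\1_(B `\` K) x)%:E + (\1_(~` B `\` K') x)%:E))%E).
  apply: ge0_le_integral => //.
  - apply/measurable_EFinP; apply: measurableT_comp => //.
    by apply: measurable_funB => //; exact: measurable_indic.
  - by apply: emeasurable_funD; apply/measurable_EFinP; exact: measurable_indic.
  - move=> x _; rewrite -EFinD lee_fin !indicE !in_setD.
    have /andP[v0' v1'] := v01 x.
    have [Bx|Bx] := boolP (x \in B).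
      have -> : (x \in ~` B) = false by rewrite in_setC Bx.
      rewrite /= addr0; have [Kx|Kx] /= := boolP (x \in K).
        by rewrite v1 ?subrr ?normr0//; exact/set_mem.
      by rewrite ger0_norm; lra.
    have -> : (x \in ~` B) = true by rewrite in_setC Bx.
    rewrite /= add0r; have [Kx|Kx] /= := boolP (x \in K').
      by rewrite (v0 _ (set_mem Kx)) ?subr0 ?oppr0 normr0 addr0.
    by rewrite ?sub0r normrN ger0_norm//; lra.
rewrite ge0_integralD//; [|by apply/measurable_EFinP; exact: measurable_indic..].
rewrite !integral_indic// !setIT.
have -> : e%:E = ((e / 2)%:E + (e / 2)%:E)%E by rewrite -EFinD; congr EFin; lra.
by apply: leeD; exact: ltW.
Qed.

Lemma norm_integralD_le (f g : borel X -> R) (a b : R) :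
  measurable_fun setT f -> measurable_fun setT g ->
  (\int[gamma]_x (`|f x|)%:E <= a%:E)%E -> (\int[gamma]_x (`|g x|)%:E <= b%:E)%E ->
  (\int[gamma]_x (`|f x + g x|)%:E <= (a + b)%:E)%E.
Proof.
move=> mf mg fa gb.
have mfn : measurable_fun setT (fun x => (`|f x|)%:E).
  by apply/measurable_EFinP; exact: measurableT_comp.
have mgn : measurable_fun setT (fun x => (`|g x|)%:E).
  by apply/measurable_EFinP; exact: measurableT_comp.
apply: (@le_trans _ _ (\int[gamma]_x ((`|f x|)%:E + (`|g x|)%:E))%E).
  apply: ge0_le_integral => //.
  - apply/measurable_EFinP; apply: measurableT_comp => //.
    exact: measurable_funD.
  - exact: emeasurable_funD.
  - by move=> x _; rewrite -EFinD lee_fin ler_normD.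
by rewrite ge0_integralD// EFinD leeD.
Qed.

Lemma unif_trig_dense (w : borel X -> R) (e : R) : gamma.-integrable setT (EFin \o w) ->
  0 < e ->
  exists2 v : X -> R, unif_trig dual v & (\int[gamma]_x (`|w x - v x|)%:E <= e%:E)%E.
Proof.
move=> iw e0.
have mw : measurable_fun setT w by case/integrableP : iw => /measurable_EFinP.
have [g [ig _ /fine_cvgP[gfin]]] := approximation_sfun_integrable measurableT iw.
move=> /cvgrPdist_lt /(_ (e / 2) ltac:(lra)) => gcvg.
have [n [gn1 gn2]] : exists n, (\int[gamma]_x `|(EFin \o w) x - (g n x)%:E| \is a fin_num)%E /\
   `|0 - fine (\int[gamma]_x `|(EFin \o w) x - (g n x)%:E|)%E| < e / 2.
  by have [n [? ?]] := filter_ex (filterI gfin gcvg); exists n.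
have {}gn : (\int[gamma]_x (`|w x - g n x|)%:E <= (e / 2)%:E)%E.
  rewrite sub0r normrN in gn2; under eq_integral do rewrite -abse_EFin EFinB.
  by rewrite -(fineK gn1) lee_fin; apply: le_trans (ltW gn2); exact: ler_norm.
have mgn : measurable_fun setT (g n) by [].
suff [v tv hv] : exists2 v : X -> R, unif_trig dual v &
    (\int[gamma]_x (`|g n x - v x|)%:E <= (e / 2)%:E)%E.
  exists v => //.
  have [mv _] := unif_trig_bounded_measurable tv.
  have -> : e = e / 2 + e / 2 by lra.
  under eq_integral.
    move=> x _; have -> : w x - v x = (w x - g n x) + (g n x - v x) by ring.
    over.
  by apply: norm_integralD_le => //; exact: measurable_funB.
set h := g n.
(* An enumeration of the values of the simple function turns it into a finite sum, to which
   induction on the number of terms applies. *)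
have [N [r hE]] : exists N (r : nat -> R), forall x : X,
    h x = \sum_(i < N) (r i * \1_(h @^-1` [set r i]) x).
  by eexists; exists (nth 0 (finmap.enum_fset (fset_set (range h)))) => x; exact: (fimfunEord h x).
suff [v tv hv] : exists2 v : X -> R, unif_trig dual v &
    (\int[gamma]_x (`|\sum_(i < N) (r i * \1_(h @^-1` [set r i]) x) - v x|)%:E <= (e / 2)%:E)%E.
  by exists v => //; under eq_integral do rewrite hE.
have He0 : 0 < e / 2 by lra.
clear gcvg gn2 gn; move: (e / 2) He0 => {}e {}e0.
have mh a : measurable (h @^-1` [set a]) by [].
elim: N {hE} e e0 => [|N IH] e e0.
  exists (fun=> 0); first exact: (unif_trig_cst dual0).
  by under eq_integral do rewrite big_ord0 subrr normr0; rewrite integral0 lee_fin ltW.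
have [v tv hv] := IH (e / 2) ltac:(lra).
(* The [+ 1] in the accuracy keeps it positive when the coefficient [r N] is 0. *)
have [v' tv' hv'] := @unif_trig_approx_indic (h @^-1` [set r N]) (e / 2 / (`|r N| + 1)) (mh _)
  ltac:(by rewrite divr_gt0 ?ltr_wpDl//; lra).
exists (fun x => v x + r N * v' x).
  by apply: unif_trigD => //; exact: unif_trigZ.
have [mv _] := unif_trig_bounded_measurable tv.
have [mv' _] := unif_trig_bounded_measurable tv'.
under eq_integral.
  move=> x _; rewrite big_ord_recr/= opprD addrACA -mulrBr; over.
have -> : e = e / 2 + e / 2 by lra.
have mi A : measurable A -> measurable_fun setT (\1_A : borel X -> R).
  by move=> mA; exact: measurable_indic.
apply: norm_integralD_le => //.
- apply: measurable_funB => //; apply: measurable_sum => i.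
  by apply: measurable_funM => //; exact: mi.
- by apply: measurable_funM => //; apply: measurable_funB => //; exact: mi.
under eq_integral do rewrite normrM EFinM.
rewrite ge0_integralZl_EFin//; last first.
  by apply/measurable_EFinP; apply: measurableT_comp => //; apply: measurable_funB => //; exact: mi.
apply: (@le_trans _ _ (`|r N|%:E * (e / 2 / (`|r N| + 1))%:E)%E).
  by apply: lee_wpmul2l => //; rewrite lee_fin.
rewrite -EFinM lee_fin mulrCA -[leRHS]mulr1 ler_wpM2l//; first lra.
by rewrite ler_pdivrMr ?ltr_wpDl// mul1r lerDl.
Qed.

Lemma trig_dense (w : borel X -> R) (e : R) : gamma.-integrable setT (EFin \o w) ->
  0 < e ->
  exists2 v : X -> R, trig_poly dual v & (\int[gamma]_x (`|w x - v x|)%:E <= e%:E)%E.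
Proof.
move=> iw e0; have [v tv hv] := unif_trig_dense iw (e := e / 2) ltac:(lra).
have mw : measurable_fun setT w by case/integrableP : iw => /measurable_EFinP.
have [u tu hu] := tv (e / 2) ltac:(lra).
exists u => //.
have [mv _] := unif_trig_bounded_measurable tv.
have [mu _] := trig_bounded_measurable tu.
have -> : e = e / 2 + e / 2 by lra.
under eq_integral.
  move=> x _; have -> : w x - u x = (w x - v x) + (v x - u x) by ring.
  over.
apply: norm_integralD_le => //; try exact: measurable_funB.
rewrite -[leRHS]mule1 -(@probability_setT _ _ _ gamma) -integral_cst//.
apply: ge0_le_integral => //.
- by apply/measurable_EFinP; apply: measurableT_comp => //; exact: measurable_funB.
- by move=> x _; rewrite lee_fin.
Qed.

(** Truncation to [-N, N] stays in the uniform closure, thanks to its lattice operations, and does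
    not increase the distance to [w]. Only the final uniform approximation can leave the
    interval. *)
Lemma trig_dense_bounded (w : borel X -> R) (N e : R) : measurable_fun setT w ->
  (forall x, `|w x| <= N) -> 0 < e ->
  exists v : X -> R, [/\ trig_poly dual v, (forall x, `|v x| <= N + e) &
    (\int[gamma]_x (`|w x - v x|)%:E <= e%:E)%E].
Proof.
move=> mw wN e0.
have iw : gamma.-integrable setT (EFin \o w).
  by apply: bounded_measurable_integrable; split=> //; exists N.
have [v tv hv] := unif_trig_dense iw (e := e / 2) ltac:(lra).
have N0 : 0 <= N by apply: le_trans (wN point); exact: normr_ge0.
pose v' x := Num.max ((fun=> - N) x) (Num.min ((fun=> N) x) (v x)).
have tv' : unif_trig dual v'.
  have d0 := @dual0 R X; have dD := @dual_lincomb R X.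
  by apply: unif_trig_max => //; [|apply: unif_trig_min => //]; exact: unif_trig_cst.
have [u tu hu] := tv' (e / 2) ltac:(lra).
exists u; split=> //.
  move=> x; have := hu x; have : `|v' x| <= N.
    by rewrite ler_norml /v' le_max lexx/= ge_max ge_min lexx/=; lra.
  by have := ler_normD (v' x) (u x - v' x); rewrite subrKC (distrC (u x)); lra.
have [mv _] := unif_trig_bounded_measurable tv.
have [mv' _] := unif_trig_bounded_measurable tv'.
have [mu _] := trig_bounded_measurable tu.
have -> : e = e / 2 + e / 2 by lra.
under eq_integral.
  move=> x _; have -> : w x - u x = (w x - v' x) + (v' x - u x) by ring.
  over.
apply: norm_integralD_le => //; try exact: measurable_funB.
- apply: le_trans hv; apply: ge0_le_integral => //.
  + by apply/measurable_EFinP; apply: measurableT_comp => //; exact: measurable_funB.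
  + by apply/measurable_EFinP; apply: measurableT_comp => //; exact: measurable_funB.
  + move=> x _; rewrite lee_fin /v'; have := wN x; rewrite ler_norml => /andP[w1 w2].
    have [h1|h1] := leP N (v x).
      by rewrite (max_idPr _) ?ler0_norm//; lra.
    have [h2|h2] := leP (- N) (v x) => //.
    by rewrite !ger0_norm//; lra.
- rewrite -[leRHS]mule1 -(@probability_setT _ _ _ gamma) -integral_cst//.
  apply: ge0_le_integral => //.
  + by apply/measurable_EFinP; apply: measurableT_comp => //; exact: measurable_funB.
  + by move=> x _; rewrite lee_fin.
Qed.

End radon_density.

Section bounded_Rintegral.
Context d (T : measurableType d) (R : realType) (P : probability T R).
Implicit Types f g : T -> R.

Lemma bRintegralD f g : bounded_measurable f -> bounded_measurable g ->
  \int[P]_x (f x + g x) = \int[P]_x f x + \int[P]_x g x.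
Proof. by move=> bf bg; apply: RintegralD => //; exact: bounded_measurable_integrable. Qed.

Lemma bRintegralB f g : bounded_measurable f -> bounded_measurable g ->
  \int[P]_x (f x - g x) = \int[P]_x f x - \int[P]_x g x.
Proof. by move=> bf bg; apply: RintegralB => //; exact: bounded_measurable_integrable. Qed.

Lemma bRintegralZ c f : bounded_measurable f ->
  \int[P]_x (c * f x) = c * \int[P]_x f x.
Proof. by move=> bf; apply: RintegralZl => //; exact: bounded_measurable_integrable. Qed.

Lemma le_bRintegral f g : bounded_measurable f -> bounded_measurable g ->
  (forall x, f x <= g x) -> \int[P]_x f x <= \int[P]_x g x.
Proof.
by move=> bf bg fg; apply: le_Rintegral => //; exact: bounded_measurable_integrable.
Qed.

Lemma bounded_measurable_sum n (F : nat -> T -> R) :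
  (forall i, bounded_measurable (F i)) -> bounded_measurable (fun x => \sum_(i < n) F i x).
Proof.
move=> hF; elim: n => [|n IH].
  by under eq_fun do rewrite big_ord0; exact: bounded_measurable_cst.
by under eq_fun do rewrite big_ord_recr/=; exact: bounded_measurableD.
Qed.

Lemma bRintegral_sum n (F : nat -> T -> R) : (forall i, bounded_measurable (F i)) ->
  \int[P]_x (\sum_(i < n) F i x) = \sum_(i < n) \int[P]_x F i x.
Proof.
move=> hF; elim: n => [|n IH].
  by under eq_Rintegral do rewrite big_ord0; rewrite Rintegral_prob_cst big_ord0.
under eq_Rintegral do rewrite big_ord_recr/=.
rewrite bRintegralD//; last exact: bounded_measurable_sum.
by rewrite IH big_ord_recr.
Qed.

Lemma EFin_bRintegral f : bounded_measurable f ->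
  (\int[P]_x f x)%:E = (\int[P]_x (f x)%:E)%E.
Proof.
by move=> bf; rewrite fineK//; apply: integrable_fin_num => //; exact: bounded_measurable_integrable.
Qed.

Lemma prob_fineK A : measurable A -> (fine (P A))%:E = P A.
Proof. by move=> mA; rewrite fineK// fin_num_measure. Qed.

Lemma fine_prob_ge0 A : 0 <= fine (P A). Proof. exact: fine_ge0. Qed.

Lemma fine_prob_le1 A : measurable A -> fine (P A) <= 1.
Proof. by move=> mA; rewrite -lee_fin prob_fineK// probability_le1. Qed.

Lemma le_fine_prob A B : measurable A -> measurable B -> A `<=` B ->
  fine (P A) <= fine (P B).
Proof. by move=> mA mB AB; rewrite -lee_fin !prob_fineK// le_measure ?inE. Qed.

Lemma fine_probC A : measurable A -> fine (P (~` A)) = 1 - fine (P A).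
Proof.
move=> mA; apply: EFin_inj; rewrite EFinB !prob_fineK//; last exact: measurableC.
exact: probability_setC.
Qed.

Lemma fine_probD A B : measurable A -> measurable B -> B `<=` A ->
  fine (P (A `\` B)) = fine (P A) - fine (P B).
Proof.
move=> mA mB BA; have mAB := measurableD mA mB.
apply: EFin_inj; rewrite EFinB !prob_fineK// measureD//.
  by rewrite setIidr.
by apply: le_lt_trans (probability_le1 P mA) _; rewrite ltry.
Qed.

End bounded_Rintegral.

(** * Maps of a product that preserve a Radon measure *)

(** Discrete layer cake: with the next lemma, a number is bracketed between a count of integer
    thresholds and that count plus 1. Integrals of slice masses are thus compared with measures of
    level sets. *)
Lemma sum_nat_threshold_le (R : realType) n (b : nat -> bool) (s : R) : 0 <= s ->
  (forall k, (k < n)%N -> b k -> k.+1%:R <= s) -> \sum_(k < n) (b k)%:R <= s.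
Proof.
move=> s0; elim: n => [|n IH] h; first by rewrite big_ord0.
rewrite big_ord_recr/=; have [bn|bn] := boolP (b n); last first.
  by rewrite addr0; apply: IH => k kn; apply: h; exact: ltnW.
apply: le_trans (h n _ bn) => //; rewrite -natr1 lerD2r.
apply: (@le_trans _ _ (\sum_(k < n) 1)); last by rewrite sumr_const card_ord.
by apply: ler_sum => i _; case: (b i).
Qed.

Lemma le_sum_nat_threshold (R : realType) n (s : R) : s <= n%:R ->
  s <= 1 + \sum_(k < n) (k.+1%:R < s)%R%:R.
Proof.
elim: n => [|n IH] sn; first by rewrite big_ord0; lra.
rewrite big_ord_recr/=; have [/IH h|h] := leP s n%:R.
  by apply: (le_trans h); rewrite lerD2l lerDl ler0n.
apply: (le_trans sn); rewrite -[leLHS](natr1 n) [leLHS]addrC lerD2l.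
apply: (@le_trans _ _ (\sum_(k < n) 1)); first by rewrite sumr_const card_ord.
apply: (@le_trans _ _ (\sum_(k < n) (k.+1%:R < s)%R%:R)); last by rewrite lerDl ler0n.
apply: ler_sum => i _; have -> // : i.+1%:R < s.
by apply: le_lt_trans h; rewrite ler_nat.
Qed.

Lemma open_nbhs_self (T : topologicalType) (A : set T) :
  (forall x, A x -> nbhs x A) -> open A.
Proof. by move=> h; rewrite openE => x /h. Qed.

Section slices.
Context {R : realType} {X : tvsType R} (hX : hausdorff_space X).
Variable gamma : probability (borel X) R.
Hypothesis gamma_radon : radon gamma.
Variable m : X -> X -> X.
Hypothesis m_cont : continuous (fun z : X * X => m z.1 z.2).

Lemma slice_continuous x : continuous (m x).
Proof.
move=> y; apply: (@continuous_comp _ _ _ (fun y => (x, y)) (fun z => m z.1 z.2)).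
  by apply: cvg_pair; [exact: cvg_cst|exact: cvg_id].
exact: m_cont.
Qed.

(** The tube lemma, for the open preimage of [U] under the joint map. *)
Lemma slice_tube x K U : compact K -> open U -> (forall y, K y -> U (m x y)) ->
  exists2 V, nbhs x V & forall x' y, V x' -> K y -> U (m x' y).
Proof.
move=> cK oU hU.
have h : forall y, K y -> \forall y' \near y & x' \near x, U (m x' y').
  move=> y Ky; have [[A B] /= [nA nB] AB] : nbhs (x, y) ((fun z => m z.1 z.2) @^-1` U).
    by apply: m_cont; apply: open_nbhs_nbhs; split=> //; exact: hU.
  by exists (B, A) => //= -[b a] /= [? ?]; apply: (AB (a, b)).
exists (fun x' => K `<=` (fun y => U (m x' y))).
  exact: ((compact_near_coveringP K).1 cK X (nbhs x) (fun x' y => U (m x' y)) (nbhs_filter x) h).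
by move=> x' y; exact.
Qed.

Lemma inner_compact (B : set X) (c : R) : measurable (B : set (borel X)) -> c < fine (gamma B) ->
  exists K, [/\ compact K, K `<=` B & c < fine (gamma K)].
Proof.
move=> mB cB; have [K [cK KB]] := gamma_radon mB (e := fine (gamma B) - c) ltac:(lra).
have mK := compact_borel hX cK; move=> h; exists K; split=> //.
have := fine_probD gamma mB mK KB.
have : fine (gamma (B `\` K)) < fine (gamma B) - c.
  by rewrite -lte_fin prob_fineK//; exact: measurableD.
lra.
Qed.

Lemma open_slice (U : set X) x : open U -> open [set y | U (m x y)].
Proof. by move=> oU; apply: open_comp => // y _; exact: slice_continuous. Qed.

Lemma open_slice_borel (U : set X) x : open U ->
  measurable ([set y | U (m x y)] : set (borel X)).
Proof. by move=> oU; exact: open_borel (open_slice x oU). Qed.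

Lemma measurable_slice (B : set X) x : measurable (B : set (borel X)) ->
  measurable ([set y | B (m x y)] : set (borel X)).
Proof.
by move=> mB; have := continuous_borel2 (@slice_continuous x) measurableT mB; rewrite setTI.
Qed.

(** Lower semicontinuity of the slice masses: inner regularity puts a compact set of mass above [c]
    into the slice at [x], and by the tube lemma the same compact set lies in the slices at all
    nearby points. *)
Lemma open_slice_gt (U : set X) (c : R) : open U ->
  open [set x | c < fine (gamma [set y | U (m x y)])].
Proof.
move=> oU; apply: open_nbhs_self => x /= cx.
have mU := open_slice_borel x oU.
have [K [cK KU cK']] := inner_compact mU cx.
have [V nV VU] := slice_tube cK oU KU.
apply: filterS nV => x' Vx'; apply: (lt_le_trans cK').
apply: le_fine_prob; [exact: compact_borel|exact: open_slice_borel|].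
by move=> y Ky; exact: VU.
Qed.

(** Tonelli does not apply: [m] is jointly continuous, but possibly not measurable for the product
    sigma-algebra. Open sets are handled by lower semicontinuity, and a Dynkin class argument
    reaches all Borel sets. *)
Lemma measurable_slice_prob (B : set X) : measurable (B : set (borel X)) ->
  measurable_fun [set: borel X] (fun x : borel X => gamma [set y | B (m x y)]).
Proof.
pose Q (S : set (borel X)) := measurable_fun [set: borel X] (fun x : borel X => gamma [set y | S (m x y)]).
move: B; apply: (@dynkin_induction _ (borel X) (@open X) Q) => //.
- exact: openI.
- rewrite /Q; apply: (eq_measurable_fun (fun=> gamma setT)) => //.
- move=> U oU; apply: (eq_measurable_fun (fun x : borel X => (fine (gamma [set y | U (m x y)]))%:E)).
    by move=> x _; apply: prob_fineK; exact: open_slice_borel.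
  by apply: lsc_borel => c; under eq_fun do rewrite lte_fin; exact: open_slice_gt.
- move=> S mS QS; rewrite /Q.
  apply: (eq_measurable_fun (fun x : borel X => 1 - gamma [set y | S (m x y)])%E).
    by move=> x _; rewrite -probability_setC//; exact: measurable_slice.
  by apply: emeasurable_funB.
- move=> F mF tF QF; rewrite /Q.
  apply: (eq_measurable_fun (fun x : borel X => \sum_(k <oo) gamma [set y | F k (m x y)])%E).
    move=> x _; rewrite -measure_semi_bigcup.
    + by congr (gamma _); apply/seteqP; split=> [y [k _ hk]|y [k _ hk]]; exists k.
    + by move=> k; exact: measurable_slice.
    + apply/trivIsetP => i j _ _ ij; apply/seteqP; split=> // y [h1 h2].
      by move/trivIsetP : tF => /(_ i j Logic.I Logic.I ij)/seteqP[/(_ (m x y)) h _]; apply: h.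
    + by apply: bigcupT_measurable => k; exact: measurable_slice.
  apply: (@ge0_emeasurable_sum _ _ _ _ (fun k (x : borel X) => gamma [set y | F k (m x y)]) xpredT).
    by move=> *; exact: measure_ge0.
  by move=> k _; exact: QF.
Qed.

Let mm x : measurable_fun [set: borel X] (m x : borel X -> borel X).
Proof. exact: continuous_borel2 (@slice_continuous x). Qed.

Definition slice_law (x : borel X) : {measure set (borel X) -> \bar R} :=
  measure_function_pushforward__canonical__measure_function_Measure gamma (mm x).

Lemma slice_lawE x B : slice_law x B = gamma [set y | B (m x y)].
Proof. by []. Qed.

Lemma slice_law_setT x : slice_law x setT = 1%E.
Proof. by rewrite slice_lawE; exact: probability_setT. Qed.

Lemma ge0_integral_slice_law x (f : borel X -> \bar R) : (forall z, 0 <= f z)%E ->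
  measurable_fun setT f -> (\int[slice_law x]_z f z = \int[gamma]_y f (m x y))%E.
Proof. by move=> f0 mf; rewrite /slice_law ge0_integral_pushforward// preimage_setT. Qed.

Lemma measurable_slice_integral (f : borel X -> \bar R) : (forall z, 0 <= f z)%E ->
  measurable_fun setT f ->
  measurable_fun setT (fun x : borel X => \int[gamma]_y f (m x y))%E.
Proof.
move=> f0 mf.
apply: (eq_measurable_fun (fun x : borel X => \int[slice_law x]_z f z)%E).
  by move=> x _; exact: ge0_integral_slice_law.
by apply: measurable_fun_integral_kernel => // U mU; exact: measurable_slice_prob.
Qed.

Lemma bounded_measurable_slice (f : borel X -> R) x : bounded_measurable f ->
  bounded_measurable (fun y : borel X => f (m x y)).
Proof.
move=> [mf [M fM]]; split; last by exists M.
exact: (measurableT_comp mf (mm x)).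
Qed.

Lemma bounded_measurable_slice_integral (f : borel X -> R) : bounded_measurable f ->
  bounded_measurable (fun x : borel X => \int[gamma]_y f (m x y)).
Proof.
move=> bf; have [mf [M fM]] := bf; split; last first.
  exists M => x; apply: le_norm_Rintegral => //.
  by apply: bounded_measurable_integrable; exact: bounded_measurable_slice.
(* The bound [M] is added to make [f] nonnegative, the case settled by kernels. *)
apply: (eq_measurable_fun (fun x : borel X => fine (\int[gamma]_y (f (m x y) + M)%:E) - M)).
  move=> x _; have := @bRintegralD _ _ _ gamma (fun y => f (m x y)) (fun=> M)
    (bounded_measurable_slice x bf) (bounded_measurable_cst _ M).
  by rewrite Rintegral_prob_cst /Rintegral => ->; rewrite addrK.
apply: measurable_funB => //; apply: measurableT_comp => //.
apply: (@measurable_slice_integral (fun z => (f z + M)%:E)).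
  by move=> z; rewrite lee_fin; have := fM z; rewrite ler_norml; lra.
by apply/measurable_EFinP; exact: measurable_funD.
Qed.

Section invariant.
Hypothesis m_trig : forall l th, dual l ->
  \int[gamma]_x (\int[gamma]_y cos (l (m x y) + th)) = \int[gamma]_x cos (l x + th).

Lemma trig_slice (u : X -> R) : trig_poly dual u ->
  \int[gamma]_x (\int[gamma]_y u (m x y)) = \int[gamma]_x u x.
Proof.
elim=> [a l th dl|{}u v tu hu tv hv].
  have bc : bounded_measurable (fun z : borel X => cos (l z + th)).
    have := trig_bounded_measurable (TrigCos 1 th dl).
    by under eq_fun do rewrite mul1r.
  transitivity (\int[gamma]_x (a * \int[gamma]_y cos (l (m x y) + th))).
    by apply: eq_Rintegral => x _; rewrite bRintegralZ//; exact: (bounded_measurable_slice x bc).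
  by rewrite !bRintegralZ// ?m_trig//; exact: (bounded_measurable_slice_integral bc).
have bu := trig_bounded_measurable tu; have bv := trig_bounded_measurable tv.
transitivity (\int[gamma]_x (\int[gamma]_y u (m x y) + \int[gamma]_y v (m x y))).
  apply: eq_Rintegral => x _; rewrite bRintegralD//; exact: bounded_measurable_slice.
by rewrite [LHS]bRintegralD ?hu ?hv ?[RHS]bRintegralD//; exact: bounded_measurable_slice_integral.
Qed.

Lemma unif_trig_slice (v : X -> R) : unif_trig dual v ->
  \int[gamma]_x (\int[gamma]_y v (m x y)) = \int[gamma]_x v x.
Proof.
move=> hv; have bv := unif_trig_bounded_measurable hv.
apply/eqP; rewrite -subr_eq0 -normr_le0; apply/ler_addgt0Pr => e e0; rewrite add0r.
have [u tu du] := hv (e / 2) ltac:(lra).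
have bu := trig_bounded_measurable tu.
have h1 : `|\int[gamma]_x (\int[gamma]_y v (m x y)) - \int[gamma]_x (\int[gamma]_y u (m x y))| <= e / 2.
  rewrite -bRintegralB; [|exact: bounded_measurable_slice_integral..].
  apply: le_norm_Rintegral.
    apply: bounded_measurable_integrable; apply: bounded_measurableB;
    exact: bounded_measurable_slice_integral.
  move=> x; rewrite -bRintegralB; [|exact: bounded_measurable_slice..].
  apply: le_norm_Rintegral => //; apply: bounded_measurable_integrable.
  by apply: bounded_measurableB; exact: bounded_measurable_slice.
have h2 : `|\int[gamma]_x u x - \int[gamma]_x v x| <= e / 2.
  rewrite -bRintegralB//; apply: le_norm_Rintegral.
    by apply: bounded_measurable_integrable; exact: bounded_measurableB.
  by move=> x; rewrite distrC.
rewrite (trig_slice tu) in h1.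
have := ler_normD (\int[gamma]_x (\int[gamma]_y v (m x y)) - \int[gamma]_x u x)
  (\int[gamma]_x u x - \int[gamma]_x v x); rewrite addrA subrK; lra.
Qed.

Let slice_prob (B : set X) (x : borel X) := fine (gamma [set y | B (m x y)]).
Let nu B := \int[gamma]_x slice_prob B x.

Let bounded_slice_prob B : measurable (B : set (borel X)) -> bounded_measurable (slice_prob B).
Proof.
move=> mB; split; first by apply: measurableT_comp => //; exact: measurable_slice_prob.
exists 1 => x; rewrite ger0_norm ?fine_prob_ge0// fine_prob_le1//.
exact: measurable_slice.
Qed.

Let le_nu A B : measurable (A : set (borel X)) -> measurable (B : set (borel X)) ->
  A `<=` B -> nu A <= nu B.
Proof.
move=> mA mB AB; apply: le_bRintegral; try exact: bounded_slice_prob.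
by move=> x; apply: le_fine_prob; try exact: measurable_slice; move=> y /AB.
Qed.

(** A Urysohn function equal to 1 on [K] and to 0 on a compact set [K'] filling almost all of the
    complement lies between the indicators of [K] and of the complement of [K'], and its mean along
    the slices is its mean under [gamma]. *)
Let nu_compact_le K : compact K -> nu K <= fine (gamma K).
Proof.
move=> cK; have mK := compact_borel hX cK.
apply/ler_addgt0Pr => e e0.
have [K' [cK' KK' he]] := gamma_radon (measurableC mK) e0.
have mK' := compact_borel hX cK'.
have [v [tv v01 v1 v0]] := urysohn_dual hX cK cK' ltac:(by apply/disj_setPS => x [? /KK']).
have bv := unif_trig_bounded_measurable tv.
apply: (@le_trans _ _ (\int[gamma]_x (\int[gamma]_y v (m x y)))).
  apply: le_bRintegral; [exact: bounded_slice_prob|exact: bounded_measurable_slice_integral|].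
  move=> x; rewrite /slice_prob -Rintegral_prob_indic; last exact: measurable_slice.
  apply: le_bRintegral; [|exact: bounded_measurable_slice|].
    by apply: bounded_measurable_indic; exact: measurable_slice.
  move=> y; rewrite indicE; have [|_] := boolP (_ \in _).
    by rewrite inE/= => /v1 ->.
  by have /andP[] := v01 (m x y).
rewrite unif_trig_slice//.
apply: (@le_trans _ _ (\int[gamma]_x (\1_(~` K') x))).
  apply: le_bRintegral => //; first by apply: bounded_measurable_indic; exact: measurableC.
  move=> x; rewrite indicE; have /andP[_ ?] := v01 x.
  have [//|] := boolP (_ \in _); rewrite notin_setE/= => /contrapT/v0 -> //.
rewrite Rintegral_prob_indic; last exact: measurableC.
have mCK := measurableC mK.
have h1 := fine_probD gamma mCK mK' KK'.
have h2 : fine (gamma (~` K `\` K')) < e by rewrite -lte_fin prob_fineK//; exact: measurableD.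
have h3 := fine_probC gamma mK; have h4 := fine_probC gamma mK'; lra.
Qed.

(** Near a point, the required compact set is the image under [m] of a compact part of [C] times a
    compact part of the slice; a closed neighbourhood, available by regularity, keeps the first
    factor compact. Unions glue the local choices. *)
Let slice_compact_gt (U C : set X) c : open U -> compact C ->
  (forall x, C x -> c < slice_prob U x) ->
  exists M, [/\ compact M, M `<=` U & forall x, C x -> c < slice_prob M x].
Proof.
move=> oU cC hC.
suff [M [cM MU hM]] : exists M, [/\ compact M, M `<=` U &
    forall x, (C `&` C) x -> c < slice_prob M x].
  by exists M; split=> // x Cx; exact: hM.
apply: (@compact_induction _ C (fun A => exists M, [/\ compact M, M `<=` U &
    forall x, (A `&` C) x -> c < slice_prob M x])) => //.
- by exists set0; split=> // [|x []//]; exact: compact0.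
- move=> A B [M [cM MU hM]] [N [cN NU hN]]; exists (M `|` N); split.
  + exact: compactU.
  + by rewrite subUset.
  + have mM := compact_borel hX cM; have mN := compact_borel hX cN.
    move=> x [[Ax|Bx] Cx]; [apply: (lt_le_trans (hM x _)) => //|apply: (lt_le_trans (hN x _)) => //];
      apply: le_fine_prob; try (apply: measurable_slice => //; exact: measurableU).
    * by move=> y; left.
    * by move=> y; right.
- by move=> A B AB [M [cM MU hM]]; exists M; split=> // x [/AB ? ?]; exact: hM.
- move=> x Cx.
  have mU := open_slice_borel x oU.
  have [L [cL LU cL']] := inner_compact mU (hC x Cx).
  have [V nV VU] := slice_tube cL oU LU.
  have [W nW WV] := @uniform_regular X x V nV.
  exists (closure W); first by apply: filterS nW; exact: subset_closure.
  exists ((fun z => m z.1 z.2) @` ((C `&` closure W) `*` L)); split.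
  + apply: continuous_compact.
      by apply: continuous_subspaceT.
    apply: compact_setX => //; apply: compact_closedI => //; exact: closed_closure.
  + by move=> _ [[a b] /= [[Ca Wa] Lb] <-]; apply: VU => //; exact: WV.
  + move=> x' [Wx' Cx']; apply: (lt_le_trans cL'); apply: le_fine_prob.
    * exact: compact_borel.
    * apply: measurable_slice; apply: compact_borel => //; apply: continuous_compact.
        by apply: continuous_subspaceT.
      apply: compact_setX => //; apply: compact_closedI => //; exact: closed_closure.
    * by move=> y Ly; exists (x', y).
Qed.

(** Inner regularity of [nu] is not given, so the compact set is built level by level: [A k]
    collects the points whose slice of [U] has mass above (k + 1) / n, [C k] is a compact part of
    it, and [M k] is a compact part of [U] with the same lower bound over [C k]. *)
Let nu_open_inner U e : open U -> 0 < e ->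
  exists M, [/\ compact M, M `<=` U & nu U <= nu M + e].
Proof.
move=> oU e0; have mU := open_borel oU.
(* With n > 2 / e the discretisation costs 1 / n < e / 2; the other e / 2 pays for replacing [A k]
   by [C k]. *)
pose n := (Num.Def.archi_bound (2 / e)).+1.
have n0 : 0 < n%:R :> R by rewrite ltr0n.
have hne : 2 / e < n%:R.
  by apply: (lt_trans (archi_boundP _)); rewrite ?divr_ge0 ?ltW// ltr_nat.
pose A k := [set x : X | k.+1%:R / n%:R < slice_prob U x].
have oA k : open (A k) by exact: open_slice_gt.
have mA k := open_borel (oA k).
have /choice[C hC] k : exists C, [/\ compact C, C `<=` A k &
    fine (gamma (A k)) <= fine (gamma C) + e / 2].
  have [C [cC CA]] := gamma_radon (mA k) (e := e / 2) ltac:(lra).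
  have mC := compact_borel hX cC.
  move=> h; exists C; split=> //.
  have := fine_probD gamma (mA k) mC CA.
  have : fine (gamma (A k `\` C)) < e / 2 by rewrite -lte_fin prob_fineK//; exact: measurableD.
  lra.
have mC k : measurable (C k : set (borel X)) by apply: compact_borel => //; case: (hC k).
have /choice[M hM] k : exists M, [/\ compact M, M `<=` U &
    forall x, C k x -> k.+1%:R / n%:R < slice_prob M x].
  by have [cC CA _] := hC k; apply: slice_compact_gt => // x /CA.
pose N := \big[setU/set0]_(k < n) M k.
have cN : compact N by apply: bigsetU_compact => k _; case: (hM k).
have mN := compact_borel hX cN.
exists N; split=> //.
  by rewrite /N => x; rewrite -bigcup_mkord => -[k _ Mx]; have [_ + _] := hM k; exact.
have bi (D : nat -> set X) : (forall k, measurable (D k : set (borel X))) ->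
    bounded_measurable (fun x : borel X => \sum_(k < n) \1_(D k) x : R).
  move=> mD; apply: (@bounded_measurable_sum _ (borel X) R n (fun k => \1_(D k))) => k.
  exact: bounded_measurable_indic.
have bsA := bi _ mA; have bsC := bi _ mC.
have h1 : n%:R * nu U <= 1 + \sum_(k < n) fine (gamma (A k)).
  rewrite /nu -bRintegralZ; last exact: bounded_slice_prob.
  under eq_bigr do rewrite -Rintegral_prob_indic//.
  rewrite -(@bRintegral_sum _ _ _ gamma n (fun k => \1_(A k)));
    last by move=> i; exact: bounded_measurable_indic.
  rewrite -[X in X + _](@Rintegral_prob_cst _ _ _ gamma) -bRintegralD.
  - apply: le_bRintegral.
    + by apply: bounded_measurableZ; exact: bounded_slice_prob.
    + apply: bounded_measurableD; first exact: bounded_measurable_cst.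
      exact: bsA.
    move=> x; apply: (le_trans (@le_sum_nat_threshold _ n _ _)).
      rewrite -[leRHS]mulr1 ler_wpM2l// fine_prob_le1//; exact: measurable_slice.
    rewrite lerD2l; apply: ler_sum => k _; rewrite indicE.
    suff -> : (x \in A k) = (k.+1%:R < n%:R * slice_prob U x) by [].
    apply/idP/idP => [/set_mem|h]; first by rewrite /A/= ltr_pdivrMr// mulrC.
    by apply/mem_set; rewrite /A/= ltr_pdivrMr// mulrC.
  - exact: bounded_measurable_cst.
  - exact: bsA.
have h2 : \sum_(k < n) fine (gamma (C k)) <= n%:R * nu N.
  rewrite /nu -bRintegralZ; last exact: bounded_slice_prob.
  under eq_bigr do rewrite -Rintegral_prob_indic//.
  rewrite -(@bRintegral_sum _ _ _ gamma n (fun k => \1_(C k)));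
    last by move=> i; exact: bounded_measurable_indic.
  apply: le_bRintegral.
  + exact: bsC.
  + by apply: bounded_measurableZ; exact: bounded_slice_prob.
  move=> x; under eq_bigr do rewrite indicE.
  apply: (@sum_nat_threshold_le _ n (fun k => x \in C k)).
    by rewrite mulr_ge0// fine_prob_ge0.
  move=> k kn /set_mem Cx; have [cM _ /(_ x Cx)] := hM k.
  rewrite ltr_pdivrMr// mulrC => /ltW/le_trans; apply.
  rewrite ler_pM2l//; apply: le_fine_prob.
  - by apply: measurable_slice; exact: compact_borel.
  - exact: measurable_slice.
  - by move=> y My; rewrite /N -bigcup_mkord; exists k.
have h3 : \sum_(k < n) fine (gamma (A k)) <= \sum_(k < n) fine (gamma (C k)) + n%:R * (e / 2).
  have -> : n%:R * (e / 2) = \sum_(k < n) (e / 2) by rewrite sumr_const card_ord mulr_natl.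
  by rewrite -big_split/=; apply: ler_sum => k _; case: (hC k).
rewrite -(ler_pM2l n0) mulrDr.
have : 2 < n%:R * e by rewrite -ltr_pdivrMr.
lra.
Qed.

Let nu_open_le U : open U -> nu U <= fine (gamma U).
Proof.
move=> oU; apply/ler_addgt0Pr => e e0; have [M [cM MU h]] := nu_open_inner oU e0.
apply: (le_trans h); rewrite lerD2r; apply: (le_trans (nu_compact_le cM)).
apply: le_fine_prob => //; [exact: compact_borel|exact: open_borel].
Qed.

Let nu_le B : measurable (B : set (borel X)) -> nu B <= fine (gamma B).
Proof.
move=> mB; have mBC := measurableC mB; apply/ler_addgt0Pr => e e0.
have [K [cK KB he]] := gamma_radon mBC e0; have mK := compact_borel hX cK.
have oK : open (~` K) by apply: closed_openC; exact: compact_closed.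
have BK : B `<=` ~` K by move=> x Bx /KB.
apply: (le_trans (le_nu mB (open_borel oK) BK)).
apply: (le_trans (nu_open_le oK)).
have h1 := fine_probD gamma mBC mK KB.
have h2 : fine (gamma (~` B `\` K)) < e by rewrite -lte_fin prob_fineK//; exact: measurableD.
have h3 := fine_probC gamma mK; have h4 := fine_probC gamma mB; lra.
Qed.

(* Urysohn functions give [nu <= gamma] on compact sets, inner regularity of
   the slices extends this to open and Borel sets, and equality follows by
   taking complements. *)
Lemma slice_prob_invariant B : measurable (B : set (borel X)) ->
  (\int[gamma]_x gamma [set y | B (m x y)] = gamma B)%E.
Proof.
move=> mB; have mBC := measurableC mB.
have nuC : nu (~` B) = 1 - nu B.
  rewrite /nu -[X in X - _](@Rintegral_prob_cst _ _ _ gamma) -bRintegralB.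
  - by apply: eq_Rintegral => x _; rewrite -fine_probC//; exact: measurable_slice.
  - exact: bounded_measurable_cst.
  - exact: bounded_slice_prob.
have h1 := nu_le mB; have h2 := nu_le mBC; rewrite nuC fine_probC// in h2.
have : nu B = fine (gamma B) by apply/eqP; rewrite eq_le h1/=; lra.
move=> h; have := congr1 (@EFin R) h.
rewrite prob_fineK// /nu EFin_bRintegral; last exact: bounded_slice_prob.
by move=> <-; apply: eq_integral => x _; rewrite prob_fineK//; exact: measurable_slice.
Qed.

(** Invariance on sets says that the mixture of the slice laws is [gamma]; the formula is
    integration against this mixture. *)
Lemma ge0_integral_slice (f : borel X -> \bar R) : (forall z, 0 <= f z)%E ->
  measurable_fun setT f ->
  (\int[gamma]_x \int[gamma]_y f (m x y) = \int[gamma]_x f x)%E.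
Proof.
move=> f0 mf.
have mk U : measurable U -> measurable_fun setT (slice_law ^~ U).
  by move=> mU; exact: measurable_slice_prob.
have := ge0_integral_mixture gamma slice_law_setT mk f0 mf.
under [in X in _ = X]eq_integral do rewrite ge0_integral_slice_law//.
move=> <-; apply: eq_measure_integral => A mA _.
by rewrite mixtureE; exact: slice_prob_invariant.
Qed.

End invariant.
End slices.

Import HBNNSimple.

(** * One-variable calculus and integration against a density *)

Section calculus.
Context {R : realType}.
Notation mu := (@lebesgue_measure R).

Lemma integrable_realZl d (T : measurableType d) (nu : {measure set T -> \bar R})
    (D : set T) (c : R) (f : T -> R) : measurable D ->
  nu.-integrable D (EFin \o f) -> nu.-integrable D (EFin \o (fun x => c * f x)).
Proof. by move=> mD hf; exact: (integrableZl mD c hf). Qed.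

Lemma integrable_realD d (T : measurableType d) (nu : {measure set T -> \bar R})
    (D : set T) (f g : T -> R) : measurable D ->
  nu.-integrable D (EFin \o f) -> nu.-integrable D (EFin \o g) ->
  nu.-integrable D (EFin \o (fun x => f x + g x)).
Proof. by move=> mD hf hg; exact: (integrableD mD hf hg). Qed.

Lemma integrable_realB d (T : measurableType d) (nu : {measure set T -> \bar R})
    (D : set T) (f g : T -> R) : measurable D ->
  nu.-integrable D (EFin \o f) -> nu.-integrable D (EFin \o g) ->
  nu.-integrable D (EFin \o (fun x => f x - g x)).
Proof. by move=> mD hf hg; exact: (integrableB mD hf hg). Qed.

Lemma is_derive_under_integral d (Y : measurableType d) (nu : {measure set Y -> \bar R})
    (B : set Y) (f df : R -> Y -> R) (G : Y -> R) : measurable B ->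
  (forall x, nu.-integrable B (EFin \o f x)) ->
  (forall (x : R) y, B y -> is_derive x (1 : R) (f ^~ y) (df x y)) ->
  nu.-integrable B (EFin \o G) -> (forall y, 0 <= G y) ->
  (forall x y, B y -> `|df x y| <= G y) ->
  forall a, is_derive a (1 : R) (fun x => \int[nu]_(y in B) f x y) (\int[nu]_(y in B) df a y).
Proof.
move=> mB intf derf intG G0 Gub a.
have Ia : `]a - 1, a + 1[%classic a by rewrite /= in_itv/=; apply/andP; split; lra.
have d1 x y : B y -> partial1of2 f x y = df x y.
  by move=> By; rewrite partial1of2E; have [_ ->] := derf x y By.
have hub x y : `]a - 1, a + 1[%classic x -> B y -> `|partial1of2 f x y| <= G y.
  by move=> _ By; rewrite d1//; exact: Gub.
have hder x y : `]a - 1, a + 1[%classic x -> B y -> derivable (f ^~ y) x 1.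
  by move=> _ By; have [] := derf x y By.
have hint x : `]a - 1, a + 1[%classic x -> nu.-integrable B (EFin \o f x) by [].
split; first exact: (derivable_under_integral mB Ia hint hder G0 intG hub).
rewrite -derive1E (differentiation_under_integral mB Ia hint hder G0 intG hub).
by apply: eq_Rintegral => y /set_mem By; rewrite d1.
Qed.

Lemma is_derive_continuous (F f : R -> R) : (forall x : R, is_derive x (1 : R) F (f x)) -> continuous F.
Proof.
move=> dF x; apply: differentiable_continuous; apply/derivable1_diffP.
by have [] := dF x.
Qed.

Lemma continuous_FTC2_everywhere (F f : R -> R) a b : a < b ->
  (forall x : R, is_derive x (1 : R) F (f x)) -> continuous f ->
  (\int[mu]_(x in `[a, b]) (f x)%:E = (F b - F a)%:E)%E.
Proof.
move=> ab dF cf; have cF := is_derive_continuous dF.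
rewrite (@continuous_FTC2 _ f F)//.
- exact: continuous_subspaceT.
- split; first by move=> x _; have [] := dF x.
  + exact/cvg_at_right_filter/cF.
  + exact/cvg_at_left_filter/cF.
- by move=> x _; rewrite derive1E; have [] := dF x.
Qed.

(** The integral over [-n, n] is F(n) - F(-n), of order 1 / n by the decay of [F], and dominated
    convergence leads to the whole line. The Gaussian integrations by parts below are instances. *)
Lemma integral_derivative_vanishing (F f : R -> R) C :
  (forall x : R, is_derive x (1 : R) F (f x)) -> continuous f ->
  mu.-integrable setT (EFin \o f) -> (forall x, `|F x| * `|x| <= C) ->
  \int[mu]_x f x = 0.
Proof.
move=> dF cf intf FC.
have mf : measurable_fun setT f by case/integrableP : intf => /measurable_EFinP.
pose I n : set R := `[- n.+1%:R, n.+1%:R]%classic.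
pose f_ n := (EFin \o f) \_ (I n).
have mef : measurable_fun setT (EFin \o f) by exact/measurable_EFinP.
have mI n : measurable (I n) by exact: measurable_itv.
have [] := @dominated_convergence _ _ _ mu setT measurableT f_ (EFin \o f) (fun x => `|f x|%:E).
- by move=> n; apply: (measurable_restrictT _ (mI n)).1; exact: measurable_funTS.
- exact: mef.
- apply: aeW => x _; apply: cvg_near_cst.
  exists (Num.Def.archi_bound `|x|) => // n /= hn.
  rewrite /f_ patchE mem_set// /I /= in_itv/= -ler_norml ltW//.
  by apply: (lt_le_trans (archi_boundP (normr_ge0 _))); rewrite ler_nat ltnW.
- exact: (integrable_abse intf).
- apply: aeW => x n _; rewrite /f_ patchE.
  by case: ifPn => _ /=; rewrite ?lexx// normr0 lee_fin.
move=> _ _ cvgf.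
have Fn n : (\int[mu]_x f_ n x = (F n.+1%:R - F (- n.+1%:R))%:E)%E.
  rewrite -integral_mkcond (@continuous_FTC2_everywhere F f)//.
  by rewrite -subr_gt0 opprK addr_gt0.
have h0 : (\int[mu]_x f_ n x)%E @[n --> \oo] --> (0%R%:E : \bar R).
  under eq_cvg do rewrite Fn.
  apply: cvg_EFin; first exact: nearW.
  apply/cvgrPdist_le => e e0.
  exists (Num.Def.archi_bound (2 * C / e)) => // n /= hn.
  rewrite sub0r normrN.
  have n0 : 0 < n.+1%:R :> R by [].
  have C0 : 0 <= C by apply: le_trans (FC 0); rewrite mulr_ge0.
  have := FC n.+1%:R; have := FC (- n.+1%:R); rewrite normrN (gtr0_norm n0).
  have := ler_normB (F n.+1%:R) (F (- n.+1%:R)).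
  have : 2 * C / e < n.+1%:R.
    apply: (lt_le_trans (archi_boundP _)); first by rewrite divr_ge0 ?mulr_ge0 ?(ltW e0).
    by rewrite ler_nat ltnW.
  rewrite ltr_pdivrMr// => h1 h2 h3 h4; rewrite leNgt; apply/negP => h5.
  have : n.+1%:R * e < n.+1%:R * `|F n.+1%:R - F (- n.+1%:R)| by rewrite ltr_pM2l.
  have : n.+1%:R * `|F n.+1%:R - F (- n.+1%:R)| <= n.+1%:R * (`|F n.+1%:R| + `|F (- n.+1%:R)|).
    by rewrite ler_pM2l.
  lra.
by rewrite /Rintegral (cvg_unique _ cvgf h0).
Qed.

Lemma ge0_integral_density d (T : measurableType d) (nu lam : {measure set T -> \bar R})
    (g : T -> R) (f : T -> \bar R) : measurable_fun setT g -> (forall x, 0 <= g x) ->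
  (forall A, measurable A -> nu A = \int[lam]_(x in A) (g x)%:E)%E ->
  measurable_fun setT f -> (forall x, 0 <= f x)%E ->
  (\int[nu]_x f x = \int[lam]_x (f x * (g x)%:E))%E.
Proof.
move=> mg g0 hnu mf f0.
have mge : measurable_fun setT (EFin \o g) by exact/measurable_EFinP.
pose f_ := nnsfun_approx measurableT mf.
have hind A : measurable A -> (\int[nu]_x (\1_A x)%:E = \int[lam]_x ((\1_A x)%:E * (g x)%:E))%E.
  move=> mA; rewrite integral_indic// setIT hnu// integral_mkcond.
  apply: eq_integral => x _; rewrite patchE indicE.
  by case: ifP => _; rewrite ?mul1e ?mul0e.
have hs (h : {nnsfun T >-> R}) : (\int[nu]_x (h x)%:E = \int[lam]_x ((h x)%:E * (g x)%:E))%E.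
  under eq_integral do rewrite fimfunE -fsumEFin//.
  rewrite ge0_integral_fsum//; last 2 first.
    - by move=> r; exact/measurable_EFinP/measurableT_comp.
    - by move=> r z _; rewrite EFinM nnfun_muleindic_ge0.
  under [RHS]eq_integral.
    move=> x _; rewrite fimfunE -fsumEFin// ge0_mule_fsuml; last first.
      by move=> r; rewrite EFinM nnfun_muleindic_ge0.
    over.
  rewrite [RHS]ge0_integral_fsum//; last 2 first.
    - move=> r; apply: emeasurable_funM => //.
      by apply/measurable_EFinP; apply: measurable_funM => //; exact: measurable_indic.
    - by move=> r z _; rewrite mule_ge0 ?lee_fin// -lee_fin EFinM nnfun_muleindic_ge0.
  apply: eq_fsbigr => r _.
  have [r0|r0] := leP 0 r.
    under [RHS]eq_integral do rewrite EFinM -muleA.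
    under eq_integral do rewrite EFinM.
    rewrite !ge0_integralZl_EFin// ?hind//.
    - by move=> x _; rewrite mule_ge0// lee_fin.
    - by apply: emeasurable_funM => //; apply/measurable_EFinP; exact: measurable_indic.
    - by apply/measurable_EFinP; exact: measurable_indic.
  by rewrite !integral0_eq// => x _; rewrite preimage_nnfun0// indic0 ?mulr0 ?mul0e.
transitivity (\int[nu]_x (limn (fun n => (f_ n x)%:E)))%E.
  by apply/eq_integral => x _; apply/esym/cvg_lim => //=; exact: cvg_nnsfun_approx.
rewrite monotone_convergence//; last 3 first.
- by move=> n; exact/measurable_EFinP.
- by move=> n z _; rewrite lee_fin.
- by move=> z _ a b ab; rewrite lee_fin; exact/lefP/nd_nnsfun_approx.
under eq_fun do rewrite hs.
rewrite -monotone_convergence//; last 3 first.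
- by move=> n; apply: emeasurable_funM => //; exact/measurable_EFinP.
- by move=> n z _; rewrite mule_ge0// lee_fin.
- move=> z _ a b ab; apply: lee_wpmul2r; first by rewrite lee_fin.
  by rewrite lee_fin; exact/lefP/nd_nnsfun_approx.
apply: eq_integral => x _; apply: cvg_lim => //.
apply: cvgeZr => //; exact: cvg_nnsfun_approx.
Qed.

End calculus.

(** * The centered normal density: moments and characteristic function *)

Section normal.
Context {R : realType}.
Notation mu := (@lebesgue_measure R).
Variable s : R.
Hypothesis s0 : 0 < s.
Let w := normal_pdf 0 s.

Let sn0 : s != 0. Proof. by rewrite gt_eqF. Qed.

Let wE x : w x = normal_peak s * expR (- x ^+ 2 / (s ^+ 2 *+ 2)).
Proof. by rewrite /w normal_pdfE ?gt_eqF// /normal_fun subr0. Qed.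

Let w_ge0 x : 0 <= w x. Proof. exact: normal_pdf_ge0. Qed.

Lemma is_derive_normal_pdf (x : R) : is_derive x (1 : R) w (- (x / s ^+ 2) * w x).
Proof.
have -> : w = (fun x => normal_peak s * expR ((- (s ^+ 2 *+ 2)^-1) * x ^+ 2)).
  by apply/funext => y; rewrite wE; congr (_ * expR _); rewrite mulrC mulNr mulrN.
apply: is_derive_eq; rewrite /GRing.scale/= -(mulr_natr (s ^+ 2)).
by field; rewrite gt_eqF.
Qed.

Lemma normal_pdf_continuous : continuous w.
Proof. exact: is_derive_continuous is_derive_normal_pdf. Qed.

(** For |x| > 1 the exponent [p] is raised to an even integer 2 k, and y <= exp y with y = c x^2 / k
    is raised to the power k. *)
Lemma powR_le_expR (p c : R) : 0 <= p -> 0 < c ->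
  exists2 C, 0 < C & forall x : R, `|x| `^ p <= C * expR (c * x ^+ 2).
Proof using.
move=> p0 c0; pose k := (Num.Def.archi_bound p).+1.
have kp : p < k%:R by apply: (lt_trans (archi_boundP p0)); rewrite ltr_nat.
have k0 : 0 < k%:R :> R by rewrite ltr0n.
exists (1 + (k%:R / c) ^+ k); first by rewrite ltr_pwDl// exprn_ge0// divr_ge0// (ltW c0).
move=> x; have e1 : 1 <= expR (c * x ^+ 2) by rewrite -[leLHS]expR0 ler_expR mulr_ge0 ?sqr_ge0 ?ltW.
rewrite mulrDl mul1r.
have [x1|x1] := leP `|x| 1.
  apply: (@le_trans _ _ 1); last first.
    by apply: (le_trans e1); rewrite lerDl mulr_ge0 ?expR_ge0// exprn_ge0// divr_ge0// (ltW c0).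
  by have := @ge0_ler_powR _ p p0 `|x| 1; rewrite !nnegrE powR1; apply.
apply: (@le_trans _ _ ((x ^+ 2) ^+ k)).
  rewrite -(real_normK (num_real x)) -exprM -powR_mulrn// ler_powR ?(ltW x1)//.
  by rewrite natrM; have : k%:R <= 2 * k%:R :> R; lra.
have h : (x ^+ 2) ^+ k <= (k%:R / c) ^+ k * expR (c * x ^+ 2).
  have -> : c * x ^+ 2 = k%:R * (c * x ^+ 2 / k%:R) by rewrite [RHS]mulrC divfK// gt_eqF.
  rewrite expRM_natl -exprMn.
  rewrite lerXn2r ?nnegrE ?sqr_ge0 ?mulr_ge0 ?expR_ge0 ?invr_ge0 ?(ltW c0)//.
  have := expR_ge1Dx (c * x ^+ 2 / k%:R) => h.
  have {}h : c * x ^+ 2 / k%:R <= expR (c * x ^+ 2 / k%:R) by lra.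
  rewrite -(ler_pM2l (_ : 0 < c / k%:R)) ?divr_gt0//.
  apply: (le_trans _ (le_trans h _)); first by rewrite mulrAC.
  have -> : c / k%:R * (k%:R / c * expR (c * x ^+ 2 / k%:R)) = expR (c * x ^+ 2 / k%:R).
    by move: (expR _) => E; field; rewrite !gt_eqF.
  by [].
by apply: (le_trans h); rewrite lerDr expR_ge0.
Qed.

Lemma normal_moment_bound p : 0 <= p ->
  exists2 C, 0 < C & forall x : R, `|x| `^ p * w x <= C * normal_pdf 0 (2 * s) x.
Proof.
move=> p0; have s20 : 0 < s ^+ 2 by rewrite exprn_gt0.
(* The rate 3 / (8 s^2) is the gap 1 / (2 s^2) - 1 / (2 (2 s)^2) between the exponents of the
   densities of standard deviation s and 2 s. *)
have [C C0 hC] := @powR_le_expR p (3 / (8 * s ^+ 2)) p0 ltac:(by rewrite divr_gt0// mulr_gt0).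
have np1 : 0 < normal_peak s by rewrite normal_peak_gt0// gt_eqF.
have np2 : 0 < normal_peak (2 * s) by rewrite normal_peak_gt0// mulf_neq0// ?gt_eqF.
exists (C * normal_peak s / normal_peak (2 * s)); first by rewrite divr_gt0// mulr_gt0.
move=> x; rewrite normal_pdfE ?mulf_neq0 ?gt_eqF// /normal_fun subr0 wE.
rewrite [leRHS]mulrA divfK ?gt_eqF// mulrCA (mulrC C) -mulrA ler_wpM2l ?(ltW np1)//.
apply: (le_trans (ler_wpM2r (expR_ge0 _) (hC x))).
rewrite -mulrA -expRD ler_wpM2l ?(ltW C0)// ler_expR le_eqVlt; apply/orP; left; apply/eqP.
have -> : (2 * s) ^+ 2 *+ 2 = 8 * s ^+ 2 by ring.
have -> : s ^+ 2 *+ 2 = 2 * s ^+ 2 by ring.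
by move: (s ^+ 2) (x ^+ 2) s20 => a b a0; field; rewrite gt_eqF.
Qed.

Lemma normal_moment_integrable p : 0 <= p ->
  mu.-integrable setT (fun x => (`|x| `^ p * w x)%:E).
Proof.
move=> p0; have [C C0 hC] := normal_moment_bound p0.
apply: (@le_integrable _ _ _ mu _ measurableT _ (fun x => (C%:E * (normal_pdf 0 (2 * s) x)%:E)%E)).
- apply/measurable_EFinP; apply: measurable_funM; last exact: measurable_normal_pdf.
  by apply: (measurableT_comp (measurable_powR _)).
- move=> x _; rewrite -EFinM !abse_EFin lee_fin ger0_norm ?mulr_ge0 ?powR_ge0//.
  by apply: (le_trans (hC x)); exact: ler_norm.
- apply: integrableZl => //; exact: integrable_normal_pdf.
Qed.

Lemma normal_integrable_le (f : R -> R) p : 0 <= p -> measurable_fun setT f ->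
  (forall x, `|f x| <= `|x| `^ p * w x) -> mu.-integrable setT (EFin \o f).
Proof.
move=> p0 mf hf.
apply: (@le_integrable _ _ _ mu _ measurableT _ (fun x => (`|x| `^ p * w x)%:E)).
- exact/measurable_EFinP.
- by move=> x _; rewrite !abse_EFin lee_fin (le_trans (hf x))// ler_norm.
- exact: normal_moment_integrable.
Qed.

(** The derivative of x w(x) is w(x) - x^2 w(x) / s^2, and its integral vanishes. *)
Lemma normal_second_moment : \int[mu]_x (x ^+ 2 * w x) = s ^+ 2.
Proof.
have s20 : s ^+ 2 != 0 by rewrite gt_eqF// exprn_gt0.
pose F x := x * w x; pose f x := (w x - x ^+ 2 / s ^+ 2 * w x).
have dF (x : R) : is_derive x (1 : R) F (f x).
  have dw := is_derive_normal_pdf x.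
  by rewrite /F /f; apply: is_derive_eq; rewrite /GRing.scale/=; field.
have cw := normal_pdf_continuous.
have cf : continuous f.
  move=> x; apply: cvgB; first exact: cw.
  apply: cvgM; last exact: cw.
  by apply: cvgMl; exact: exprn_continuous.
have i2 : mu.-integrable setT (EFin \o (fun x => x ^+ 2 * w x)).
  apply: (normal_integrable_le (p := 2)) => //.
    by apply: continuous_measurable_fun => x; apply: cvgM; [exact: exprn_continuous|exact: cw].
  by move=> x; rewrite powR_mulrn// real_normK ?num_real// ger0_norm// mulr_ge0 ?sqr_ge0.
have i0 : mu.-integrable setT (EFin \o w).
  exact: integrable_normal_pdf.
have i2' : mu.-integrable setT (EFin \o (fun x => (s ^+ 2)^-1 * (x ^+ 2 * w x))).
  exact: integrable_realZl.
have [C C0 hC] := normal_moment_bound (p := 2) ltac:(by []).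
have h := @integral_derivative_vanishing _ F f (C * normal_peak (2 * s)) dF cf.
have : \int[mu]_x f x = 0.
  apply: h.
    rewrite (_ : f = (fun x => w x - (s ^+ 2)^-1 * (x ^+ 2 * w x))); last first.
      by apply/funext => x; rewrite /f; field.
    exact: integrable_realB.
  move=> x; rewrite /F normrM (ger0_norm (w_ge0 x)) mulrAC -expr2.
  have := hC x; rewrite powR_mulrn// => /le_trans; apply.
  by rewrite ler_wpM2l ?(ltW C0)// normal_pdf_ub// mulf_neq0// gt_eqF.
rewrite (_ : f = (fun x => w x - (s ^+ 2)^-1 * (x ^+ 2 * w x))); last first.
  by apply/funext => x; rewrite /f; field.
rewrite RintegralB// RintegralZl//.
rewrite [X in X - _](_ : _ = 1); last by rewrite /Rintegral integral_normal_pdf.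
by move=> /eqP; rewrite subr_eq0 => /eqP h1; rewrite -[RHS]mulr1 h1; field.
Qed.

(** Differentiation under the integral gives [phi' = - psi], and the vanishing integral of the
    derivative of sin(a x) w(x) gives [psi a = s^2 a phi a]. Hence phi(u) exp(s^2 u^2 / 2) has
    derivative 0. *)
Lemma normal_char (u : R) : \int[mu]_x (cos (u * x) * w x) = expR (- (s ^+ 2 * u ^+ 2 / 2)).
Proof.
have s20 : s ^+ 2 != 0 by rewrite gt_eqF// exprn_gt0.
have cw := normal_pdf_continuous.
have ccos a : continuous (fun x : R => cos (a * x)).
  move=> x; apply: continuous_comp; last exact: continuous_cos.
  by apply: cvgMr; exact: cvg_id.
have csin a : continuous (fun x : R => sin (a * x)).
  move=> x; apply: continuous_comp; last exact: continuous_sin.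
  by apply: cvgMr; exact: cvg_id.
have ic a : mu.-integrable setT (EFin \o (fun x => cos (a * x) * w x)).
  apply: (normal_integrable_le (p := 0)) => //.
    by apply: continuous_measurable_fun => x; apply: cvgM; [exact: ccos|exact: cw].
  move=> x; rewrite powRr0 mul1r normrM (ger0_norm (w_ge0 x)).
  by rewrite -[leRHS]mul1r ler_wpM2r// cos_max.
have is1 a : mu.-integrable setT (EFin \o (fun x => x * sin (a * x) * w x)).
  apply: (normal_integrable_le (p := 1)) => //.
    apply: continuous_measurable_fun => x; apply: cvgM; last exact: cw.
    by apply: cvgM; [exact: cvg_id|exact: csin].
  move=> x; rewrite powRr1// !normrM (ger0_norm (w_ge0 x)) ler_wpM2r//.
  by rewrite -[leRHS]mulr1 ler_wpM2l// sin_max.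
pose phi u := \int[mu]_x (cos (u * x) * w x).
pose psi u := \int[mu]_x (x * sin (u * x) * w x).
have dphi (a : R) : is_derive a (1 : R) phi (- psi a).
  have hd : is_derive a (1 : R) phi (\int[mu]_x (- 1 * (x * sin (a * x) * w x))).
    apply: (@is_derive_under_integral _ _ _ mu setT (fun u x => cos (u * x) * w x)
      (fun u x => - 1 * (x * sin (u * x) * w x)) (fun x => `|x| `^ 1 * w x)) => //.
    - move=> b x _.
      by apply: is_derive_eq; rewrite /GRing.scale/=; ring.
    - exact: normal_moment_integrable.
    - by move=> x; rewrite mulr_ge0 ?powR_ge0.
    - move=> b x _; rewrite powRr1// !normrM normrN1 mul1r (ger0_norm (w_ge0 x)) ler_wpM2r//.
      by rewrite -[leRHS]mulr1 ler_wpM2l// sin_max.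
  by move: hd; rewrite RintegralZl// mulN1r.
have stein a : psi a = s ^+ 2 * a * phi a.
  pose F x := sin (a * x) * w x.
  pose f x := a * (cos (a * x) * w x) - (s ^+ 2)^-1 * (x * sin (a * x) * w x).
  have dF (x : R) : is_derive x (1 : R) F (f x).
    have dw := is_derive_normal_pdf x.
    by rewrite /F /f; apply: is_derive_eq; rewrite /GRing.scale/=; field.
  have cf : continuous f.
    move=> x; apply: cvgB; apply: cvgMr; apply: cvgM; try exact: cw; first exact: ccos.
    by apply: cvgM; [exact: cvg_id|exact: csin].
  have i1 : mu.-integrable setT (EFin \o (fun x => a * (cos (a * x) * w x))).
    exact: integrable_realZl.
  have i2 : mu.-integrable setT (EFin \o (fun x => (s ^+ 2)^-1 * (x * sin (a * x) * w x))).
    exact: integrable_realZl.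
  have [C C0 hC] := normal_moment_bound (p := 1) ltac:(by []).
  have : \int[mu]_x f x = 0.
    apply: (@integral_derivative_vanishing _ F f (C * normal_peak (2 * s)) dF cf).
      exact: integrable_realB.
    move=> x; rewrite /F normrM (ger0_norm (w_ge0 x)).
    apply: (@le_trans _ _ (`|x| `^ 1 * w x)).
      rewrite powRr1// mulrC mulrA ler_wpM2r// -[leRHS]mulr1 ler_wpM2l//.
      exact: sin_max.
    apply: (le_trans (hC x)).
    by rewrite ler_wpM2l ?(ltW C0)// normal_pdf_ub// mulf_neq0// gt_eqF.
  rewrite RintegralB// !RintegralZl// -/(phi a) -/(psi a).
  by move=> /eqP; rewrite subr_eq0 => /eqP h; rewrite -mulrA h; field.
pose g u := phi u * expR (s ^+ 2 / 2 * u ^+ 2).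
have dg (x : R) : is_derive x (1 : R) g 0.
  have := dphi x; rewrite stein => dx.
  by apply: is_derive_eq; rewrite /GRing.scale/=; field.
have : g u = g 0 by apply: is_derive_0_is_cst.
rewrite /g expr0n mulr0 expR0 mulr1.
have -> : phi 0 = 1.
  rewrite /phi; under eq_Rintegral do rewrite mul0r cos0 mul1r.
  by rewrite /Rintegral integral_normal_pdf.
move=> h; rewrite -/(phi u) expRN.
have -> : s ^+ 2 * u ^+ 2 / 2 = s ^+ 2 / 2 * u ^+ 2 by field.
by apply: (mulIf (lt0r_neq0 (expR_gt0 (s ^+ 2 / 2 * u ^+ 2)))); rewrite h mulVf// lt0r_neq0// expR_gt0.
Qed.

End normal.

(** * Continuous linear forms as Gaussian variables *)

Section gaussian.
Context {R : realType} {X : tvsType R} (hX : hausdorff_space X).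
Notation mu := (@lebesgue_measure R).
Variable gamma : probability (borel X) R.
Hypothesis gamma_gauss : centered_gaussian gamma.

Definition cov (l m : X -> R) := \int[gamma]_x (l x * m x).

Definition law_integral (s : R) (f : R -> R) : R :=
  if (s == 0)%R then f 0 else \int[mu]_x (f x * normal_pdf 0 s x).

Lemma dual_law (l : X -> R) : dual l -> exists2 s : R, 0 <= s &
  (forall f : R -> R, measurable_fun setT f -> (forall x, 0 <= f x) ->
    (\int[gamma]_x (f (l x))%:E =
     if (s == 0)%R then (f 0%R)%:E else \int[mu]_x (f x * normal_pdf 0 s x)%:E)%E).
Proof.
move=> dl; have ml := dual_measurable dl.
have [s s0 hs] := gamma_gauss dl; exists s => // f mf f0.
have mfe : measurable_fun setT (EFin \o f) by exact/measurable_EFinP.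
have [s00|sn0] := eqVneq s 0.
  transitivity (\int[pushforward gamma (l : borel X -> R)]_x (f x)%:E)%E.
    by rewrite (ge0_integral_pushforward ml)// ?preimage_setT// => x _; rewrite lee_fin.
  transitivity (\int[dirac (0%R : R)]_x (f x)%:E)%E.
    have := @eq_measure_integral _ _ _ setT (dirac (0 : R)) 
      (measure_function_pushforward__canonical__measure_function_Measure gamma ml) (EFin \o f).
    by apply => A mA _; rewrite /= hs// s00 eqxx.
  by rewrite integral_dirac// diracT mul1e.
have ml2 : @measurable_fun _ _ (borel X) (measurableTypeR R) setT l := ml.
transitivity (\int[measure_function_pushforward__canonical__measure_function_Measure gamma ml2]_x (EFin \o f) x)%E.
  by rewrite (ge0_integral_pushforward ml2)// ?preimage_setT// => x _; rewrite lee_fin.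
transitivity (\int[normal_prob 0 s]_x (f x)%:E)%E.
  have e := @eq_measure_integral _ _ _ setT (normal_prob 0 s)
      (measure_function_pushforward__canonical__measure_function_Measure gamma ml2) (EFin \o f).
  refine (e _) => A mA _.
  by apply: (etrans (hs A mA)); rewrite (negbTE sn0).
rewrite (@ge0_integral_density _ _ _ (normal_prob 0 s) mu (normal_pdf 0 s) (EFin \o f))//.
- exact: measurable_normal_pdf.
- by move=> x; exact: normal_pdf_ge0.
Qed.

(** Adding the bound of [f] reduces the claim to nonnegative functions; the constant is subtracted
    on both sides afterwards. *)
Lemma dual_law_bounded (l : X -> R) (s : R) :
  (forall f : R -> R, measurable_fun setT f -> (forall x, 0 <= f x) ->
    (\int[gamma]_x (f (l x))%:E =
     if (s == 0)%R then (f 0%R)%:E else \int[mu]_x (f x * normal_pdf 0 s x)%:E)%E) ->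
  dual l -> forall f : R -> R, bounded_measurable f ->
  \int[gamma]_x f (l x) = law_integral s f.
Proof.
move=> hs dl f [mf [M fM]]; have ml := dual_measurable dl.
have bfl : bounded_measurable (fun x : borel X => f (l x)).
  by split; [exact: measurableT_comp|exists M].
have := hs (fun x => f x + M) (measurable_funD mf (measurable_cst M)) ltac:(
  by move=> x; have := fM x; rewrite ler_norml; lra).
have := bRintegralD gamma bfl (bounded_measurable_cst (borel X) M).
rewrite Rintegral_prob_cst /law_integral => h1 h2.
have -> : \int[gamma]_x f (l x) = \int[gamma]_x (f (l x) + M) - M by rewrite h1 addrK.
rewrite /Rintegral h2; case: ifP => s0; first by rewrite /= addrK.
have sn0 : s != 0 by rewrite s0.
have iw := integrable_normal_pdf 0 s.
have iM : mu.-integrable setT (EFin \o (fun x => M * normal_pdf 0 s x)) by exact: integrable_realZl.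
have ifw : mu.-integrable setT (EFin \o (fun x => f x * normal_pdf 0 s x)).
  apply: (@le_integrable _ _ _ mu _ measurableT _ (EFin \o (fun x => M * normal_pdf 0 s x))) => //.
    by apply/measurable_EFinP; apply: measurable_funM => //; exact: measurable_normal_pdf.
  move=> x _; rewrite !abse_EFin lee_fin !normrM; apply: ler_wpM2r => //.
  exact: le_trans (fM x) (ler_norm _).
have e1 := RintegralD measurableT ifw iM.
have -> : fine (\int[mu]_x ((f x + M) * normal_pdf 0 s x)%:E) =
    \int[mu]_x (f x * normal_pdf 0 s x + M * normal_pdf 0 s x).
  by apply: eq_Rintegral => x _; rewrite mulrDl.
rewrite e1 RintegralZl//.
have -> : \int[mu]_x (normal_pdf 0 s x) = 1 by rewrite /Rintegral integral_normal_pdf.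
by rewrite mulr1 addrK.
Qed.

Lemma law_sq (s : R) : 0 <= s ->
  (if (s == 0)%R then (0 ^+ 2 : R)%:E else \int[mu]_x (x ^+ 2 * normal_pdf 0 s x)%:E)%E = (s ^+ 2)%:E.
Proof.
move=> s0; have [->|sn0] := eqVneq s 0; first by rewrite expr0n.
have sp : 0 < s by rewrite lt_def sn0.
rewrite -(normal_second_moment sp) fineK//; apply: integrable_fin_num => //.
apply: (normal_integrable_le sp (p := 2)) => //.
  apply: measurable_funM; last exact: measurable_normal_pdf.
  by apply: measurable_funX.
move=> x; rewrite powR_mulrn// real_normK ?num_real// ger0_norm// mulr_ge0 ?sqr_ge0//.
exact: normal_pdf_ge0.
Qed.

Lemma dual_covar_law (l : X -> R) : dual l -> exists s : R, [/\ 0 <= s,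
  (\int[gamma]_x (l x ^+ 2)%:E)%E = (s ^+ 2)%:E, cov l l = s ^+ 2,
  (forall f : R -> R, bounded_measurable f -> \int[gamma]_x f (l x) = law_integral s f) &
  (forall f : R -> R, measurable_fun setT f -> (forall x, 0 <= f x) -> s != 0 ->
    (\int[gamma]_x (f (l x))%:E = \int[mu]_x (f x * normal_pdf 0 s x)%:E)%E)].
Proof.
move=> dl; have [s s0 hs] := dual_law dl; exists s.
have h2 : (\int[gamma]_x (l x ^+ 2)%:E)%E = (s ^+ 2)%:E.
  by rewrite (hs (fun x => x ^+ 2)) ?law_sq// => x; exact: sqr_ge0.
split=> //.
- by rewrite /cov; under eq_Rintegral do rewrite -expr2; rewrite /Rintegral h2.
- exact: dual_law_bounded.
- by move=> f mf f0 sn0; rewrite hs// (negbTE sn0).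
Qed.

Lemma dual_sq_integral (l : X -> R) : dual l ->
  (\int[gamma]_x (l x ^+ 2)%:E)%E = (cov l l)%:E.
Proof. by move=> /dual_covar_law[s [_ -> ->]]. Qed.

Lemma covar_ge0 (l : X -> R) : dual l -> 0 <= cov l l.
Proof. by move=> /dual_covar_law[s [_ _ -> _ _]]; exact: sqr_ge0. Qed.

Lemma dual_mul_integrable (l m : X -> R) : dual l -> dual m ->
  gamma.-integrable setT (EFin \o (fun x : borel X => l x * m x)).
Proof.
have sq k : dual k -> gamma.-integrable setT (EFin \o (fun x : borel X => k x ^+ 2)).
  move=> dk; apply/integrableP; split.
    by apply/measurable_EFinP; apply: measurable_funX; exact: dual_measurable.
  under eq_integral do rewrite /= ger0_norm ?sqr_ge0//.
  by rewrite dual_sq_integral// ltry.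
move=> dl dm.
apply: (@le_integrable _ _ _ gamma _ measurableT _ (EFin \o (fun x : borel X => l x ^+ 2 + m x ^+ 2))).
- by apply/measurable_EFinP; apply: measurable_funM; exact: dual_measurable.
- move=> x _; rewrite !abse_EFin lee_fin [leRHS]ger0_norm ?addr_ge0 ?sqr_ge0// normrM.
  rewrite -(real_normK (num_real (l x))) -(real_normK (num_real (m x))).
  by have := sqr_ge0 (`|l x| - `|m x|); have := normr_ge0 (l x); have := normr_ge0 (m x); nra.
- by apply: integrable_realD => //; exact: sq.
Qed.

Lemma dual_integrable (l : X -> R) : dual l ->
  gamma.-integrable setT (EFin \o (l : borel X -> R)).
Proof.
move=> dl.
apply: (@le_integrable _ _ _ gamma _ measurableT _ (EFin \o (fun x : borel X => l x * l x + 1))).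
- by apply/measurable_EFinP; exact: dual_measurable.
- move=> x _; rewrite !abse_EFin lee_fin [leRHS]ger0_norm ?addr_ge0 -?expr2 ?sqr_ge0//.
  by rewrite -(real_normK (num_real (l x))); have := sqr_ge0 (`|l x| - 1);
     have := normr_ge0 (l x); nra.
- apply: integrable_realD => //; first exact: dual_mul_integrable.
  by apply: bounded_measurable_integrable; exact: bounded_measurable_cst.
Qed.

Lemma covarC (l m : X -> R) : cov l m = cov m l.
Proof. by apply: eq_Rintegral => x _; rewrite mulrC. Qed.

Lemma covarDl a (l m k : X -> R) : dual l -> dual m -> dual k ->
  cov (fun x => a * l x + m x) k = a * cov l k + cov m k.
Proof.
move=> dl dm dk; rewrite /cov -RintegralZl//; last exact: dual_mul_integrable.
rewrite -RintegralD//; last 2 first.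
- by apply: integrable_realZl => //; exact: dual_mul_integrable.
- exact: dual_mul_integrable.
by apply: eq_Rintegral => x _; ring.
Qed.

Lemma covarDr a (l m k : X -> R) : dual l -> dual m -> dual k ->
  cov k (fun x => a * l x + m x) = a * cov k l + cov k m.
Proof. by move=> *; rewrite covarC covarDl// (covarC l) (covarC m). Qed.

Lemma covar0l (k : X -> R) : cov (fun=> 0) k = 0.
Proof.
by rewrite /cov; under eq_Rintegral do rewrite mul0r; rewrite Rintegral_prob_cst.
Qed.

Lemma cos_dual_bounded (l : X -> R) c : dual l ->
  bounded_measurable (fun x : borel X => cos (l x + c)).
Proof.
move=> dl; have := trig_bounded_measurable (TrigCos 1 c dl).
by under eq_fun do rewrite mul1r.
Qed.

Lemma bounded_measurable_cos : bounded_measurable (@cos R).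
Proof.
split; first by apply: continuous_measurable_fun; exact: continuous_cos.
by exists 1 => x; exact: cos_max.
Qed.

Lemma bounded_measurable_sin : bounded_measurable (@sin R).
Proof.
split; first by apply: continuous_measurable_fun; exact: continuous_sin.
by exists 1 => x; exact: sin_max.
Qed.

Lemma dualN (l : X -> R) : dual l -> dual (fun x => - l x).
Proof.
move=> dl; have := dual_lincomb (-1) dl (@dual0 R X).
by under eq_fun do rewrite mulN1r addr0.
Qed.

Lemma dual_cos_integral (l : X -> R) : dual l ->
  \int[gamma]_x cos (l x) = expR (- (cov l l / 2)).
Proof.
move=> /dual_covar_law[s [s0 _ -> h _]]; rewrite h; last exact: bounded_measurable_cos.
rewrite /law_integral; have [->|sn0] := eqVneq s 0.
  by rewrite cos0 expr0n mul0r oppr0 expR0.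
have sp : 0 < s by rewrite lt_def sn0.
have := normal_char sp 1; rewrite expr1n mulr1 => <-.
by apply: eq_Rintegral => x _; rewrite mul1r.
Qed.

(** A centered Gaussian law is determined by its variance, so [l] and [- l] have the same law, and
    the sine is odd. *)
Lemma dual_sin_integral (l : X -> R) : dual l -> \int[gamma]_x sin (l x) = 0.
Proof.
move=> dl; have dNl := dualN dl.
have [s [s0 _ hc h _]] := dual_covar_law dl.
have [t [t0 _ hc' h' _]] := dual_covar_law dNl.
have ts : t = s.
  apply/eqP; rewrite -(eqrXn2 (n := 2))// -hc -hc' /cov; apply/eqP.
  by apply: eq_Rintegral => x _; rewrite mulrNN.
have h1 := h _ bounded_measurable_sin; have h2 := h' _ bounded_measurable_sin.
have : \int[gamma]_x sin (- l x) = - \int[gamma]_x sin (l x).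
  under eq_Rintegral do rewrite sinN -mulN1r.
  rewrite bRintegralZ ?mulN1r//.
  split; first by apply: measurableT_comp; [apply: continuous_measurable_fun; exact: continuous_sin|exact: dual_measurable].
  by exists 1 => x; exact: sin_max.
by rewrite h1 h2 ts => /eqP; rewrite -addr_eq0 -mulr2n mulrn_eq0 => /eqP.
Qed.

Lemma dual_char (l : X -> R) c : dual l ->
  \int[gamma]_x cos (l x + c) = cos c * expR (- (cov l l / 2)).
Proof.
move=> dl; rewrite -dual_cos_integral//.
have bs : bounded_measurable (fun x : borel X => sin (l x)).
  split; last by exists 1 => x; exact: sin_max.
  by apply: measurableT_comp; [apply: continuous_measurable_fun; exact: continuous_sin|exact: dual_measurable].
have bc : bounded_measurable (fun x : borel X => cos (l x)).
  by have := cos_dual_bounded 0 dl; under eq_fun do rewrite addr0.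
transitivity (\int[gamma]_x (cos c * cos (l x) - sin c * sin (l x))).
  by apply: eq_Rintegral => x _; rewrite cosD mulrC (mulrC (sin c)).
rewrite bRintegralB; try exact: bounded_measurableZ.
by rewrite !bRintegralZ// dual_sin_integral// mulr0 subr0.
Qed.

Lemma covar_self_lincomb a (l m : X -> R) : dual l -> dual m ->
  cov (fun x => a * l x + m x) (fun x => a * l x + m x) =
  a ^+ 2 * cov l l + 2 * a * cov l m + cov m m.
Proof.
move=> dl dm; have dlm := dual_lincomb a dl dm.
by rewrite covarDl// !covarDr// (covarC m l); ring.
Qed.

(* Differentiate [E cos(c + l + e g)] with respect to [e] at [e = 0]. *)
Lemma dual_sin_mul_integral (l g : X -> R) c : dual l -> dual g ->
  \int[gamma]_x (sin (l x + c) * g x) = cos c * cov l g * expR (- (cov l l / 2)).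
Proof.
move=> dl dg.
have dlg e := dual_lincomb e dg dl.
have ms e : measurable_fun setT (fun x : borel X => sin (e * g x + l x + c)).
  apply: measurableT_comp; first by apply: continuous_measurable_fun; exact: continuous_sin.
  by apply: measurable_funD => //; exact: (dual_measurable (dlg e)).
have h1 : is_derive (0 : R) (1 : R) (fun e => \int[gamma]_x cos (e * g x + l x + c))
    (\int[gamma]_x (- 1 * (sin (0 * g x + l x + c) * g x))).
  apply: (@is_derive_under_integral _ _ _ gamma setT
    (fun e (x : borel X) => cos (e * g x + l x + c))
    (fun e (x : borel X) => - 1 * (sin (e * g x + l x + c) * g x)) (fun x => `|g x|)) => //.
  - by move=> e; apply: bounded_measurable_integrable; exact: (cos_dual_bounded c (dlg e)).
  - by move=> e x _; apply: is_derive_eq; rewrite /GRing.scale/=; ring.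
  - exact: (integrable_abse (dual_integrable dg)).
  - move=> e x _; rewrite !normrM normrN1 mul1r -[leRHS]mul1r ler_wpM2r//.
    exact: sin_max.
pose q e := e ^+ 2 * cov g g + 2 * e * cov g l + cov l l.
have h2 : is_derive (0 : R) (1 : R) (fun e => \int[gamma]_x cos (e * g x + l x + c))
    (- (cos c * cov l g * expR (- (cov l l / 2)))).
  have -> : (fun e => \int[gamma]_x cos (e * g x + l x + c)) =
      (fun e => cos c * expR (- ((e ^+ 2 * cov g g + 2 * e * cov g l + cov l l) / 2))).
    by apply/funext => e; rewrite (dual_char c (dlg e)) covar_self_lincomb.
  apply: is_derive_eq; rewrite /GRing.scale/= (covarC g l) expr0n !(mul0r, mulr0, add0r, addr0).
  by field.
have : \int[gamma]_x (- 1 * (sin (0 * g x + l x + c) * g x)) =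
    - (cos c * cov l g * expR (- (cov l l / 2))).
  by have [_ <-] := h1; have [_ <-] := h2.
have -> : \int[gamma]_x (- 1 * (sin (0 * g x + l x + c) * g x)) =
    - 1 * \int[gamma]_x (sin (l x + c) * g x).
  rewrite -RintegralZl//; first by apply: eq_Rintegral => x _; rewrite mul0r add0r.
  apply: (@le_integrable _ _ _ gamma _ measurableT _ (EFin \o (g : borel X -> R))).
  - apply/measurable_EFinP; apply: measurable_funM; last exact: dual_measurable.
    by have := ms 0; under eq_fun do rewrite mul0r add0r.
  - move=> x _; rewrite !abse_EFin lee_fin normrM -[leRHS]mul1r ler_wpM2r//.
    exact: sin_max.
  - exact: dual_integrable.
by rewrite mulN1r => /oppr_inj.
Qed.

Lemma dual_moment (l : X -> R) p : dual l -> cov l l = 1 -> 0 <= p ->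
  (\int[gamma]_x (`|l x| `^ p)%:E)%E = (\int[mu]_x (`|x| `^ p * normal_pdf 0 1 x))%:E.
Proof.
move=> dl l1 p0; have [s [s0 _ hc _ h]] := dual_covar_law dl.
have s1 : s = 1 by apply/eqP; rewrite -(eqrXn2 (n := 2))// -hc l1 expr1n.
rewrite (h (fun x => `|x| `^ p)) ?s1 ?oner_neq0//.
- rewrite fineK//; apply: integrable_fin_num => //.
  exact: normal_moment_integrable.
- by apply: (measurableT_comp (measurable_powR _)).
Qed.

End gaussian.

(** * The Cameron-Martin space *)

Lemma continuous_tvsD {R : realType} {X : tvsType R} (T : topologicalType) (f g : T -> X) :
  continuous f -> continuous g -> continuous (fun t => f t + g t).
Proof.
move=> cf cg t; apply: (@continuous_comp _ _ _ (fun t => (f t, g t)) (fun z : X * X => z.1 + z.2)).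
  by apply: cvg_pair; [exact: cf|exact: cg].
exact: add_continuous.
Qed.

Lemma continuous_tvsZ {R : realType} {X : tvsType R} (T : topologicalType) (f : T -> R) (g : T -> X) :
  continuous f -> continuous g -> continuous (fun t => f t *: g t).
Proof.
move=> cf cg t; pose f' : T -> R^o := f.
apply: (@continuous_comp _ _ _ (fun t => (f' t, g t)) (fun z : R^o * X => z.1 *: z.2)).
  exact: (@cvg_pair T R^o X (nbhs t) (nbhs (f' t)) (nbhs (g t)) (nbhs_filter t)
    (nbhs_filter _) (nbhs_filter _) f' g (cf t) (cg t)).
exact: scale_continuous.
Qed.

Section lebesgue_translation.
Context {R : realType}.
Notation mu := (@lebesgue_measure R).

Lemma lebesgue_measure_translation (a : R) (D : set R) : measurable D ->
  mu [set x | D (x + a)] = mu D.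
Proof.
move=> mD.
have mf : @measurable_fun _ _ (measurableTypeR R) (measurableTypeR R) setT (fun x => x + a).
  exact: measurable_funD.
have := @lebesgue_measure_unique R
  (measure_function_pushforward__canonical__measure_function_Measure mu mf).
move=> /(_ _ D mD) -> //.
move=> _ [[b c] /= _ <-].
rewrite /pushforward.
have -> : (fun x => x + a) @^-1` `]b, c] = `]b - a, c - a]%classic.
  by apply/seteqP; split => x /=; rewrite !in_itv/= ltrBlDr lerBrDr.
rewrite !lebesgue_measure_itv/= !lte_fin ltrD2r.
by case: ifP => // _; congr EFin; ring.
Qed.

(** The normal density vanishes nowhere. Lebesgue null sets are translation invariant, which is how
    translates of null sets are controlled although the normal law is not invariant. *)
Lemma normal_prob_null (s : R) (D : set R) : s != 0 -> measurable D ->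
  normal_prob 0 s D = 0%E <-> mu D = 0%E.
Proof.
move=> s0 mD; have mw : measurable_fun D (EFin \o normal_pdf 0 s).
  apply/measurable_EFinP; apply: (measurable_funS measurableT) => //.
  exact: measurable_normal_pdf.
split=> [D0|D0]; last first.
  exact: ((null_content_dominatesP _ mu).1 (@normal_prob_dominates R 0 s)).
have := (ae_eq_integral_abs mu mD mw).1.
have -> : (\int[mu]_(x in D) `|(EFin \o normal_pdf 0 s) x|)%E = 0%E.
  rewrite -[RHS]D0 /normal_prob; apply: eq_integral => x _.
  by rewrite /= ger0_norm// normal_pdf_ge0.
move=> /(_ erefl) [N [mN N0 DN]]; apply: (subset_measure0 _ _ _ N0) => // x Dx.
apply: DN => /= /(_ Dx) /eqP.
by rewrite normal_pdfE// eqe mulf_eq0 !gt_eqF ?normal_peak_gt0// expR_gt0.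
Qed.

End lebesgue_translation.

Section cameron_martin.
Context {R : realType} {X : tvsType R} (hX : hausdorff_space X).
Notation mu := (@lebesgue_measure R).
Variable gamma : probability (borel X) R.
Hypothesis gamma_radon : radon gamma.
Hypothesis gamma_gauss : centered_gaussian gamma.
Let covar := (cov gamma).

Lemma dual_prob (g : X -> R) (D : set R) : dual g -> covar g g = 1 -> measurable D ->
  gamma [set x | D (g x)] = normal_prob 0 1 D.
Proof.
move=> dg g1 mD; have [s [s0 _ hc _ h]] := dual_covar_law gamma_gauss dg.
have s1 : s = 1 by apply/eqP; rewrite -(eqrXn2 (n := 2))// -hc -/covar g1 expr1n.
have := h \1_D (measurable_indic mD) (fun x => ltac:(by rewrite indicE)).
rewrite s1 oner_neq0 => /(_ isT) e.
have mgD : measurable ([set x | D (g x)] : set (borel X)).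
  by have := dual_measurable dg measurableT mD; rewrite setTI.
transitivity (\int[gamma]_x (\1_[set x : borel X | D (g x)] x)%:E)%E.
  by rewrite integral_indic// setIT.
apply: (etrans e); rewrite /normal_prob [RHS]integral_mkcond; apply: eq_integral => x _.
by rewrite patchE indicE; case: (_ \in _); rewrite ?mul1r ?mul0r.
Qed.

Lemma dual_zero (l : X -> R) : dual l -> l 0 = 0.
Proof.
move=> [+ _] => /(_ 1 0 0); rewrite scaler0 add0r => /eqP.
by rewrite -subr_eq subrr mul1r eq_sym => /eqP.
Qed.

Lemma dual_add (l : X -> R) x y : dual l -> l (x + y) = l x + l y.
Proof. by move=> [+ _] => /(_ 1 x y); rewrite scale1r => ->; congr (_ + _); exact: mul1r. Qed.

Lemma dual_scale (l : X -> R) a x : dual l -> l (a *: x) = a * l x.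
Proof. by move=> dl; have [+ _] := dl => /(_ a x 0); rewrite addr0 dual_zero// addr0. Qed.

Lemma dualZ c (g : X -> R) : dual g -> dual (fun x => c * g x).
Proof.
by move=> dg; have := dual_lincomb c dg (@dual0 R X); under eq_fun do rewrite addr0.
Qed.

Lemma covarZZ c (g : X -> R) : dual g ->
  covar (fun x => c * g x) (fun x => c * g x) = c ^+ 2 * covar g g.
Proof.
move=> dg; rewrite /covar /cov -RintegralZl//; last exact: dual_mul_integrable.
by apply: eq_Rintegral => x _; ring.
Qed.

Section direction.
Variable g : X -> R.
Hypotheses (dg : dual g) (g1 : covar g g = 1).

Lemma two_point_inner (l : X -> R) th x : dual l ->
  \int[gamma]_y cos (l x + (g y - g x) * covar l g + th) =
  expR (- (covar l g ^+ 2 / 2)) * cos (- covar l g * g x + l x + th).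
Proof.
move=> dl; set c := covar l g.
transitivity (\int[gamma]_y cos (c * g y + (- c * g x + l x + th))).
  by apply: eq_Rintegral => y _; congr cos; ring.
by rewrite (dual_char gamma_gauss)//; [rewrite -/covar covarZZ// g1 mulr1 mulrC|exact: dualZ].
Qed.

(** The form [l - covar l g * g] is uncorrelated with [g], so replacing the contribution of [g x] to
    [l x] by that of an independent [g y] leaves the law unchanged: the two exponents add up to that
    of [l]. *)
Lemma two_point_char (l : X -> R) th : dual l ->
  \int[gamma]_x (\int[gamma]_y cos (l x + (g y - g x) * covar l g + th)) =
  \int[gamma]_x cos (l x + th).
Proof.
move=> dl; have dlg := dual_lincomb (- covar l g) dg dl.
transitivity (\int[gamma]_x (expR (- (covar l g ^+ 2 / 2)) * cos (- covar l g * g x + l x + th))).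
  by apply: eq_Rintegral => x _; exact: two_point_inner.
rewrite bRintegralZ; last exact: (cos_dual_bounded th dlg).
rewrite !(dual_char gamma_gauss)// mulrCA -expRD.
rewrite (covar_self_lincomb gamma_gauss)// (covarC gamma g l) -/covar g1.
by congr (_ * expR _); field.
Qed.

(** If [h] represents [g], this function is [l] at [x + (g y - g x) *: h]. It is written without
    [h], whose existence is to be proved. *)
Definition two_point : set (X * X -> R) :=
  [set u | exists2 l, dual l & u = fun z => l z.1 + (g z.2 - g z.1) * covar l g].

Lemma two_point0 : two_point (fun=> 0).
Proof.
exists (fun=> 0); first exact: dual0.
by apply/funext => z; rewrite /covar covar0l mulr0 addr0.
Qed.

Lemma two_pointD a u v : two_point u -> two_point v -> two_point (fun z => a * u z + v z).
Proof.
move=> [l dl ->] [k dk ->]; exists (fun x => a * l x + k x); first exact: dual_lincomb.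
by apply/funext => z; rewrite /covar (covarDl gamma_gauss)//; ring.
Qed.

Lemma two_point_continuous u : two_point u -> continuous u.
Proof.
move=> [l dl ->] z.
have cl k : dual k -> continuous (fun z : X * X => k z.1) /\ continuous (fun z : X * X => k z.2).
  move=> dk; split=> w.
    by apply: (@continuous_comp _ _ _ fst k); [exact: cvg_fst|exact: dual_continuous].
  by apply: (@continuous_comp _ _ _ snd k); [exact: cvg_snd|exact: dual_continuous].
apply: cvgD; first exact: (cl l dl).1.
by apply: cvgMl; apply: cvgB; [exact: (cl g dg).2|exact: (cl g dg).1].
Qed.

(** Measurability of all sections and of the inner mean is carried along with the equality of means,
    because it is needed to add the iterated integrals; no Fubini theorem on the product is
    invoked. *)
Lemma two_point_trig (u : X * X -> R) : trig_poly two_point u ->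
  [/\ forall x, bounded_measurable (fun y : borel X => u (x, y)),
      bounded_measurable (fun x : borel X => \int[gamma]_y u (x, y)),
      bounded_measurable (fun x : borel X => u (x, x)) &
      \int[gamma]_x (\int[gamma]_y u (x, y)) = \int[gamma]_x u (x, x)].
Proof.
elim=> [a w th [l dl ->]|{}u v _ [u1 u2 u3 u4] _ [v1 v2 v3 v4]] /=.
  have dlg := dual_lincomb (- covar l g) dg dl.
  have b1 x : bounded_measurable (fun y : borel X => cos (l x + (g y - g x) * covar l g + th)).
    have := cos_dual_bounded (- covar l g * g x + l x + th) (dualZ (covar l g) dg).
    congr bounded_measurable; apply/funext => y; congr cos; ring.
  have e2 : (fun x : borel X => \int[gamma]_y (a * cos (l x + (g y - g x) * covar l g + th))) =
      (fun x => a * (expR (- (covar l g ^+ 2 / 2)) * cos (- covar l g * g x + l x + th))).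
    by apply/funext => x; rewrite bRintegralZ// two_point_inner.
  have e3 : (fun x : borel X => a * cos (l x + (g x - g x) * covar l g + th)) =
      (fun x => a * cos (l x + th)).
    by apply/funext => x; rewrite subrr mul0r addr0.
  split.
  - by move=> x; apply: bounded_measurableZ.
  - by rewrite e2; do 2 apply: bounded_measurableZ; exact: (cos_dual_bounded th dlg).
  - by rewrite e3; apply: bounded_measurableZ; exact: cos_dual_bounded.
  - rewrite e3 bRintegralZ; last exact: cos_dual_bounded.
    rewrite -two_point_char// -bRintegralZ; first by apply: eq_Rintegral => x _; rewrite bRintegralZ.
    have -> : (fun x : borel X => \int[gamma]_y cos (l x + (g y - g x) * covar l g + th)) =
        (fun x => expR (- (covar l g ^+ 2 / 2)) * cos (- covar l g * g x + l x + th)).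
      by apply/funext => x; exact: two_point_inner.
    by apply: bounded_measurableZ; exact: (cos_dual_bounded th dlg).
have e : (fun x : borel X => \int[gamma]_y (u (x, y) + v (x, y))) =
    (fun x => \int[gamma]_y u (x, y) + \int[gamma]_y v (x, y)).
  by apply/funext => x; rewrite bRintegralD.
split.
- by move=> x; exact: bounded_measurableD.
- by rewrite e; exact: bounded_measurableD.
- exact: bounded_measurableD.
- by rewrite e !bRintegralD// u4 v4.
Qed.

End direction.

Let halfspace_compact (g : X -> R) : dual g -> covar g g = 1 ->
  exists A : set X, [/\ compact A, (forall x, A x -> 1 <= g x) & 0 < fine (gamma A)].
Proof.
move=> dg g1.
have mB : measurable ([set x | `[1, +oo[%classic (g x)] : set (borel X)).
  have := dual_measurable dg measurableT (measurable_itv `[1, +oo[).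
  by rewrite setTI.
have [A [cA AB A0]] : exists A : set X, [/\ compact A, A `<=` [set x | `[1, +oo[%classic (g x)] & 0 < fine (gamma A)].
  apply: (inner_compact hX gamma_radon mB); rewrite fine_gt0// lt0e measure_ge0 andbT.
  rewrite ltey_eq fin_num_measure// andbT.
  rewrite dual_prob//; apply/eqP => /(normal_prob_null (oner_neq0 _) (measurable_itv _)).1.
  by rewrite lebesgue_measure_itv/= ltry.
by exists A; split=> // x /AB /=; rewrite in_itv/= andbT.
Qed.

(* If there were no such [h], then for compact sets [A] in [g >= 1], [B] in
   [g <= -1] and [K] no pair in [A * B] could be identified with a point [z] of
   [K] by [l x + (g y - g x) * covar l g = l z] for all [l]. A Urysohn function
   built from these forms is then 1 on [A * B] and 0 on [K]; by
   [two_point_char] its two means agree, although gamma A * gamma B exceeds the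
   mass outside a large [K]. *)
Lemma cm_vector (g : X -> R) : dual g -> covar g g = 1 ->
  exists h : X, forall l, dual l -> l h = covar l g.
Proof.
move=> dg g1.
have [A [cA Ag A0]] := halfspace_compact dg g1.
have dNg := dualN dg.
have [B [cB Bg B0]] : exists A : set X, [/\ compact A, (forall x, A x -> 1 <= - g x) & 0 < fine (gamma A)].
  apply: (halfspace_compact dNg).
  by rewrite -g1; apply: eq_Rintegral => x _; rewrite mulrNN.
have mA := compact_borel hX cA; have mB := compact_borel hX cB.
have AB0 : 0 < fine (gamma A) * fine (gamma B) by exact: mulr_gt0.
have [K [cK _ Kg]] : exists K : set X, [/\ compact K, K `<=` setT & 1 - fine (gamma A) * fine (gamma B) < fine (gamma K)].
  by apply: (inner_compact hX gamma_radon measurableT); rewrite probability_setT/= ltrBlDr ltrDl.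
have mK := compact_borel hX cK.

have [sep|] := pselect (forall z w, (A `*` B) z -> ((fun x : X => (x, x)) @` K) w ->
    exists2 l, two_point g l & l z != l w); last first.
  move=> /existsNP [[x y]] /existsNP [w] /not_implyP[[/= Ax By]] /not_implyP[[x' Kx' <-]] ns.
  have xy : g y - g x != 0.
    by apply/eqP; have := Ag _ Ax; have := Bg _ By; lra.
  (* A pair that no form separates from a diagonal point satisfies
     [l x + (g y - g x) * covar l g = l x'] for all [l], and [h] is read off. The divisor is nonzero
     because [g] is at least 1 on [A] and at most -1 on [B]. *)
  exists ((g y - g x)^-1 *: (x' - x)) => l dl.
  have lin : l x + (g y - g x) * covar l g = l x'.
    apply/eqP; apply/negPn/negP => ne; apply: ns.
    exists (fun z => l z.1 + (g z.2 - g z.1) * covar l g); first by exists l.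
    by rewrite /= subrr mul0r addr0.
  have -> : l ((g y - g x)^-1 *: (x' - x)) = (g y - g x)^-1 * (l x' - l x).
    by rewrite dual_scale// dual_add// -(scaleN1r x) dual_scale// mulN1r.
  by rewrite -lin addrAC subrr add0r mulKf.
have cKK : compact ((fun x : X => (x, x)) @` K).
  apply: continuous_compact => //; apply: continuous_subspaceT => x.
  by apply: cvg_pair; exact: cvg_id.
have [v [uv v01 v1 v0]] := urysohn_trig (two_point0 g) (two_pointD dg) (two_point_continuous dg)
  (compact_setX cA cB) cKK sep.
(* A quarter of the gap: replacing [v] by [u] costs [e] in each of the two means, and 2 e is less
   than the gap 4 e. *)
pose e := (fine (gamma A) * fine (gamma B) - (1 - fine (gamma K))) / 4.
have e0 : 0 < e by rewrite divr_gt0// subr_gt0; lra.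
have [u tu vu] := uv e e0.
have [u1 u2 u3 u4] := two_point_trig dg g1 tu.
have h1 : fine (gamma A) * fine (gamma B) - e <= \int[gamma]_x (\int[gamma]_y u (x, y)).
  have -> : fine (gamma A) * fine (gamma B) - e = \int[gamma]_x (fine (gamma B) * \1_(A : set (borel X)) x - e).
    rewrite bRintegralB; [|apply: bounded_measurableZ; exact: bounded_measurable_indic|exact: bounded_measurable_cst].
    rewrite bRintegralZ; last exact: bounded_measurable_indic.
    by rewrite Rintegral_prob_indic// Rintegral_prob_cst mulrC.
  apply: le_bRintegral => //.
    apply: bounded_measurableB; last exact: bounded_measurable_cst.
    by apply: bounded_measurableZ; exact: bounded_measurable_indic.
  move=> x; have -> : fine (gamma B) * \1_A x - e = \int[gamma]_y (\1_A x * \1_(B : set (borel X)) y - e).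
    rewrite bRintegralB; [|apply: bounded_measurableZ; exact: bounded_measurable_indic|exact: bounded_measurable_cst].
    rewrite bRintegralZ; last exact: bounded_measurable_indic.
    by rewrite Rintegral_prob_indic// Rintegral_prob_cst mulrC.
  apply: le_bRintegral => //.
    apply: bounded_measurableB; last exact: bounded_measurable_cst.
    by apply: bounded_measurableZ; exact: bounded_measurable_indic.
  move=> y; have := vu (x, y); rewrite ler_norml => /andP[_ h].
  suff : \1_A x * \1_B y <= v (x, y) by move: (_ * _) (v _) (u _) h => *; lra.
  have /andP[w0 w1] := v01 (x, y); rewrite !indicE.
  have [/set_mem Ax|_] := boolP (x \in A); last by rewrite mul0r.
  have [/set_mem By|_] := boolP (y \in B); last by rewrite mulr0.
  by rewrite v1 ?mulr1.
have h2 : \int[gamma]_x u (x, x) <= 1 - fine (gamma K) + e.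
  have -> : 1 - fine (gamma K) + e = \int[gamma]_x (\1_(~` K : set (borel X)) x + e).
    rewrite bRintegralD; [|apply: bounded_measurable_indic; exact: measurableC|exact: bounded_measurable_cst].
    by rewrite Rintegral_prob_indic ?Rintegral_prob_cst ?fine_probC//; exact: measurableC.
  apply: le_bRintegral => //.
    apply: bounded_measurableD; last exact: bounded_measurable_cst.
    by apply: bounded_measurable_indic; exact: measurableC.
  move=> x; have := vu (x, x); rewrite ler_norml => /andP[h _].
  have /andP[w0 w1] := v01 (x, x).
  suff : v (x, x) <= \1_(~` K) x by move: (\1_ _ _) (v _) (u _) h => *; lra.
  rewrite indicE; have [_|] := boolP (x \in _); first by [].
  by rewrite notin_setE => /contrapT Kx; rewrite v0//; exists x.
have : e * 4 = fine (gamma A) * fine (gamma B) - (1 - fine (gamma K)) by rewrite divfK.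
by rewrite u4 in h1; lra.
Qed.

(** [h] is the image of [g] under the covariance operator, the canonical map from X^* to the
    Cameron-Martin space. *)
Definition cm_rep (g : X -> R) (h : X) := forall l, dual l -> l h = covar l g.

Lemma cm_rep_lincomb a g g' h h' : dual g -> dual g' -> cm_rep g h -> cm_rep g' h' ->
  cm_rep (fun x => a * g x + g' x) (a *: h + h').
Proof.
move=> dg dg' rg rg' l dl; rewrite dual_add// dual_scale// rg// rg'//.
by rewrite /covar (covarDr gamma_gauss).
Qed.

Lemma covar_cauchy (l g : X -> R) : dual l -> dual g -> covar l l <= 1 ->
  covar l g <= Num.sqrt (covar g g).
Proof.
move=> dl dg l1.
have hq b : 0 <= b ^+ 2 * covar l l + 2 * b * covar l g + covar g g.
  rewrite -(covar_self_lincomb gamma_gauss)//; apply: covar_ge0 => //.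
  exact: dual_lincomb.
have [c0|c0] := leP (covar l g) 0; first by apply: (le_trans c0); exact: sqrtr_ge0.
rewrite -(ger0_norm (ltW c0)) -sqrtr_sqr ler_wsqrtr//.
(* The quadratic is evaluated at its minimiser for a form [l] of variance 1; a smaller variance only
   helps. *)
have := hq (- covar l g) => h.
have : (- covar l g) ^+ 2 * covar l l <= (- covar l g) ^+ 2.
  by rewrite -[leRHS]mulr1 ler_wpM2l// sqr_ge0.
by rewrite sqrrN; nra.
Qed.

(** Cauchy-Schwarz bounds the supremum, and [g] divided by its L^2 norm attains it; if [g] has
    variance 0, the zero form does. *)
Lemma cm_norm_rep g h : dual g -> cm_rep g h ->
  cm_norm gamma h = (Num.sqrt (covar g g))%:E.
Proof.
move=> dg rg; apply/eqP; rewrite eq_le; apply/andP; split.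
  apply: ub_ereal_sup => _ [l [dl l1] <-]; rewrite lee_fin rg//.
  by apply: covar_cauchy => //; rewrite -lee_fin -(dual_sq_integral gamma_gauss).
have [g0|g0] := eqVneq (covar g g) 0.
  rewrite g0 sqrtr0; apply: ereal_sup_ubound; exists (fun=> 0) => //.
  split; first exact: dual0.
  by rewrite (dual_sq_integral gamma_gauss) ?covar0l ?lee_fin//; exact: dual0.
have gp : 0 < covar g g by rewrite lt_def g0 (covar_ge0 gamma_gauss).
have s0 : Num.sqrt (covar g g) != 0 by rewrite sqrtr_eq0 -ltNge.
have dlg := dualZ (Num.sqrt (covar g g))^-1 dg.
apply: ereal_sup_ubound; exists (fun x => (Num.sqrt (covar g g))^-1 * g x).
  split=> //; rewrite (dual_sq_integral gamma_gauss)// -/covar covarZZ//.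
  by rewrite exprVn sqr_sqrtr ?(ltW gp)// mulVf.
congr EFin; rewrite rg//.

by rewrite -{2}[covar g g]sqr_sqrtr ?(ltW gp)// expr2 mulKf.
Qed.

Lemma cm_inner_rep g h g' h' : dual g -> dual g' -> cm_rep g h -> cm_rep g' h' ->
  cm_inner gamma h h' = covar g g'.
Proof.
move=> dg dg' rg rg'; rewrite /cm_inner.
have -> : h + h' = 1 *: h + h' by rewrite scale1r.
have -> : h - h' = -1 *: h' + h by rewrite scaleN1r addrC.
rewrite (cm_norm_rep _ (cm_rep_lincomb 1 dg dg' rg rg')); last exact: dual_lincomb.
rewrite (cm_norm_rep _ (cm_rep_lincomb (-1) dg' dg rg' rg)); last exact: dual_lincomb.
rewrite /= !sqr_sqrtr; try by apply: (covar_ge0 gamma_gauss); exact: dual_lincomb.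
rewrite /covar !(covar_self_lincomb gamma_gauss)// (covarC gamma g' g) -/covar.
by field.
Qed.

Section shift.
Variables (g : X -> R) (h : X).
Hypotheses (dg : dual g) (g1 : covar g g = 1) (rg : cm_rep g h).

(** This map redraws the [g]-coordinate of [x] from an independent point [y] and keeps the rest, so
    it preserves [gamma]. *)
Let m (x y : X) : X := x + (g y - g x) *: h.

Let m_cont : continuous (fun z : X * X => m z.1 z.2).
Proof.
apply: continuous_tvsD; first by move=> z; exact: cvg_fst.
apply: continuous_tvsZ; last by move=> z; exact: cvg_cst.
move=> z; apply: cvgB.
  by apply: (@continuous_comp _ _ _ snd g); [exact: cvg_snd|exact: dual_continuous].
by apply: (@continuous_comp _ _ _ fst g); [exact: cvg_fst|exact: dual_continuous].
Qed.

Let m_trig l th : dual l ->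
  \int[gamma]_x (\int[gamma]_y cos (l (m x y) + th)) = \int[gamma]_x cos (l x + th).
Proof.
move=> dl; rewrite -(two_point_char dg g1 th dl); apply: eq_Rintegral => x _; apply: eq_Rintegral => y _.
by rewrite /m dual_add// dual_scale// rg.
Qed.

(** By invariance under [m], a set is null when almost every line in direction [h] meets it in a set
    that is null for the normal law, equivalently for Lebesgue measure. Shifting by [c *: h]
    translates these traces, which keeps them Lebesgue null. *)
Lemma shift_null c (B : set X) : measurable (B : set (borel X)) -> gamma B = 0%E ->
  gamma [set x | B (x + c *: h)] = 0%E.
Proof.
move=> mB B0.
have line_cont x : continuous (fun s : R => x - g x *: h + s *: h).
  apply: continuous_tvsD; first by move=> ?; exact: cvg_cst.
  by apply: continuous_tvsZ => ?; [exact: cvg_id|exact: cvg_cst].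
have mline x (C : set X) : measurable (C : set (borel X)) ->
    measurable [set s : R | C (x - g x *: h + s *: h)].
  have mf : measurable_fun setT (fun s : R => (x - g x *: h + s *: h : borel X)).
    apply: (measurability (@open X : set (set (borel X))) erefl) => //= _ [U oU <-].
    by rewrite setTI; apply: open_measurable; exact: (open_comp (fun s _ => line_cont x s) oU).
  by move=> mC; have := mf measurableT _ mC; rewrite setTI.
have msh : measurable ([set x | B (x + c *: h)] : set (borel X)).
  have : measurable_fun setT (fun x : borel X => (x + c *: h : borel X)).
    apply: continuous_borel2.
    apply: continuous_tvsD => ?; [exact: cvg_id|exact: cvg_cst].
  by move=> /(_ measurableT _ mB); rewrite setTI.
have mE x y : m x y = x - g x *: h + g y *: h by rewrite /m scalerBl addrA addrAC.
have sec x (C : set X) : measurable (C : set (borel X)) ->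
    gamma [set y | C (m x y)] = normal_prob 0 1 [set s : R | C (x - g x *: h + s *: h)].
  move=> mC; rewrite -(dual_prob dg g1 (mline x C mC)); congr (gamma _).
  by apply/seteqP; split => y /=; rewrite mE.
rewrite -(slice_prob_invariant hX gamma_radon m_cont m_trig msh).
rewrite -B0 -(slice_prob_invariant hX gamma_radon m_cont m_trig mB).
have B00 := slice_prob_invariant hX gamma_radon m_cont m_trig mB.
rewrite B0 in B00; rewrite B00.
have mi (C : set X) : measurable (C : set (borel X)) ->
    measurable_fun setT (fun x : borel X => gamma [set y | C (m x y)]).
  by move=> mC; exact: (measurable_slice_prob hX gamma_radon m_cont).
have ae0 := (ae_eq_integral_abs gamma measurableT (mi B mB)).1.
have {}ae0 : ae_eq gamma setT (fun x : borel X => gamma [set y | B (m x y)]) (cst 0%E).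
  by apply: ae0; rewrite -[RHS]B00; apply: eq_integral => x _; rewrite gee0_abs.
apply: (etrans _ (integral0 gamma setT)).
apply: ae_eq_integral => //; first exact: mi.
move: ae0; apply: filterS => x h0 _; have {h0} := h0 I.
rewrite /cst sec// => /(normal_prob_null (oner_neq0 _) (mline x B mB)).1 h0.
rewrite (sec _ _ msh); apply/(normal_prob_null (oner_neq0 _) (mline x _ msh)).
rewrite -[RHS]h0 -(lebesgue_measure_translation c (mline x B mB)); congr (_ _).
by apply/seteqP; split=> s /=; rewrite scalerDl addrA.
Qed.

Lemma cm_rep_cameron_martin : cameron_martin gamma h.
Proof.
split.
  by apply/null_content_dominatesP => B mB B0; have := @shift_null 1 B mB B0; rewrite scale1r.
have mf : measurable_fun setT (fun x : borel X => (x + h : borel X)).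
  apply: continuous_borel2.
  apply: continuous_tvsD => ?; [exact: cvg_id|exact: cvg_cst].
apply/(null_content_dominatesP gamma
  (measure_function_pushforward__canonical__measure_function_Measure gamma mf)) => B mB B0.
have msh : measurable ([set x | B (x + h)] : set (borel X)).
  by have := mf measurableT _ mB; rewrite setTI.
have := @shift_null (-1) _ msh B0.
rewrite (_ : [set x | _] = B)//; apply/seteqP; split=> x /=;
  by rewrite scaleN1r subrK.
Qed.

End shift.

End cameron_martin.

(** * Smooth cylindrical functions and cutoffs *)

Section smooth1.
Context {R : realType}.
Implicit Types u v w : R -> R.

(** Smoothness is witnessed by a family stable under derivation. For the concrete functions such a
    family is explicit, which avoids formulas for iterated derivatives. *)
Definition smooth1 u := exists F : set (R -> R), F u /\
  forall v, F v -> exists2 w, F w & forall x : R, is_derive x (1 : R) v (w x).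

Lemma smooth1_derive u : smooth1 u ->
  exists2 w, smooth1 w & forall x : R, is_derive x (1 : R) u (w x).
Proof.
move=> [F [Fu Fd]]; have [w Fw dw] := Fd u Fu.
by exists w => //; exists F.
Qed.

Lemma smooth1_continuous u : smooth1 u -> continuous u.
Proof. by move=> /smooth1_derive[w _]; exact: is_derive_continuous. Qed.

Lemma poly_expR_bound (P : {poly R}) :
  exists2 C, 0 <= C & forall y : R, 0 <= y -> `|P.[y] * expR (- y)| <= C.
Proof.
have pw k (y : R) : 0 <= y -> y ^+ k * expR (- y) <= k%:R ^+ k.
  move=> y0; case: k => [|k]; first by rewrite !expr0 mul1r -expR0 ler_expR oppr_le0.
  rewrite expRN ler_pdivrMr ?expR_gt0//.
  have -> : expR y = expR (y / k.+1%:R) ^+ k.+1 by rewrite -expRM_natl mulrC divfK ?pnatr_eq0.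
  rewrite -exprMn lerXn2r ?nnegrE ?mulr_ge0 ?expR_ge0//.
  rewrite -ler_pdivrMl ?ltr0n// mulrC.
  by have := expR_ge1Dx (y / k.+1%:R); move: (y / _) => z h; lra.
exists (\sum_(i < size P) `|P`_i| * i%:R ^+ i).
  by apply: sumr_ge0 => i _; rewrite mulr_ge0// exprn_ge0.
move=> y y0; rewrite horner_coef mulr_suml; apply: (le_trans (ler_norm_sum _ _ _)).
apply: ler_sum => i _; rewrite -mulrA normrM ler_wpM2l//.
by rewrite ger0_norm ?mulr_ge0 ?exprn_ge0 ?expR_ge0// pw.
Qed.

(** With [P = 1] this is the classical function exp(-1 / x) extended by 0. Polynomial factors in 1 /
    x make the class stable under derivation, so smoothness at 0 reduces to one derivative. *)
Definition flat (P : {poly R}) (x : R) : R :=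
  if 0 < x then P.[x^-1] * expR (- x^-1) else 0.

Lemma flat_bound (P : {poly R}) : exists2 C, 0 <= C & forall x, `|flat P x| <= C.
Proof.
have [C C0 hC] := poly_expR_bound P; exists C => // x; rewrite /flat.
by case: ifP => [x0|_]; [apply: hC; rewrite invr_ge0 (ltW x0)|rewrite normr0].
Qed.

Lemma flatM_bound (P : {poly R}) : exists2 C, 0 <= C & forall x, `|flat P x| <= C * `|x|.
Proof.
have [C C0 hC] := flat_bound (P * 'X); exists C => // x.
have [x0|x0] := ltP 0 x; last by rewrite /flat ltNge x0 normr0 mulr_ge0.
have := hC x; rewrite /flat x0 hornerMX !normrM normfV => h.
by rewrite -(ler_pM2r (_ : 0 < `|x|^-1)) ?invr_gt0 ?normr_gt0 ?gt_eqF// mulfK ?normr_eq0 ?gt_eqF// mulrAC.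
Qed.

(** With y = 1 / x one has dy/dx = - y^2, so P(y) exp(-y) has derivative (P - P')(y) y^2 exp(-y). *)
Definition flat_deriv (P : {poly R}) : {poly R} := (P - P^`()) * 'X^2.

Lemma is_derive_flat (P : {poly R}) (x : R) : is_derive x (1 : R) (flat P) (flat (flat_deriv P) x).
Proof.
have [x0|x0|<-] := ltgtP 0 x.
- refine (@near_eq_is_derive _ R^o R^o (fun y => P.[y^-1] * expR (- y^-1)) (flat P) x 1 _ _ _).
    near=> y; rewrite /flat ifT//; near: y; exact: lt_nbhsr.
  have x1 : x != 0 by rewrite gt_eqF.
  have dV : is_derive x (1 : R) (fun y => y^-1) (- x ^- 2).
    by have := @is_deriveV _ id x 1 1 x1 (is_derive_id _ _); rewrite /GRing.scale/= mulr1.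
  have dN : is_derive x (1 : R) (fun y => - y^-1) (x ^- 2).
    by apply: is_derive_eq; rewrite opprK.
  have dP : is_derive x (1 : R) (fun y => P.[y^-1]) (P^`().[x^-1] * - x ^- 2).
    exact: (@is_derive1_comp _ (horner P) (fun y => y^-1) x _ _ (is_derive_poly P x^-1) dV).
  have dE : is_derive x (1 : R) (fun y => expR (- y^-1)) (expR (- x^-1) * x ^- 2).
    exact: (@is_derive1_comp _ expR (fun y => - y^-1) x _ _ (is_derive_expR _) dN).
  have := @is_deriveM _ _ _ _ _ _ _ _ dP dE.
  rewrite /flat /flat_deriv x0 /GRing.scale/= => h; apply: (is_derive_eq h).
  rewrite hornerM hornerD hornerN hornerXn exprVn.
  by move: (expR _) (P.[_]) (P^`().[_]) (x ^- 2) => *; ring.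
- have -> : flat (flat_deriv P) x = 0 by rewrite /flat ltNge (ltW x0).
  refine (@near_eq_is_derive _ R^o R^o (fun=> 0) (flat P) x 1 0 _ (is_derive_cst _ _ _)).
  near=> y; rewrite /flat ifF//; apply/negbTE; rewrite -leNgt; apply: ltW; near: y; exact: lt_nbhsl.
have -> : flat (flat_deriv P) 0 = 0 by rewrite /flat ltxx.
(* The difference quotient at 0 is 0 on the left and [flat (P * 'X)] on the right, hence at most C
   |h|. *)
have [C C0 hC] := flatM_bound (P * 'X).
have hcvg : h^-1 *: ((flat P \o shift 0) (h *: (1 : R)) - flat P 0) @[h --> 0^'] --> 0.
  apply/cvgr0Pnorm_le => e e0; near=> h.
  have h0 : h != 0 by near: h; exact: nbhs_dnbhs_neq.
  rewrite /= /flat ltxx subr0 addr0 [_ *: 1]mulr1.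
  have [hp|hp] := ltP 0 h; last by rewrite scaler0 normr0 (ltW e0).
  have := hC h; rewrite /flat hp hornerMX => hb.
  have -> : h^-1 *: (P.[h^-1] * expR (- h^-1)) = P.[h^-1] * h^-1 * expR (- h^-1).
    by rewrite /GRing.scale/=; ring.
  apply: (le_trans hb); apply: (@le_trans _ _ ((C + 1) * `|h|)); first by rewrite ler_wpM2r// lerDl.
  rewrite mulrC -ler_pdivlMr; last lra.
  by near: h; apply: (@dnbhs0_le _ R^o); rewrite divr_gt0//; lra.
by split; [apply/cvg_ex; exists 0|apply/cvg_lim].
Unshelve. all: by end_near. Qed.

Lemma smooth1_flat P : smooth1 (flat P).
Proof.
exists [set u | exists Q, u = flat Q]; split; first by exists P.
by move=> _ [Q ->]; exists (flat (flat_deriv Q)); [exists (flat_deriv Q)|exact: is_derive_flat].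
Qed.

(* [x |-> exp (2 - 1 / (1 + x) - 1 / (1 - x))] on ]-1, 1[ *)
Definition bump (x : R) : R := expR 1 * flat 1 (1 + x) * (expR 1 * flat 1 (1 - x)).

Lemma flat1_ge0 x : 0 <= flat 1 x.
Proof. by rewrite /flat; case: ifP => // _; rewrite hornerC mul1r expR_ge0. Qed.

Lemma flat1_le1 x : flat 1 x <= 1.
Proof.
rewrite /flat; case: ifP => // x0; rewrite hornerC mul1r -expR0 ler_expR oppr_le0.
by rewrite invr_ge0 ltW.
Qed.

Lemma bump_ge0 x : 0 <= bump x.
Proof. by rewrite !mulr_ge0 ?expR_ge0 ?flat1_ge0. Qed.

Lemma bump_le1 x : bump x <= 1.
Proof.
rewrite /bump /flat; case: ifP => [x1|_]; last by rewrite mulr0 mul0r.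
case: ifP => [x2|_]; last by rewrite !mulr0.
rewrite !hornerC !mul1r -!expRD -[leRHS]expR0 ler_expR.
have -> : 1 - (1 + x)^-1 + (1 - (1 - x)^-1) = - (2 * x ^+ 2) / ((1 + x) * (1 - x)).
  by field; rewrite !gt_eqF.
by rewrite mulNr oppr_le0 divr_ge0 // mulr_ge0 ?sqr_ge0 ?(ltW x1) ?(ltW x2).
Qed.

Lemma bump0 : bump 0 = 1.
Proof. by rewrite /bump addr0 subr0 /flat ltr01 hornerC mul1r invr1 -expRD subrr expR0 mulr1. Qed.

Lemma bump_support x : bump x != 0 -> -1 <= x <= 1.
Proof.
rewrite /bump /flat; case: ifP => [x1|_]; last by rewrite mulr0 mul0r eqxx.
by case: ifP => [x2 _|_]; [lra|rewrite !mulr0 eqxx].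
Qed.

Definition bump_deriv (x : R) : R :=
  expR 1 ^+ 2 * (flat (flat_deriv 1) (1 + x) * flat 1 (1 - x) - flat 1 (1 + x) * flat (flat_deriv 1) (1 - x)).

Lemma is_derive_bump (x : R) : is_derive x (1 : R) bump (bump_deriv x).
Proof.
have d1 : is_derive x (1 : R) (fun x => flat 1 (1 + x)) (flat (flat_deriv 1) (1 + x)).
  have := @is_derive1_comp _ (flat 1) (fun x => 1 + x) x _ 1 (is_derive_flat _ _).
  rewrite mulr1; apply.
  by have := is_deriveD (is_derive_cst (1 : R) x 1) (is_derive_id x (1 : R)); rewrite add0r.
have d2 : is_derive x (1 : R) (fun x => flat 1 (1 - x)) (- flat (flat_deriv 1) (1 - x)).
  have := @is_derive1_comp _ (flat 1) (fun x => 1 - x) x _ (-1) (is_derive_flat _ _).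
  rewrite mulrN1; apply.
  by have := is_deriveB (is_derive_cst (1 : R) x 1) (is_derive_id x (1 : R)); rewrite sub0r.
rewrite /bump; apply: is_derive_eq; rewrite /bump_deriv /GRing.scale/=.
by move: (flat _ _) (flat _ _) (flat _ _) (flat _ _) (expR _) => *; ring.
Qed.

Lemma bump_deriv_bound : exists2 B, 0 <= B & forall x, `|bump_deriv x| <= B.
Proof.
have [C C0 hC] := flat_bound (flat_deriv 1).
exists (expR 1 ^+ 2 * (C + C)); first by rewrite mulr_ge0 ?exprn_ge0 ?expR_ge0 ?addr_ge0.
move=> x; rewrite normrM ger0_norm ?exprn_ge0 ?expR_ge0// ler_wpM2l ?exprn_ge0 ?expR_ge0//.
apply: (le_trans (ler_normB _ _)); rewrite !normrM.
have h y : `|flat 1 y| <= 1 by rewrite ger0_norm ?flat1_ge0 ?flat1_le1.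
by apply: lerD; [rewrite -[leRHS]mulr1|rewrite -[leRHS]mul1r]; exact: ler_pM.
Qed.

End smooth1.

Section cyl_smooth.
Context {R : realType} {n : nat}.
Implicit Types f : 'rV[R]_n -> R.

Definition lin_form (l : 'rV[R]_n) (y : 'rV[R]_n) : R := \sum_(j < n) l 0 j * y 0 j.

(** A syntactic class stable under partial derivatives that contains the cutoffs and the field
    components; smoothness of all orders is then an induction on the list of directions. *)
Inductive cyl_smooth : ('rV[R]_n -> R) -> Prop :=
| CylBase u l c : smooth1 u -> cyl_smooth (fun y => u (lin_form l y + c))
| CylCst c : cyl_smooth (fun=> c)
| CylAdd f g : cyl_smooth f -> cyl_smooth g -> cyl_smooth (fun y => f y + g y)
| CylMul f g : cyl_smooth f -> cyl_smooth g -> cyl_smooth (fun y => f y * g y).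

Lemma lin_form_continuous l : continuous (lin_form l).
Proof.
rewrite (_ : lin_form l = \sum_(j < n) (fun y : 'rV[R]_n => l 0 j * y 0 j)); last first.
  by apply/funext => y; rewrite fct_sumE.
elim/big_ind: _ => //.
- exact: (@cst_continuous _ _ (0 : R)).
- by move=> f g cf cg y; exact: (cvgD (cf y) (cg y)).
- move=> j _ y; have cj := @coord_continuous R 1 n 0 j.
  have cc := @cst_continuous 'rV[R]_n R (l 0 j).
  exact: (continuousM (cc y) (cj y)).
Qed.

Lemma lin_form_delta l (j : 'I_n) (h : R) y :
  lin_form l (h *: delta_mx 0 j + y) = h * l 0 j + lin_form l y.
Proof.
rewrite /lin_form (eq_bigr (fun i => h * (l 0 i * (i == j)%:R) + l 0 i * y 0 i)); last first.
  by move=> i _; rewrite !mxE eqxx/=; ring.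
rewrite big_split/= -mulr_sumr (bigD1 j)//= eqxx mulr1 big1 ?addr0// => i /negbTE ->.
by rewrite mulr0.
Qed.

Lemma is_derive_line (f : 'rV[R]_n -> R) (y v : 'rV[R]_n) (d : R) :
  is_derive (0 : R) (1 : R) (fun h => f (h *: v + y)) d -> is_derive y v f d.
Proof.
move=> [h1 h2]; split; first exact/derivable1P.
rewrite -h2 /derive; set g1 := fun h => h^-1 *: _; set g2 := fun h => h^-1 *: _.
suff -> : g1 = g2 by [].
by rewrite funeqE /g1 /g2 => h /=; rewrite addr0 scale0r add0r [_%:A]mulr1.
Qed.

Lemma is_derive_lin_form (u u' : R -> R) l c (j : 'I_n) y :
  (forall x : R, is_derive x (1 : R) u (u' x)) ->
  is_derive y (delta_mx 0 j) (fun y => u (lin_form l y + c)) (l 0 j * u' (lin_form l y + c)).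
Proof.
move=> du; apply: is_derive_line.
under eq_fun do rewrite lin_form_delta.
have := @is_derive1_comp _ u (fun h => h * l 0 j + lin_form l y + c) 0 (u' (lin_form l y + c)) (l 0 j).
rewrite mul0r add0r (mulrC (u' _)); apply => //.
by apply: is_derive_eq; rewrite /GRing.scale/=; ring.
Qed.

Lemma cyl_smooth_partial f (j : 'I_n) : cyl_smooth f ->
  exists2 f', cyl_smooth f' & forall y, is_derive y (delta_mx 0 j) f (f' y).
Proof.
elim=> [u l c /smooth1_derive[u' su' du]|c|{}f g sf [f' sf' df] sg [g' sg' dg]|
        {}f g sf [f' sf' df] sg [g' sg' dg]].
- exists (fun y => l 0 j * u' (lin_form l y + c)) => [|y]; last exact: is_derive_lin_form.
  by apply: CylMul; [exact: CylCst|exact: CylBase].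
- by exists (fun=> 0) => [|y]; [exact: CylCst|exact: is_derive_cst].
- by exists (fun y => f' y + g' y) => [|y]; [exact: CylAdd|exact: is_deriveD].
- exists (fun y => f y * g' y + g y * f' y) => [|y]; last exact: is_deriveM.
  by apply: CylAdd; exact: CylMul.
Qed.

Lemma cyl_smooth_continuous f : cyl_smooth f -> continuous f.
Proof.
elim=> [u l c /smooth1_continuous cu|c|{}f g _ cf _ cg|{}f g _ cf _ cg] y.
- apply: (@continuous_comp _ _ _ (fun y => lin_form l y + c) u); last exact: cu.
  have cl := @lin_form_continuous l; have cc := @cst_continuous 'rV[R]_n R c.
  exact: (continuousD (cl y) (cc y)).
- exact: (@cst_continuous 'rV[R]_n R c).
- exact: (continuousD (cf y) (cg y)).
- exact: (continuousM (cf y) (cg y)).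
Qed.

Lemma cyl_smooth_iter_partial f s : cyl_smooth f -> cyl_smooth (iter_partial s f).
Proof.
move=> sf; elim: s => //= j s /(cyl_smooth_partial j)[g sg dg].
have -> // : partial j (iter_partial s f) = g.
by apply/funext => y; have [_] := dg y.
Qed.

Lemma cyl_smooth_smooth f : cyl_smooth f -> smooth f.
Proof.
move=> sf s; have sfs := cyl_smooth_iter_partial s sf.
split; first exact: cyl_smooth_continuous.
by move=> j y; have [g _ dg] := cyl_smooth_partial j sfs; have [] := dg y.
Qed.

Lemma cyl_smooth_prod m (F : 'I_m -> 'rV[R]_n -> R) : (forall i, cyl_smooth (F i)) ->
  cyl_smooth (fun y => \prod_i F i y).
Proof.
move=> sF; rewrite [X in cyl_smooth X](_ : _ = \prod_i F i); last first.
  by apply/funext => y; rewrite fct_prodE.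
elim/big_ind: _ => //; [exact: CylCst|exact: CylMul].
Qed.

Lemma lin_form_delta_mx a (j : 'I_n) y : lin_form (a *: delta_mx 0 j) y = a * y 0 j.
Proof.
rewrite /lin_form (bigD1 j)//= !mxE !eqxx mulr1 big1 ?addr0// => i /negbTE ij.
by rewrite !mxE ij andbF mulr0 mul0r.
Qed.

Definition cutoff (k : R) (y : 'rV[R]_n) : R := \prod_(j < n) bump (k^-1 * y 0 j).

Lemma cyl_smooth_cutoff k : cyl_smooth (cutoff k).
Proof.
apply: cyl_smooth_prod => j.
have sf (e : R) : cyl_smooth (fun y => flat 1 (1 + e * (k^-1 * y 0 j))).
  have := CylBase ((e * k^-1) *: delta_mx 0 j) 1 (smooth1_flat 1).
  by under eq_fun do rewrite lin_form_delta_mx -mulrA addrC.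
rewrite /bump; apply: CylMul; (apply: CylMul; first exact: CylCst).
  by have := sf 1; under eq_fun do rewrite mul1r.
by have := sf (-1); under eq_fun do rewrite mulN1r.
Qed.

Lemma cutoff_ge0 k y : 0 <= cutoff k y.
Proof. by apply: prodr_ge0 => j _; exact: bump_ge0. Qed.

Lemma cutoff_le1 k y : cutoff k y <= 1.
Proof. by apply: prodr_ile1 => j _; rewrite bump_ge0 bump_le1. Qed.

Lemma cutoff_support k y : 0 < k -> cutoff k y != 0 -> forall j, -k <= y 0 j <= k.
Proof.
move=> k0 /prodf_neq0 h j; have := bump_support (h j isT).
by rewrite ler_pdivlMl// ler_pdivrMl// mulrN1 mulr1.
Qed.

Lemma cutoff_compact_support k f : 0 < k -> cyl_smooth f ->
  smooth_compact_support (fun y => cutoff k y * f y).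
Proof.
move=> k0 sf; split; first by apply: cyl_smooth_smooth; apply: CylMul => //; exact: cyl_smooth_cutoff.
have cK : compact [set v : 'rV[R]_n | forall i, `[- k, k]%classic (v ord0 i)].
  by apply: (@rV_compact R n (fun=> `[- k, k]%classic)) => _; exact: segment_compact.
apply: (subclosed_compact _ cK); first exact: closed_closure.
have /closure_id -> : closed [set v : 'rV[R]_n | forall i, `[- k, k]%classic (v ord0 i)].
  by apply: compact_closed => //; exact: norm_hausdorff.
apply: closureS => y /= h i; rewrite in_itv/=; apply: cutoff_support => //.
by apply: contra_neq h => ->; rewrite mul0r.
Qed.

(** The constant [B] does not depend on [k], and the other factors of the product are at most 1. The
    gain 1 / k is what removes the gradient of the cutoff in the limit. *)
Lemma is_derive_cutoff : exists2 B : R, 0 <= B & forall k, 0 < k -> forall (j : 'I_n) y,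
  exists2 d, is_derive y (delta_mx 0 j) (cutoff k) d & `|d| <= B / k.
Proof.
have [B B0 hB] := @bump_deriv_bound R; exists B => // k k0 j y.
pose P := \prod_(i < n | i != j) bump (k^-1 * y 0 i).
have P01 : `|P| <= 1.
  rewrite ger0_norm; first by apply: prodr_ile1 => i _; rewrite bump_ge0 bump_le1.
  by apply: prodr_ge0 => i _; exact: bump_ge0.
exists (k^-1 * bump_deriv (k^-1 * y 0 j) * P).
  apply: is_derive_line.
  have -> : (fun h : R => cutoff k (h *: delta_mx 0 j + y)) =
      (fun h => bump (k^-1 * (h + y 0 j)) * P).
    apply/funext => h; rewrite /cutoff (bigD1 j)//= !mxE !eqxx mulr1; congr (_ * _).
    by apply: eq_bigr => i /negbTE ij; rewrite !mxE ij andbF mulr0 add0r.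
  have := @is_derive1_comp _ bump (fun h => k^-1 * (h + y 0 j)) 0 _ k^-1 (is_derive_bump _).
  rewrite add0r => h.
  have {}h : is_derive (0 : R) (1 : R) (fun h => bump (k^-1 * (h + y 0 j))) (bump_deriv (k^-1 * y 0 j) * k^-1).
    by apply: h; apply: is_derive_eq; rewrite /GRing.scale/=; ring.
  by apply: is_derive_eq; rewrite /GRing.scale/=; ring.
rewrite normrM -[leRHS]mulr1; apply: ler_pM => //.
by rewrite normrM gtr0_norm ?invr_gt0// mulrC ler_pM2r ?invr_gt0.
Qed.

Lemma cutoff_cvg y : cutoff k.+1%:R y @[k --> \oo] --> (1 : R).
Proof.
have h : forall j, bump (k.+1%:R^-1 * y 0 j) @[k --> \oo] --> (1 : R).
  move=> j; rewrite -[X in _ --> X]bump0.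
  have cb := is_derive_continuous (@is_derive_bump R).
  apply: (@cvg_comp _ _ _ (fun k : nat => k.+1%:R^-1 * y 0 j) bump _ (nbhs (0 : R))); last exact: cb.
  have := cvgM (@cvg_harmonic R) (@cvg_cst _ (y 0 j) _ (\oo : set_system nat) _).
  by rewrite mul0r; apply.
rewrite /cutoff; move: (index_enum _) => r; elim: r => [|j r IH].
  by under eq_fun do rewrite big_nil; exact: cvg_cst.
under eq_fun do rewrite big_cons.
by have := cvgM (h j) IH; rewrite mulr1; exact.
Qed.

End cyl_smooth.

(** * The rotation field *)

Section trig_average.
Context {R : realType}.
Notation mu := (@lebesgue_measure R).
Variable a : R.

(** Profile of the field for a single cosine. In this form a derivative in [r] only multiplies the
    weight by [cos s] and shifts the phase by pi / 2, so the class is stable under derivation. *)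
Definition trig_average (w : R -> R) (c r : R) : R :=
  \int[mu]_(s in `[0, a]) (w s * sin (cos s * r + c)).

Lemma segment_continuous_integrable (f : R -> R) (b : R) : continuous f ->
  mu.-integrable `[0, b] (EFin \o f).
Proof.
move=> cf; apply: continuous_compact_integrable; first exact: segment_compact.
exact: continuous_subspaceT.
Qed.

Lemma trig_average_continuous (w : R -> R) c r : continuous w ->
  continuous (fun s : R => w s * sin (cos s * r + c)).
Proof.
move=> cw s; apply: continuousM; first exact: cw.
apply: continuous_comp; last exact: continuous_sin.
apply: continuousD; last exact: cvg_cst.
by apply: continuousM; [exact: continuous_cos|exact: cvg_cst].
Qed.

Lemma sinDpihalf (x : R) : sin (x + pi / 2) = cos x.
Proof. by rewrite sinD cos_pihalf sin_pihalf mulr0 mulr1 add0r. Qed.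

Lemma is_derive_trig_average (w : R -> R) c (r : R) : continuous w ->
  is_derive r (1 : R) (trig_average w c)
    (trig_average (fun s => w s * cos s) (c + pi / 2) r).
Proof.
move=> cw.
apply: (@is_derive_under_integral _ _ _ mu `[0, a]%classic
  (fun r s => w s * sin (cos s * r + c))
  (fun r s => w s * cos s * sin (cos s * r + (c + pi / 2))) (fun s => `|w s|)) => //.
- by move=> x; apply: segment_continuous_integrable; exact: trig_average_continuous.
- move=> x s _; rewrite addrA sinDpihalf.
  have : is_derive x (1 : R) (fun x => sin (cos s * x + c)) (cos (cos s * x + c) * cos s).
    apply: (@is_derive1_comp _ sin (fun x => cos s * x + c) x).
    by apply: is_derive_eq; rewrite /GRing.scale/=; ring.
  by move=> h; apply: is_derive_eq; rewrite /GRing.scale/=; ring.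
- apply: segment_continuous_integrable => s; apply: continuous_comp; first exact: cw.
  exact: norm_continuous.
- move=> x s _; rewrite -mulrA normrM -[leRHS]mulr1 ler_wpM2l// normrM mulr_ile1//.
    exact: cos_max.
  exact: sin_max.
Qed.

Lemma smooth1_trig_average (w : R -> R) c : continuous w -> smooth1 (trig_average w c).
Proof.
move=> cw; exists [set u | exists w c, continuous w /\ u = trig_average w c].
split; first by exists w, c.
move=> _ [v [d [cv ->]]]; exists (trig_average (fun s => v s * cos s) (d + pi / 2)).
  exists (fun s => v s * cos s), (d + pi / 2); split=> // s.
  by apply: continuousM; [exact: cv|exact: continuous_cos].
by move=> x; exact: is_derive_trig_average.
Qed.

(** If [l] has variance [q], the Gaussian mean over y of cos(sin s l(y) + r) v(y) is
    [rot_weight q s] times sin r times the covariance of [l] and v. *)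
Definition rot_weight (q s : R) : R := - sin s * expR (- (sin s ^+ 2 * q / 2)).

Lemma rot_weight_continuous q : continuous (rot_weight q).
Proof.
have cc d : continuous (fun _ : R => d : R) by move=> x; exact: cvg_cst.
have cs := @continuous_sin R.
have c1 : continuous (fun s : R => - (sin s * sin s * (q / 2))).
  move=> s; exact: (continuousN (continuousM (continuousM (cs s) (cs s)) (cc (q / 2) s))).
have c2 : continuous (fun s : R => expR (- (sin s * sin s * (q / 2)))).
  by move=> s; apply: (continuous_comp (c1 s)); exact: continuous_expR.
have -> : rot_weight q = fun s => - sin s * expR (- (sin s * sin s * (q / 2))).
  by apply/funext => s; rewrite /rot_weight expr2 mulrA.
by move=> s; exact: (continuousM (continuousN (cs s)) (c2 s)).
Qed.

Hypothesis a0 : 0 < a.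

(* The integrand is the derivative of [exp (- sin^2 s q / 2) cos (cos s r + c)]. *)
Lemma trig_average_divergence q c r :
  q * trig_average (fun s => rot_weight q s * cos s) (c + pi / 2) r
    - r * trig_average (rot_weight q) c r =
  expR (- (sin a ^+ 2 * q / 2)) * cos (cos a * r + c) - cos (r + c).
Proof.
have cw := @rot_weight_continuous q.
have cw2 : continuous (fun s => rot_weight q s * cos s).
  by move=> s; apply: continuousM; [exact: cw|exact: continuous_cos].
pose f1 s := rot_weight q s * cos s * sin (cos s * r + (c + pi / 2)).
pose f2 s := rot_weight q s * sin (cos s * r + c).
have cf1 : continuous f1 by exact: trig_average_continuous.
have cf2 : continuous f2 by exact: trig_average_continuous.
have if1 := segment_continuous_integrable a cf1.
have if2 := segment_continuous_integrable a cf2.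
have mI : measurable (`[0, a]%classic : set (measurableTypeR R)) by exact: measurable_itv.
rewrite /trig_average -!RintegralZl// -RintegralB//; try exact: integrable_realZl.
pose F s := expR (- (sin s ^+ 2 * q / 2)) * cos (cos s * r + c).
have dF s : is_derive s (1 : R) F (q * f1 s - r * f2 s).
  have d1 : is_derive s (1 : R) (fun s => expR (- (sin s ^+ 2 * q / 2)))
      (expR (- (sin s ^+ 2 * q / 2)) * - (sin s * cos s * q)).
    apply: (@is_derive1_comp _ expR (fun s => - (sin s ^+ 2 * q / 2)) s).
    by apply: is_derive_eq; rewrite /GRing.scale/=; field.
  have d2 : is_derive s (1 : R) (fun s => cos (cos s * r + c)) (- sin (cos s * r + c) * (- sin s * r)).
    apply: (@is_derive1_comp _ cos (fun s => cos s * r + c) s).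
    by apply: is_derive_eq; rewrite /GRing.scale/=; ring.
  have h := is_deriveM d1 d2; apply: (is_derive_eq h).
  rewrite /f1 /f2 /rot_weight addrA sinDpihalf /GRing.scale/=; ring.
have cf : continuous (fun s => q * f1 s - r * f2 s).
  move=> s; have cc d : continuous (fun _ : R => d : R) by move=> x; exact: cvg_cst.
  exact: (continuousB (continuousM (cc q s) (cf1 s)) (continuousM (cc r s) (cf2 s))).
have := continuous_FTC2_everywhere a0 dF cf; rewrite /Rintegral => ->.
by rewrite /= /F sin0 cos0 expr0n !mul0r oppr0 expR0 !mul1r.
Qed.

End trig_average.

(** * Gram-Schmidt and the reduction to finitely many coordinates *)

Section gram_schmidt.
Context {R : realType} {X : tvsType R} (hX : hausdorff_space X).
Variable gamma : probability (borel X) R.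
Hypothesis gamma_radon : radon gamma.
Hypothesis gamma_gauss : centered_gaussian gamma.
Let covar := (cov gamma).
Let cC (l m : X -> R) : covar l m = covar m l. Proof. exact: covarC. Qed.

Lemma dual_sum n (c : 'I_n -> R) (g : 'I_n -> X -> R) : (forall i, dual (g i)) ->
  dual (fun x => \sum_i c i * g i x).
Proof.
move=> dg; elim: n c g dg => [|n IH] c g dg.
  by under eq_fun do rewrite big_ord0; exact: dual0.
under eq_fun do rewrite big_ord_recl.
by apply: dual_lincomb => //; exact: (IH (fun i => c (lift ord0 i)) (fun i => g (lift ord0 i))).
Qed.

Lemma covar_suml n (c : 'I_n -> R) (g : 'I_n -> X -> R) (k : X -> R) :
  (forall i, dual (g i)) -> dual k ->
  covar (fun x => \sum_i c i * g i x) k = \sum_i c i * covar (g i) k.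
Proof.
move=> + dk; elim: n c g => [|n IH] c g dg.
  by rewrite big_ord0; under [X in covar X _]eq_fun do rewrite big_ord0; exact: covar0l.
rewrite big_ord_recl -IH//; under [X in covar X _]eq_fun do rewrite big_ord_recl.
rewrite /covar covarDl//.
exact: (dual_sum (fun i => c (lift ord0 i)) (fun i => dg (lift ord0 i))).
Qed.

Lemma covarZl (t : R) (r k : X -> R) : dual r -> dual k ->
  covar (fun x => t * r x) k = t * covar r k.
Proof.
move=> dr dk; have := covarDl gamma_gauss t dr (@dual0 R X) dk; rewrite covar0l addr0 => <-.
by congr (cov _ _ _); apply/funext => x; rewrite addr0.
Qed.

Lemma covar_null (r k : X -> R) : dual r -> dual k -> covar r r = 0 -> covar r k = 0.
Proof.
move=> dr dk r0; apply/eqP; apply/negPn/negP => n0.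
(* Every multiple of [r] has variance 0, so Cauchy-Schwarz bounds [t * covar r k] by the same number
   for all t; this t exceeds it by 1. *)
pose t := (Num.sqrt (covar k k) + 1) / covar r k.
have := @covar_cauchy _ _ _ gamma_gauss (fun x => t * r x) k (dualZ t dr) dk.
rewrite (covarZZ gamma_gauss)// -/covar r0 mulr0 ler01 covarZl// => /(_ isT).
by rewrite /t divfK//; lra.
Qed.

Definition orthonormal n (g : 'I_n -> X -> R) :=
  (forall i, dual (g i)) /\ forall i j, covar (g i) (g j) = (i == j)%:R.

Definition residual n (g : 'I_n -> X -> R) (l : X -> R) (x : X) : R :=
  l x - \sum_i covar l (g i) * g i x.

Lemma residualE n (g : 'I_n -> X -> R) l :
  residual g l = fun x => -1 * (\sum_i covar l (g i) * g i x) + l x.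
Proof. by apply/funext => x; rewrite /residual mulN1r addrC. Qed.

Lemma dual_residual n (g : 'I_n -> X -> R) l : orthonormal g -> dual l -> dual (residual g l).
Proof. by move=> [dg _] dl; rewrite residualE; apply: dual_lincomb => //; exact: dual_sum. Qed.

Lemma residual_orthogonal n (g : 'I_n -> X -> R) l i : orthonormal g -> dual l ->
  covar (residual g l) (g i) = 0.
Proof.
move=> [dg og] dl; have ds := dual_sum (fun i => covar l (g i)) dg.
rewrite residualE /covar covarDl// -/covar covar_suml// (bigD1 i)//= og eqxx mulr1 big1 => [|j /negbTE ji].
  by rewrite addr0 mulN1r addNr.
by rewrite og ji mulr0.
Qed.

Lemma residual_covarr n (g : 'I_n -> X -> R) l : orthonormal g -> dual l ->
  covar l (residual g l) = covar (residual g l) (residual g l).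
Proof.
move=> og dl; have dr := dual_residual og dl; have [dg _] := og.
have ds := dual_sum (fun i => covar l (g i)) dg.
rewrite [in LHS]/covar covarC -/covar {3}residualE /covar covarDr// -/covar.
rewrite [X in -1 * X](_ : _ = 0) ?mulr0 ?add0r//.
rewrite /covar covarC -/covar covar_suml// big1// => i _.
by rewrite (cC (g i)) residual_orthogonal// mulr0.
Qed.

Lemma residual_covar n (g : 'I_n -> X -> R) l : orthonormal g -> dual l ->
  covar (residual g l) (residual g l) = covar l l - \sum_i covar l (g i) ^+ 2.
Proof.
move=> og dl; rewrite -residual_covarr//; have [dg _] := og.
have ds := dual_sum (fun i => covar l (g i)) dg.
rewrite residualE /covar covarDr// -/covar mulN1r addrC; congr (_ - _).
by rewrite cC covar_suml//; apply: eq_bigr => i _; rewrite (cC (g i)) expr2.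
Qed.

(** The form is a combination of the [g i] almost everywhere only: a form of variance 0 need not be
    0. This is why phi is cylindrical only up to a null set. *)
Definition null n (g : 'I_n -> X -> R) (l : X -> R) := covar (residual g l) (residual g l) = 0.

(** If the residual of [l] has positive variance, its normalisation is added to the family. By
    Bessel's identity this can only lower the residual variance of other forms, and it cancels that
    of [l]. *)
Lemma orthonormal_null_extend n (g : 'I_n -> X -> R) (l : X -> R) : orthonormal g -> dual l ->
  exists m (g' : 'I_m -> X -> R), [/\ orthonormal g',
    forall k, dual k -> null g k -> null g' k & null g' l].
Proof.
move=> og dl; have [r0|r0] := eqVneq (covar (residual g l) (residual g l)) 0.
  by exists n, g; split.
set r := residual g l in r0.
have dr : dual r by exact: dual_residual.
have rp : 0 < covar r r by rewrite lt_def r0 (covar_ge0 gamma_gauss).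
pose t := (Num.sqrt (covar r r))^-1.
have t2 : t ^+ 2 = (covar r r)^-1 by rewrite /t exprVn sqr_sqrtr ?(ltW rp).
pose g' (i : 'I_n.+1) := if unlift ord0 i is Some j then g j else fun x => t * r x.
have [dg og2] := og.
have dg' i : dual (g' i) by rewrite /g'; case: (unlift ord0 i) => [j|] //; exact: dualZ.
have og' : orthonormal g'.
  split=> // i j; rewrite /g'; case: (unliftP ord0 i) => [i'|] ->; case: (unliftP ord0 j) => [j'|] ->.
  + by rewrite og2 (inj_eq lift_inj).
  + by rewrite /covar covarC -/covar covarZl// residual_orthogonal// mulr0.
  + by rewrite covarZl// residual_orthogonal// mulr0.
  + by rewrite eqxx /covar (covarZZ gamma_gauss)// -/covar t2 mulVf.
have defect k : dual k -> covar (residual g' k) (residual g' k) =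
    covar (residual g k) (residual g k) - t ^+ 2 * covar k r ^+ 2.
  move=> dk; rewrite !residual_covar// big_ord_recl {1}/g' unlift_none.
  rewrite [X in X ^+ 2](_ : _ = t * covar k r); last first.
    by rewrite /covar covarC -/covar covarZl// /covar covarC.
  under [X in _ - (_ + X)]eq_bigr do rewrite /g' liftK.
  by rewrite exprMn; ring.
exists n.+1, g'; split=> // [k dk|].
  rewrite /null => h; apply/eqP; rewrite eq_le; apply/andP; split; last first.
    by apply: (covar_ge0 gamma_gauss); exact: dual_residual.
  by rewrite defect// h sub0r oppr_le0 mulr_ge0 ?sqr_ge0.
by rewrite /null defect// residual_covarr// -/r t2 expr2 mulKf// subrr.
Qed.

(** Indices run over all naturals; past the end stands the zero form, which is continuous and null
    for every family. *)
Lemma gram_schmidt (s : seq (X -> R)) : (forall i, dual (nth (fun=> 0) s i)) ->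
  exists n (g : 'I_n -> X -> R), orthonormal g /\ forall i, null g (nth (fun=> 0) s i).
Proof.
elim: s => [|l s IH] ds.
  exists 0%N, (fun=> fun=> 0); split; first by split=> [[]|[]].
  move=> i; rewrite nth_nil /null residual_covar//; last first.
  - exact: dual0.
  - by split=> [[]|[]].
  by rewrite big_ord0 subr0; exact: covar0l.
have [n [g [og ng]]] := IH (fun i => ds i.+1).
have [m [g' [og' gg' nl]]] := orthonormal_null_extend og (ds 0%N).
exists m, g'; split; first exact: og'.
by case=> [|i]; [exact: nl|exact: (gg' _ (ds i.+1) (ng i))].
Qed.

Lemma trig_poly_finite (u : X -> R) : trig_poly dual u ->
  exists2 s : seq (X -> R), (forall i, dual (nth (fun=> 0) s i)) &
    trig_poly [set l | exists i, l = nth (fun=> 0) s i] u.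
Proof.
have mono (F G : set (X -> R)) v : F `<=` G -> trig_poly F v -> trig_poly G v.
  move=> FG; elim=> [a l th Fl|{}v w _ hv _ hw]; last exact: TrigAdd.
  by apply: TrigCos; exact: FG.
elim=> [a l th dl|{}u v _ [s ds us] _ [r dr vr]].
  exists [:: l]; last by apply: TrigCos; exists 0%N.
  by case=> [|i] //=; rewrite nth_nil; exact: dual0.
exists (s ++ r).
  by move=> i; rewrite nth_cat; case: ifP.
apply: TrigAdd.
  apply: mono us => l [i ->]; have [h|h] := ltnP i (size s).
    by exists i; rewrite nth_cat h.
  rewrite nth_default//; exists (size s + size r)%N.
  by rewrite nth_default// size_cat.
by apply: mono vr => l [i ->]; exists (size s + i)%N; rewrite nth_cat ltnNge leq_addr addKn.
Qed.

Definition coords n (g : 'I_n -> X -> R) (x : X) : 'rV[R]_n := \row_i g i x.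

Definition lin_forms n : set ('rV[R]_n -> R) := [set lin_form l | l in setT].

Lemma lin_form_coords n (g : 'I_n -> X -> R) (c : 'rV[R]_n) x :
  lin_form c (coords g x) = \sum_i c 0 i * g i x.
Proof. by apply: eq_bigr => i _; rewrite mxE. Qed.

Lemma trig_poly_coords n (g : 'I_n -> X -> R) (F : set (X -> R)) (u : X -> R) : trig_poly F u ->
  exists2 P, trig_poly (@lin_forms n) P &
    forall x, (forall l, F l -> residual g l x = 0) -> u x = P (coords g x).
Proof.
elim=> [a l th Fl|{}u v _ [P tP uP] _ [Q tQ vQ]].
  exists (fun y => a * cos (lin_form (\row_i covar l (g i)) y + th)).
    by apply: TrigCos; exists (\row_i covar l (g i)).
  move=> x /(_ l Fl) /eqP; rewrite subr_eq0 => /eqP ->; rewrite lin_form_coords.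
  by congr (_ * cos (_ + _)); apply: eq_bigr => i _; rewrite mxE.
exists (fun y => P y + Q y); first exact: TrigAdd.
by move=> x hx; rewrite uP// vQ.
Qed.

(** Only finitely many forms occur, and almost everywhere their residuals all vanish, so they can be
    replaced by coordinates. The last clause bounds [P] on all of R^n, because every vector is the
    coordinate vector of some point where the residuals vanish. *)
Lemma trig_poly_cylindrical (u : X -> R) : trig_poly dual u ->
  exists n (g : 'I_n -> X -> R) (P : 'rV[R]_n -> R),
  [/\ orthonormal g, trig_poly (@lin_forms n) P,
    {ae gamma, forall x : borel X, u x = P (coords g x)} &
    forall M, (forall x, `|u x| <= M) -> forall y, `|P y| <= M].
Proof.
move=> /trig_poly_finite[s ds us]; have [n [g [og ng]]] := gram_schmidt ds.
have [P tP uP] := trig_poly_coords g us.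
have rd i := dual_residual og (ds i).
have ae0 : {ae gamma, forall x : borel X, forall i, residual g (nth (fun=> 0) s i) x = 0}.
  apply/ae_foralln => i.
  have mr : measurable_fun setT (fun x : borel X => (residual g (nth (fun=> 0) s i) x ^+ 2)%:E).
    by apply/measurable_EFinP; apply: measurable_funX; exact: dual_measurable.
  have := (ae_eq_integral_abs gamma measurableT mr).1.
  have -> : (\int[gamma]_x `|(residual g (nth (fun=> 0%R) s i) x ^+ 2)%:E| = 0)%E.
    under eq_integral do rewrite gee0_abs ?lee_fin ?sqr_ge0//.
    by rewrite (dual_sq_integral gamma_gauss (rd i)); exact: (congr1 EFin (ng i)).
  move=> /(_ erefl); apply: filterS => x /= /(_ I) [] /eqP.
  by rewrite sqrf_eq0 => /eqP.
exists n, g, P; split=> //.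
  by move: ae0; apply: filterS => x h; apply: uP => l [i ->].
move=> M uM y; have [dg og2] := og.
have [x0 x00] : exists x0 : borel X, forall i, residual g (nth (fun=> 0) s i) x0 = 0.
  apply/not_existsP => h; have [N [mN N0 hN]] := ae0.
  have NT : N = setT by rewrite -subTset => x _; exact: (hN x (h x)).
  have /eqP := @probability_setT _ _ _ gamma.
  by rewrite -[X in gamma X]NT N0 eq_sym onee_eq0.
have gcov i : covar (g i) (g i) = 1 by rewrite og2 eqxx.
have [h hh] := choice (fun i => cm_vector hX gamma_radon gamma_gauss (dg i) (gcov i)).
pose c i := y 0 i - g i x0.
(* Moving along the [h i] adjusts the coordinates to [y] one by one and keeps the residuals at 0,
   since a null residual has covariance 0 with each [g i]. *)
pose x := x0 + \sum_i c i *: h i.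
have lx l : dual l -> l x = l x0 + \sum_i c i * l (h i).
  move=> dl; rewrite /x dual_add//; congr (_ + _).
  elim/big_rec2: _ => [|i a b _ IH]; first exact: dual_zero.
  by rewrite dual_add// dual_scale// IH.
have -> : y = coords g x.
  apply/rowP => i; rewrite mxE lx// (bigD1 i)//= hh// -/covar gcov mulr1 big1 ?addr0.
    by rewrite /c addrC subrK.
  by move=> j /negbTE ji; rewrite hh// -/covar og2 eq_sym ji mulr0.
rewrite -uP// => l [i ->]; rewrite lx// x00 add0r big1// => j _.
by rewrite hh// -/covar covar_null ?mulr0//; exact: ng.
Qed.

End gram_schmidt.

(** * Means along rotations and their field *)

Section rotation_field.
Context {R : realType} {X : tvsType R} (hX : hausdorff_space X).
Notation mu := (@lebesgue_measure R).
Variable gamma : probability (borel X) R.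
Hypothesis gamma_gauss : centered_gaussian gamma.
Local Notation covar := (cov gamma).
Variables (n : nat) (g : 'I_n -> X -> R).
Hypothesis og : orthonormal gamma g.
Let dg := og.1.

Definition rot (s : R) (x y : X) : X := cos s *: x + sin s *: y.

Definition rot_mean (P : 'rV[R]_n -> R) (s : R) (x : X) : R :=
  \int[gamma]_y P (coords g (rot s x y)).

(** Component along [v] of the integrand of the field at the angle [s]; unit vectors [v] reduce the
    norm of the field to scalar estimates. *)
Definition rot_mean_dir (P : 'rV[R]_n -> R) (v : 'I_n -> R) (s : R) (x : X) : R :=
  \int[gamma]_y (P (coords g (rot s x y)) * \sum_i v i * g i y).

Lemma lin_form_rot c s x y : lin_form c (coords g (rot s x y)) =
  sin s * lin_form c (coords g y) + cos s * lin_form c (coords g x).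
Proof.
rewrite !lin_form_coords !mulr_sumr -big_split/=; apply: eq_bigr => i _.
by rewrite (dual_add _ _ (dg i)) !(dual_scale _ _ (dg i)); ring.
Qed.

Lemma dual_lin_form c : dual (fun x => lin_form c (coords g x)).
Proof. by under eq_fun do rewrite lin_form_coords; exact: dual_sum. Qed.

Definition sqn (c : 'rV[R]_n) := \sum_i c 0 i ^+ 2.

Lemma covar_lin_form c (v : 'I_n -> R) :
  covar (fun x => lin_form c (coords g x)) (fun x => \sum_i v i * g i x) = \sum_i c 0 i * v i.
Proof.
under [X in covar X _]eq_fun do rewrite lin_form_coords.
rewrite (covar_suml gamma_gauss)//; last exact: dual_sum.
apply: eq_bigr => i _; congr (_ * _).
rewrite covarC (covar_suml gamma_gauss)// (bigD1 i)//= og.2 eqxx mulr1 big1 ?addr0//.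
by move=> j /negbTE ji; rewrite og.2 ji mulr0.
Qed.

Lemma covar_lin_form_self c :
  covar (fun x => lin_form c (coords g x)) (fun x => lin_form c (coords g x)) = sqn c.
Proof.
under [X in covar _ X]eq_fun do rewrite lin_form_coords.
by rewrite covar_lin_form; apply: eq_bigr => i _; rewrite expr2.
Qed.

Lemma rot_mean_cos a c th s x :
  rot_mean (fun y => a * cos (lin_form c y + th)) s x =
  a * (expR (- (sin s ^+ 2 * sqn c / 2)) * cos (cos s * lin_form c (coords g x) + th)).
Proof.
have dl := dual_lin_form c; rewrite /rot_mean.
under eq_Rintegral do rewrite lin_form_rot -addrA.
rewrite bRintegralZ; last exact: (cos_dual_bounded _ (dualZ (sin s) dl)).
rewrite (dual_char gamma_gauss); last exact: dualZ.
by rewrite (covarZZ gamma_gauss (sin s) dl) covar_lin_form_self [X in a * X]mulrC.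
Qed.

Lemma rot_mean_dir_cos a c th v s x :
  rot_mean_dir (fun y => a * cos (lin_form c y + th)) v s x =
  a * (\sum_i c 0 i * v i) * (rot_weight (sqn c) s * sin (cos s * lin_form c (coords g x) + th)).
Proof.
have dl := dual_lin_form c; have dv := dual_sum v dg; rewrite /rot_mean_dir.
have dsl := dualZ (sin s) dl.
transitivity (\int[gamma]_y (a * (sin (sin s * lin_form c (coords g y) +
    (cos s * lin_form c (coords g x) + th + pi / 2)) * \sum_i v i * g i y))).
  by apply: eq_Rintegral => y _; rewrite lin_form_rot addrA sinDpihalf addrA mulrA.
rewrite RintegralZl//; last first.
  apply: (@le_integrable _ _ _ gamma _ measurableT _ (EFin \o (fun y : borel X => \sum_i v i * g i y))).
  - apply/measurable_EFinP; apply: measurable_funM; last exact: (dual_measurable dv).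
    apply: measurableT_comp; first by apply: continuous_measurable_fun; exact: continuous_sin.
    by apply: measurable_funD => //; exact: (dual_measurable dsl).
  - by move=> y _; rewrite !abse_EFin lee_fin normrM -[leRHS]mul1r ler_wpM2r// sin_max.
  - exact: (dual_integrable gamma_gauss dv).
rewrite (dual_sin_mul_integral gamma_gauss)//.
rewrite (covarZl gamma_gauss (sin s) dl dv) covar_lin_form (covarZZ gamma_gauss (sin s) dl).
rewrite covar_lin_form_self.
rewrite cosDpihalf /rot_weight; move: (sin (_ + _)) (expR _) (\sum_i _) => *; ring.
Qed.

Lemma trig_rot_bounded P s x : trig_poly (@lin_forms R n) P ->
  bounded_measurable (fun y : borel X => P (coords g (rot s x y))).
Proof.
elim=> [a _ th [c _ <-]|{}P Q _ bP _ bQ]; last exact: bounded_measurableD.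
under eq_fun do rewrite lin_form_rot -addrA.
by apply: bounded_measurableZ; exact: (cos_dual_bounded _ (dualZ (sin s) (dual_lin_form c))).
Qed.

Lemma trig_rot_dir_integrable P v s x : trig_poly (@lin_forms R n) P ->
  gamma.-integrable setT (EFin \o (fun y : borel X => P (coords g (rot s x y)) * \sum_i v i * g i y)).
Proof.
move=> tP; have [mP [M PM]] := trig_rot_bounded s x tP; have dv := dual_sum v dg.
apply: (@le_integrable _ _ _ gamma _ measurableT _ (EFin \o (fun y : borel X => M * \sum_i v i * g i y))).
- apply/measurable_EFinP; apply: measurable_funM => //; exact: (dual_measurable dv).
- move=> y _; rewrite !abse_EFin lee_fin !normrM ler_wpM2r//.
  exact: le_trans (PM y) (ler_norm _).
- by apply: integrable_realZl => //; exact: (dual_integrable gamma_gauss dv).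
Qed.

(* With [M_s P] for [rot_mean P s], the field is the integral of
   [sin s *: M_s (grad P) = tan s *: grad (M_s P)] over [0 < s < a]; its
   divergence telescopes because [d/ds M_s P] is [tan s] times the
   Ornstein-Uhlenbeck operator applied to [M_s P]. *)
Lemma rotation_field a (P : 'rV[R]_n -> R) : 0 < a -> trig_poly (@lin_forms R n) P ->
  exists S : 'I_n -> 'rV[R]_n -> R,
  [/\ forall j, cyl_smooth (S j),
      exists M, forall j y, `|S j y| <= M,
      forall x, \sum_j (partial j (S j) (coords g x) - g j x * S j (coords g x)) =
        rot_mean P a x - P (coords g x) &
      forall v x, (continuous (fun s => rot_mean_dir P v s x) /\
        \sum_j v j * S j (coords g x) = \int[mu]_(s in `[0, a]) rot_mean_dir P v s x)].
Proof.
move=> a0; elim=> [b _ th [c _ <-]|{}P Q tP [S [S1 [M SM] S3 S4]] tQ [T [T1 [N TN] T3 T4]]]; last first.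
  exists (fun j y => S j y + T j y); split.
  - by move=> j; exact: CylAdd.
  - by exists (M + N) => j y; apply: (le_trans (ler_normD _ _)); exact: lerD.
  - move=> x; have -> : rot_mean (fun y => P y + Q y) a x = rot_mean P a x + rot_mean Q a x.
      by apply: bRintegralD; exact: trig_rot_bounded.
    rewrite opprD addrACA -S3 -T3 -big_split/=; apply: eq_bigr => j _.
    have [S' _ dS] := cyl_smooth_partial j (S1 j).
    have [T' _ dT] := cyl_smooth_partial j (T1 j).
    have -> : partial j (fun y => S j y + T j y) (coords g x) =
        partial j (S j) (coords g x) + partial j (T j) (coords g x).
      have [e1 e2] := dS (coords g x); have [e3 e4] := dT (coords g x).
      by rewrite /partial; apply: deriveD.
    by rewrite mulrDr; ring.
  move=> v x; have [c1 e1] := S4 v x; have [c2 e2] := T4 v x.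
  have e s : rot_mean_dir (fun y => P y + Q y) v s x = rot_mean_dir P v s x + rot_mean_dir Q v s x.
    rewrite /rot_mean_dir -RintegralD//; try exact: trig_rot_dir_integrable.
    by apply: eq_Rintegral => y _; rewrite mulrDl.
  rewrite (_ : (fun s => rot_mean_dir (fun y => P y + Q y) v s x) =
    fun s => rot_mean_dir P v s x + rot_mean_dir Q v s x); last exact/funext.
  split; first by move=> s; exact: (continuousD (c1 s) (c2 s)).
  rewrite RintegralD//; try exact: segment_continuous_integrable.
  by rewrite -e1 -e2 -big_split/=; apply: eq_bigr => j _; rewrite mulrDr.
have cw := @rot_weight_continuous R (sqn c).
pose S := trig_average a (rot_weight (sqn c)) th.
have sS : smooth1 S by exact: smooth1_trig_average.
pose S' := trig_average a (fun s => rot_weight (sqn c) s * cos s) (th + pi / 2).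
have dS r : is_derive r (1 : R) S (S' r) by exact: is_derive_trig_average.
have [B SB] : exists B, forall r, `|S r| <= B.
  exists (\int[mu]_(s in `[0, a]) `|rot_weight (sqn c) s|) => r.
  have ci : mu.-integrable `[0, a]
      (EFin \o (fun s => rot_weight (sqn c) s * sin (cos s * r + th))).
    by apply: segment_continuous_integrable; exact: trig_average_continuous.
  apply: (le_trans (le_normr_Rintegral _ ci)) => //.
  apply: le_Rintegral => //.
  - by apply/integrable_norm.
  - by apply: (integrable_norm (segment_continuous_integrable a cw)).
  - by move=> s _; rewrite normrM -[leRHS]mulr1 ler_wpM2l// sin_max.
exists (fun j y => b * c 0 j * S (lin_form c y)); split.
- move=> j; apply: CylMul; first exact: CylCst.
  by have := CylBase c 0 sS; under eq_fun do rewrite addr0.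
- exists (\sum_j `|b * c 0 j| * `|B|) => j y.
  rewrite normrM (bigD1 j)//= -[leLHS]addr0; apply: lerD; last first.
    by apply: sumr_ge0 => i _; exact: mulr_ge0.
  by rewrite ler_wpM2l//; exact: le_trans (SB _) (ler_norm _).
- move=> x; set r := lin_form c (coords g x).
  rewrite rot_mean_cos -mulrBr -/r -(trig_average_divergence a0 (sqn c) th r) -/S -/S'.
  (* The sum over j turns the squares of the coefficients into [sqn c], the variance of the form,
     which is the [q] of [trig_average_divergence]. *)
  rewrite (eq_bigr (fun j => b * S' r * (c 0 j ^+ 2) - b * S r * (c 0 j * g j x))); last first.
    move=> j _; rewrite -/r.
    have h : is_derive (coords g x) (delta_mx 0 j) (fun y => b * c 0 j * S (lin_form c y))
        (b * c 0 j * (c 0 j * S' r)).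
      have := is_derive_lin_form c 0 j (coords g x) dS; rewrite addr0 -/r.
      under eq_fun do rewrite addr0.
      by move=> h; have := is_deriveZ (b * c 0 j) h.
    have [_] := h; rewrite /partial => ->; ring.
  rewrite sumrB -!mulr_sumr -/(sqn c) -lin_form_coords -/r; ring.
move=> v x; under eq_fun do rewrite rot_mean_dir_cos.
have ct := @trig_average_continuous R _ th (lin_form c (coords g x)) cw.
split; first by move=> s; have cc d : continuous (fun _ : R => d : R); 
  [by move=> ?; exact: cvg_cst|exact: (continuousM (cc _ s) (ct s))].
rewrite RintegralZl//; last exact: segment_continuous_integrable.
rewrite -/(trig_average _ _ _ _) -/S mulr_sumr mulr_suml; apply: eq_bigr => j _; ring.
Qed.

End rotation_field.

(** * Norm bounds for the rotation field *)

Section hoelder_real.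
Context d {T : measurableType d} {R : realType}.
Variables (nu : {measure set T -> \bar R}) (D : set T).
Hypothesis mD : measurable D.

Lemma hoelder_ge0 (f g : T -> R) (p q : R) : measurable_fun setT f -> measurable_fun setT g ->
  (forall x, 0 <= f x) -> (forall x, 0 <= g x) -> 0 < p -> 0 < q -> p^-1 + q^-1 = 1 ->
  (\int[nu]_(x in D) (f x * g x)%:E <=
   (\int[nu]_(x in D) (f x `^ p)%:E) `^ p^-1 * (\int[nu]_(x in D) (g x `^ q)%:E) `^ q^-1)%E.
Proof.
move=> mf mg f0 g0 p0 q0 pq.
have mfD : measurable_fun setT (fun x => f x * \1_D x) by apply: measurable_funM.
have mgD : measurable_fun setT (fun x => g x * \1_D x) by apply: measurable_funM.
have := hoelder nu mfD mgD p0 q0 pq; rewrite Lnorm1 unlock.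
have e (u : T -> R) (r : R) : (forall x, 0 <= u x) -> 0 < r ->
    (\int[nu]_x `|(EFin \o (fun x => u x * \1_D x)%R) x| `^ r = \int[nu]_(x in D) (u x `^ r)%:E)%E.
  move=> u0 r0; rewrite [RHS]integral_mkcond; apply: eq_integral => x _.
  rewrite /= patchE indicE; case: (x \in D); first by rewrite mulr1 ger0_norm.
  by rewrite mulr0 normr0 powR0// gt_eqF.
rewrite !e//; congr (_ <= _)%E; rewrite [RHS]integral_mkcond; apply: eq_integral => x _.
rewrite /= patchE indicE; case: (x \in D); first by rewrite !mulr1 ger0_norm// mulr_ge0.
by rewrite !mulr0 normr0.
Qed.

Lemma hoelder_le (f g : T -> R) (p q a b : R) : measurable_fun setT f -> measurable_fun setT g ->
  (forall x, 0 <= f x) -> (forall x, 0 <= g x) -> 0 < p -> 0 < q -> p^-1 + q^-1 = 1 ->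
  0 <= a -> 0 <= b ->
  (\int[nu]_(x in D) (f x `^ p)%:E <= (a `^ p)%:E)%E ->
  (\int[nu]_(x in D) (g x `^ q)%:E <= (b `^ q)%:E)%E ->
  (\int[nu]_(x in D) (f x * g x)%:E <= (a * b)%:E)%E.
Proof.
move=> mf mg f0 g0 p0 q0 pq a0 b0 fa gb; apply: (le_trans (hoelder_ge0 mf mg f0 g0 p0 q0 pq)).
rewrite EFinM; apply: lee_pmul; try exact: poweR_ge0.
  have -> : a%:E = ((a `^ p)%:E `^ p^-1)%E by rewrite poweR_EFin -powRrM divff ?powRr1// gt_eqF.
  apply: gt0_ler_poweR => //; rewrite ?in_itv/= ?leey ?andbT ?invr_ge0 ?(ltW p0)//.
    by apply: integral_ge0 => x _; rewrite lee_fin powR_ge0.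
  by rewrite lee_fin powR_ge0.
have -> : b%:E = ((b `^ q)%:E `^ q^-1)%E by rewrite poweR_EFin -powRrM divff ?powRr1// gt_eqF.
apply: gt0_ler_poweR => //; rewrite ?in_itv/= ?leey ?andbT ?invr_ge0 ?(ltW q0)//.
  by apply: integral_ge0 => x _; rewrite lee_fin powR_ge0.
by rewrite lee_fin powR_ge0.
Qed.

End hoelder_real.

Section rotation.
Context {R : realType} {X : tvsType R} (hX : hausdorff_space X).
Notation mu := (@lebesgue_measure R).
Variable gamma : probability (borel X) R.
Hypothesis gamma_radon : radon gamma.
Hypothesis gamma_gauss : centered_gaussian gamma.
Local Notation covar := (cov gamma).

Lemma rot_continuous s : continuous (fun z : X * X => rot s z.1 z.2).
Proof.
apply: continuous_tvsD; apply: continuous_tvsZ => z; try exact: cvg_cst.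
  exact: cvg_fst.
exact: cvg_snd.
Qed.

Lemma rot_cos s (l : X -> R) th x : dual l ->
  \int[gamma]_y cos (l (rot s x y) + th) =
  expR (- (sin s ^+ 2 * covar l l / 2)) * cos (cos s * l x + th).
Proof.
move=> dl; transitivity (\int[gamma]_y cos (sin s * l y + (cos s * l x + th))).
  apply: eq_Rintegral => y _; rewrite (dual_add _ _ dl) !(dual_scale _ _ dl).
  by congr cos; ring.
by rewrite (dual_char gamma_gauss _ (dualZ (sin s) dl)) (covarZZ gamma_gauss _ dl) mulrC.
Qed.

(** The exponents combine by cos^2 + sin^2 = 1. This is the test on cosines from which invariance
    for all Borel functions follows. *)
Lemma rot_trig s (l : X -> R) th : dual l ->
  \int[gamma]_x (\int[gamma]_y cos (l (rot s x y) + th)) = \int[gamma]_x cos (l x + th).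
Proof.
move=> dl; under eq_Rintegral do rewrite rot_cos//.
rewrite bRintegralZ; last exact: (cos_dual_bounded _ (dualZ (cos s) dl)).
rewrite !(dual_char gamma_gauss)//; last exact: dualZ.
rewrite (covarZZ gamma_gauss _ dl) mulrCA -expRD; congr (_ * expR _).
by rewrite -opprD -mulrDl -mulrDl addrC cos2Dsin2 mul1r.
Qed.

Lemma ge0_integral_rot s (f : borel X -> \bar R) : (forall z, 0 <= f z)%E ->
  measurable_fun setT f ->
  (\int[gamma]_x \int[gamma]_y f (rot s x y) = \int[gamma]_x f x)%E.
Proof. exact: (ge0_integral_slice hX gamma_radon (@rot_continuous s) (@rot_trig s)). Qed.

Section trig.
Variables (n : nat) (g : 'I_n -> X -> R).
Hypothesis og : orthonormal gamma g.
Variable P : 'rV[R]_n -> R.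
Hypothesis tP : trig_poly (@lin_forms R n) P.


(** Linearity splits the form into sin s l(y) + cos s l(x), which is measurable for the product
    sigma-algebra even if the rotation itself is not. Tonelli in (s, x) rests on this. *)
Lemma lin_form_rot_measurable (c : 'rV[R]_n) : measurable_fun setT
  (fun z : (measurableTypeR R * borel X) * borel X => lin_form c (coords g (rot z.1.1 z.1.2 z.2))).
Proof.
have ml := dual_measurable (dual_lin_form og c).
under eq_fun do rewrite (lin_form_rot og).
apply: measurable_funD; apply: measurable_funM.
- apply: (measurableT_comp (f := @sin R)).
    by apply: continuous_measurable_fun; exact: continuous_sin.
  by apply: (measurableT_comp measurable_fst); exact: measurable_fst.
- by apply: (measurableT_comp ml); exact: measurable_snd.
- apply: (measurableT_comp (f := @cos R)).
    by apply: continuous_measurable_fun; exact: continuous_cos.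
  by apply: (measurableT_comp measurable_fst); exact: measurable_fst.
- apply: (measurableT_comp ml).
  by apply: (measurableT_comp measurable_snd); exact: measurable_fst.
Qed.

Lemma trig_rot_measurable : measurable_fun setT
  (fun z : (measurableTypeR R * borel X) * borel X => P (coords g (rot z.1.1 z.1.2 z.2))).
Proof.
elim: tP => [a _ th [c _ <-]|u v _ mu_ _ mv]; last exact: measurable_funD.
apply: measurable_funM => //; apply: (measurableT_comp (f := @cos R)).
  by apply: continuous_measurable_fun; exact: continuous_cos.
by apply: measurable_funD => //; exact: lin_form_rot_measurable.
Qed.

Lemma trig_lin_bounded : exists2 M, 0 < M & forall y, `|P y| <= M.
Proof. exact: trig_poly_bounded tP. Qed.

Lemma trig_coords : trig_poly dual (fun x => P (coords g x)).
Proof.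
elim: tP => [a _ th [c _ <-]|u v _ hu _ hv]; last exact: TrigAdd.
exact: (TrigCos a th (dual_lin_form og c)).
Qed.

Variable q : R.
Hypothesis q0 : 0 < q.

Definition rot_power (s : R) (x : X) : R := \int[gamma]_y (`|P (coords g (rot s x y))| `^ q).

Lemma rot_power_bounded s x :
  bounded_measurable (fun y : borel X => `|P (coords g (rot s x y))| `^ q).
Proof.
have [mP _] := trig_rot_bounded og s x tP; split.
  by apply: (measurableT_comp (measurable_powR q)); exact: measurableT_comp.
have [M M0 PM] := trig_lin_bounded; exists (M `^ q) => y.
rewrite ger0_norm ?powR_ge0// ge0_ler_powR// ?nnegrE ?(ltW q0)//.
exact: ltW.
Qed.

Lemma rot_power_EFin s x :
  (rot_power s x)%:E = (\int[gamma]_y (`|P (coords g (rot s x y))| `^ q)%:E)%E.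
Proof. by apply: EFin_bRintegral; exact: rot_power_bounded. Qed.

Lemma rot_power_ge0 s x : 0 <= rot_power s x.
Proof. by apply: Rintegral_ge0 => y _; exact: powR_ge0. Qed.

Lemma rot_power_measurable : measurable_fun setT
  (fun z : measurableTypeR R * borel X => rot_power z.1 z.2).
Proof.
apply: (@measurableT_comp _ _ _ _ _ _ (@fine R)) => //.
apply: (@measurable_fun_fubini_tonelli_F _ _ _ _ _ gamma
  (fun z : (measurableTypeR R * borel X) * borel X => (`|P (coords g (rot z.1.1 z.1.2 z.2))| `^ q)%:E)).
  apply/measurable_EFinP; apply: (measurableT_comp (measurable_powR q)).
  by apply: measurableT_comp => //; exact: trig_rot_measurable.
by move=> z; rewrite lee_fin powR_ge0.
Qed.

Lemma rot_power_measurable1 x : measurable_fun setT (fun s : measurableTypeR R => rot_power s x).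
Proof.
have h := @measurable_fun_pair1 _ _ _ (measurableTypeR R) (borel X) _ _ x rot_power_measurable.
exact: h.
Qed.

Lemma rot_power_measurable2 s : measurable_fun setT (fun x : borel X => rot_power s x).
Proof.
exact: (measurable_fun_pair2 s rot_power_measurable).
Qed.

Lemma rot_power_integral s : (\int[gamma]_x (rot_power s x)%:E =
  \int[gamma]_x (`|P (coords g x)| `^ q)%:E)%E.
Proof.
under eq_integral do rewrite rot_power_EFin.
apply: (@ge0_integral_rot s (fun x => (`|P (coords g x)| `^ q)%:E)).
  by move=> z; rewrite lee_fin powR_ge0.
apply/measurable_EFinP; apply: (measurableT_comp (measurable_powR q)).
apply: measurableT_comp => //.
by have [] := trig_bounded_measurable trig_coords.
Qed.

Variables (p a : R).
Hypotheses (p0 : 0 < p) (pq : p^-1 + q^-1 = 1) (a0 : 0 < a).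

(** Jensen's inequality, obtained as Hoelder's inequality against the constant 1 on a probability
    space. *)
Lemma rot_mean_power s x : `|rot_mean gamma g P s x| `^ q <= rot_power s x.
Proof.
have hP := trig_rot_bounded og s x tP; have [mP _] := hP.
have h : `|rot_mean gamma g P s x| <= rot_power s x `^ q^-1.
  apply: le_norm_Rintegral_norm => //; first exact: powR_ge0.
  under eq_integral do rewrite -[X in X%:E]mulr1.
  rewrite -[X in (_ <= X%:E)%E]mulr1.
  apply: (@hoelder_le _ _ _ gamma setT measurableT _ _ q p) => //.
  - exact: measurableT_comp.
  - by rewrite addrC.
  - exact: powR_ge0.
  - by rewrite -powRrM mulVf ?gt_eqF// powRr1 ?rot_power_ge0// rot_power_EFin.
  - under eq_integral do rewrite powR1.
    by rewrite integral_cst// [X in (_ * X)%E](@probability_setT _ _ _ gamma) mule1 powR1.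
apply: (@le_trans _ _ ((rot_power s x `^ q^-1) `^ q)).
  by apply: ge0_ler_powR => //; rewrite ?nnegrE ?(ltW q0) ?powR_ge0.
by rewrite -powRrM mulVf ?gt_eqF// powRr1// rot_power_ge0.
Qed.

Lemma rot_mean_measurable s : measurable_fun setT (rot_mean gamma g P s : borel X -> R).
Proof.
have [] := bounded_measurable_slice_integral hX gamma_radon (@rot_continuous s)
  (trig_bounded_measurable trig_coords).
by [].
Qed.

Lemma rot_mean_norm s : (\int[gamma]_x (`|rot_mean gamma g P s x| `^ q)%:E <=
  \int[gamma]_x (`|P (coords g x)| `^ q)%:E)%E.
Proof.
rewrite -(rot_power_integral s); apply: ge0_le_integral => //.
- apply/measurable_EFinP; apply: (measurableT_comp (measurable_powR q)).
  by apply: measurableT_comp => //; exact: rot_mean_measurable.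
- by apply/measurable_EFinP; exact: rot_power_measurable2.
- by move=> x _; rewrite lee_fin rot_mean_power.
Qed.

Definition rot_total (x : X) : R := \int[mu]_(s in `[0, a]) rot_power s x.

Let mI : measurable (`[0, a]%classic : set (measurableTypeR R)). Proof. exact: measurable_itv. Qed.

Lemma lebesgue_segment : mu `[0, a]%classic = a%:E.
Proof. by rewrite lebesgue_measure_itv/= lte_fin a0 oppr0 adde0. Qed.

Lemma rot_power_integrable x : mu.-integrable `[0, a] (EFin \o (fun s => rot_power s x)).
Proof.
have [M M0 PM] := trig_lin_bounded.
apply: measurable_bounded_integrable => //.
- by rewrite [X in (X < _)%E]lebesgue_segment ltry.
- by apply: measurable_funTS; exact: rot_power_measurable1.
exists (M `^ q); split; first exact: num_real.
move=> K hK s _; apply: (le_trans _ (ltW hK)).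
rewrite /= ger0_norm ?rot_power_ge0// -[leRHS](Rintegral_prob_cst gamma).
apply: le_bRintegral; [exact: rot_power_bounded|exact: bounded_measurable_cst|move=> y].
by rewrite ge0_ler_powR// ?nnegrE ?(ltW q0)// ltW.
Qed.

Lemma rot_total_EFin x : (rot_total x)%:E = (\int[mu]_(s in `[0%R, a]) (rot_power s x)%:E)%E.
Proof.
rewrite fineK//; apply: integrable_fin_num => //; exact: rot_power_integrable.
Qed.

Lemma rot_total_ge0 x : 0 <= rot_total x.
Proof. by apply: Rintegral_ge0 => s _; exact: rot_power_ge0. Qed.

Let F (z : measurableTypeR R * borel X) : \bar R := (rot_power z.1 z.2 * \1_(`[0, a]%classic) z.1)%:E.

Let mF : measurable_fun setT F.
Proof.
apply/measurable_EFinP; apply: measurable_funM; first exact: rot_power_measurable.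
by apply: measurableT_comp => //; exact: measurable_fst.
Qed.

Let F0 z : (0 <= F z)%E.
Proof. by rewrite lee_fin mulr_ge0// rot_power_ge0. Qed.

Let FE x : (rot_total x)%:E = (\int[mu]_s F (s, x))%E.
Proof.
rewrite rot_total_EFin integral_mkcond; apply: eq_integral => s _.
by rewrite patchE /F /= indicE; case: (s \in _); rewrite ?mulr1 ?mulr0.
Qed.

Lemma rot_total_measurable : measurable_fun setT (rot_total : borel X -> R).
Proof.
apply/measurable_EFinP; rewrite (_ : EFin \o _ = fubini_G mu F); last exact/funext.
exact: measurable_fun_fubini_tonelli_G.
Qed.

(** Tonelli in (s, x); by rotation invariance the inner integral does not depend on s, and the
    length [a] factors out. *)
Lemma rot_total_integral : (\int[gamma]_x (rot_total x)%:E =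
  a%:E * \int[gamma]_x (`|P (coords g x)| `^ q)%:E)%E.
Proof.
under eq_integral do rewrite FE.
rewrite -[LHS](@fubini_tonelli _ _ _ _ _ mu gamma F)//.
transitivity (\int[mu]_s ((\1_(`[0%R, a]%classic) s)%:E * \int[gamma]_x (`|P (coords g x)| `^ q)%:E))%E.
  apply: eq_integral => s _; rewrite -(rot_power_integral s).
  rewrite -ge0_integralZl//.
  - by apply: eq_integral => x _; rewrite /F/= mulrC EFinM.
  - by apply/measurable_EFinP; exact: rot_power_measurable2.
  - by move=> x _; rewrite lee_fin rot_power_ge0.
rewrite ge0_integralZr//.
- by rewrite integral_indic// setIT [X in (X * _)%E]lebesgue_segment.
- by apply/measurable_EFinP.
- by apply: integral_ge0 => x _; rewrite lee_fin powR_ge0.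
Qed.

End trig.
End rotation.

Section gaussian_moment.
Context {R : realType}.
Notation mu := (@lebesgue_measure R).

Lemma gaussian_moment_ge0 (p : R) : 0 <= gaussian_moment p :> R.
Proof. exact: powR_ge0. Qed.

Lemma gaussian_momentE (p : R) : 0 < p ->
  gaussian_moment p `^ p = \int[mu]_x (`|x| `^ p * normal_pdf 0 1 x).
Proof.
move=> p0; have pk0 : 0 < normal_peak 1 :> R by rewrite normal_peak_gt0// oner_neq0.
have e x : `|x| `^ p * expR (- (x ^+ 2 / 2)) = (normal_peak 1)^-1 * (`|x| `^ p * normal_pdf 0 1 x).
  rewrite normal_pdfE ?oner_neq0// /normal_fun subr0 expr1n.
  rewrite [RHS]mulrCA; congr (_ * _); rewrite mulrA mulVf ?gt_eqF// mul1r.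
  by rewrite mulNr.
rewrite /gaussian_moment -powRrM mulVf ?gt_eqF// powRr1; last first.
  rewrite mulr_ge0 ?powR_ge0//; apply: Rintegral_ge0 => x _.
  by rewrite mulr_ge0 ?powR_ge0// expR_ge0.
under eq_Rintegral do rewrite e.
rewrite RintegralZl//; last exact: (normal_moment_integrable ltr01 (ltW p0)).
rewrite mulrA [X in X * _](_ : _ = 1) ?mul1r//.
have h2 : (2 * pi) `^ (- 2^-1) = normal_peak 1 :> R.
  by rewrite powRN powR12_sqrt ?mulr_ge0 ?pi_ge0// /normal_peak expr1n mul1r mulr_natl.
by rewrite h2 divff// gt_eqF.
Qed.

End gaussian_moment.

Section field_bound.
Context {R : realType} {X : tvsType R} (hX : hausdorff_space X).
Notation mu := (@lebesgue_measure R).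
Variable gamma : probability (borel X) R.
Hypothesis gamma_radon : radon gamma.
Hypothesis gamma_gauss : centered_gaussian gamma.
Local Notation covar := (cov gamma).
Variables (n : nat) (g : 'I_n -> X -> R).
Hypothesis og : orthonormal gamma g.
Let dg := og.1.

Lemma covar_sum_self (v : 'I_n -> R) :
  covar (fun x => \sum_i v i * g i x) (fun x => \sum_i v i * g i x) = \sum_i v i ^+ 2.
Proof.
have dv := dual_sum v dg.
rewrite (covar_suml gamma_gauss)//; apply: eq_bigr => i _; rewrite expr2; congr (_ * _).
rewrite covarC (covar_suml gamma_gauss)// (bigD1 i)//= og.2 eqxx mulr1 big1 ?addr0//.
by move=> j /negbTE ji; rewrite og.2 ji mulr0.
Qed.

(** A unit combination of orthonormal forms is a standard Gaussian variable; this is where C(p)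
    enters. *)
Lemma direction_moment (v : 'I_n -> R) p : 0 < p -> \sum_i v i ^+ 2 = 1 ->
  (\int[gamma]_x (`|\sum_i v i * g i x| `^ p)%:E = (gaussian_moment p `^ p)%:E)%E.
Proof.
move=> p0 v1; rewrite gaussian_momentE//.
apply: (dual_moment gamma_gauss) => //; [exact: dual_sum|by rewrite covar_sum_self|exact: ltW].
Qed.

Lemma sqrt_sum_sq_le (s : 'I_n -> R) (K : R) : 0 <= K ->
  (forall v : 'I_n -> R, \sum_i v i ^+ 2 = 1 -> \sum_i v i * s i <= K) ->
  Num.sqrt (\sum_i s i ^+ 2) <= K.
Proof.
move=> K0 hK; set r := Num.sqrt _; have [->//|r0] := eqVneq r 0.
have s2 : r ^+ 2 = \sum_i s i ^+ 2.
  by rewrite sqr_sqrtr//; apply: sumr_ge0 => i _; exact: sqr_ge0.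
have := hK (fun i => r^-1 * s i).
under eq_bigr do rewrite exprMn.
rewrite -mulr_sumr -s2 -exprMn mulVf// expr1n => /(_ erefl).
under eq_bigr do rewrite -mulrA -expr2.
by rewrite -mulr_sumr -s2 expr2 mulKf.
Qed.

Variables (P : 'rV[R]_n -> R) (a N : R).
Hypothesis tP : trig_poly (@lin_forms R n) P.
Hypotheses (a0 : 0 < a) (N0 : 0 <= N).
Variable S : 'I_n -> 'rV[R]_n -> R.
Hypothesis cS : forall j, cyl_smooth (S j).
Hypothesis SE : forall v x, continuous (fun s => rot_mean_dir gamma g P v s x) /\
  \sum_j v j * S j (coords g x) = \int[mu]_(s in `[0, a]) rot_mean_dir gamma g P v s x.

Definition field_norm (x : X) := Num.sqrt (\sum_j S j (coords g x) ^+ 2).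

Lemma cyl_smooth_coords_continuous f : cyl_smooth f -> continuous (fun x => f (coords g x)).
Proof.
elim=> [u l c /smooth1_continuous cu|c|{}f h _ cf _ ch|{}f h _ cf _ ch] x.
- apply: (@continuous_comp _ _ _ (fun x => lin_form l (coords g x) + c) u); last exact: cu.
  have cl := dual_continuous (dual_lin_form og l); have cc := @cst_continuous X R c.
  exact: (continuousD (cl x) (cc x)).
- exact: (@cst_continuous X R c).
- exact: (continuousD (cf x) (ch x)).
- exact: (continuousM (cf x) (ch x)).
Qed.

Lemma cyl_smooth_coords_measurable f : cyl_smooth f ->
  measurable_fun setT (fun x : borel X => f (coords g x)).
Proof. by move=> sf; apply: continuous_borel; exact: cyl_smooth_coords_continuous. Qed.

Lemma field_norm_measurable : measurable_fun setT (field_norm : borel X -> R).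
Proof.
apply: (measurableT_comp (f := @Num.sqrt R)).
  by apply: continuous_measurable_fun; exact: sqrt_continuous.
apply: (@measurable_sum _ _ R setT _ _ (fun j (x : borel X) => S j (coords g x) ^+ 2)) => j.
by apply: measurable_funX; exact: cyl_smooth_coords_measurable.
Qed.

Let mI : measurable (`[0, a]%classic : set (measurableTypeR R)). Proof. exact: measurable_itv. Qed.

(** The Euclidean norm is a supremum over unit vectors [v]; as [B] does not depend on [v], one
    integral over the angles bounds all components at once. *)
Lemma field_norm_le_integral (x : X) (K : R) (B : R -> R) : 0 <= K ->
  measurable_fun (`[0, a]%classic : set (measurableTypeR R)) B ->
  (forall v s, \sum_i v i ^+ 2 = 1 -> `|rot_mean_dir gamma g P v s x| <= B s) ->
  (\int[mu]_(s in `[0%R, a]) (B s)%:E <= K%:E)%E -> field_norm x <= K.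
Proof.
move=> K0 mB hB BK; apply: sqrt_sum_sq_le => // v v1.
have [cv ->] := SE v x; have iv := segment_continuous_integrable a cv.
apply: (le_trans (ler_norm _)); apply: (le_trans (le_normr_Rintegral mI iv)).
have inv : mu.-integrable `[0, a] (EFin \o (fun s => `|rot_mean_dir gamma g P v s x|)).
  exact: (integrable_norm iv).
rewrite -lee_fin fineK; last exact: integrable_fin_num.
apply: (le_trans _ BK); apply: ge0_le_integral => //.
- by case/integrableP : inv.
- by apply/measurable_EFinP.
- by move=> s _; rewrite lee_fin; exact: hB.
Qed.

Let P_measurable s x : measurable_fun setT (fun y : borel X => `|P (coords g (rot s x y))|).
Proof. by apply: measurableT_comp => //; have [] := trig_rot_bounded og s x tP. Qed.

Let dir_measurable v : measurable_fun setT (fun y : borel X => `|\sum_i v i * g i y|).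
Proof. by apply: measurableT_comp => //; exact: (dual_measurable (dual_sum v dg)). Qed.

Lemma field_norm_le_sup x : (forall y, `|P y| <= N) -> field_norm x <= gaussian_moment 1 * a * N.
Proof.
move=> PN; apply: (@field_norm_le_integral x _ (fun=> N * gaussian_moment 1)).
- by rewrite !mulr_ge0// ?gaussian_moment_ge0// ltW.
- exact: measurable_cst.
- move=> v s v1; apply: le_norm_Rintegral_norm.
  + by rewrite mulr_ge0// gaussian_moment_ge0.
  + by case/integrableP : (trig_rot_dir_integrable gamma_gauss og v s x tP) => /measurable_EFinP.
  have := direction_moment ltr01 v1; rewrite powRr1 ?gaussian_moment_ge0// => h.
  rewrite EFinM -h -ge0_integralZl//; last first.
    by apply/measurable_EFinP; apply: (measurableT_comp (measurable_powR 1)).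
  apply: ge0_le_integral => //.
  * by apply/measurable_EFinP; under eq_fun do rewrite normrM; apply: measurable_funM.
  * apply: emeasurable_funM => //; apply/measurable_EFinP.
    by apply: (measurableT_comp (measurable_powR 1)).
  * by move=> y _; rewrite -EFinM lee_fin normrM powRr1// ler_wpM2r.
rewrite integral_cst//= [X in (_ * X <= _)%E]lebesgue_segment// -EFinM lee_fin.
by rewrite (mulrC N) mulrAC.
Qed.

Variables (p q : R).
Hypotheses (p0 : 0 < p) (q0 : 0 < q) (pq : p^-1 + q^-1 = 1).

Lemma rot_mean_dir_power v s x : \sum_i v i ^+ 2 = 1 ->
  `|rot_mean_dir gamma g P v s x| <= rot_power gamma g P q s x `^ q^-1 * gaussian_moment p.
Proof.
move=> v1; apply: le_norm_Rintegral_norm.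
- by rewrite mulr_ge0 ?powR_ge0 ?gaussian_moment_ge0.
- by case/integrableP : (trig_rot_dir_integrable gamma_gauss og v s x tP) => /measurable_EFinP.
under eq_integral do rewrite normrM.
apply: (@hoelder_le _ _ _ gamma setT measurableT _ _ q p) => //.
- by rewrite addrC.
- exact: powR_ge0.
- exact: gaussian_moment_ge0.
- rewrite -powRrM mulVf ?gt_eqF// powRr1 ?rot_power_ge0//.
  by rewrite (rot_power_EFin og tP q0).
- by rewrite direction_moment.
Qed.

(** Hoelder's inequality in y gives the factor C(p), and a second one in s, on a segment of length
    [a], gives a^(1/p). *)
Lemma field_norm_power x : field_norm x <=
  gaussian_moment p * (rot_total gamma g P q a x `^ q^-1 * a `^ p^-1).
Proof.
have mA := rot_power_measurable1 og tP q x.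
have mB : measurable_fun setT (fun s : measurableTypeR R => rot_power gamma g P q s x `^ q^-1).
  by apply: (measurableT_comp (measurable_powR _)).
apply: (@field_norm_le_integral x _ (fun s => rot_power gamma g P q s x `^ q^-1 * gaussian_moment p)).
- by rewrite !mulr_ge0 ?gaussian_moment_ge0 ?powR_ge0.
- by apply: measurable_funTS; apply: measurable_funM.
- by move=> v s; exact: rot_mean_dir_power.
under eq_integral do rewrite mulrC EFinM.
rewrite ge0_integralZl//; last 3 first.
- by apply/measurable_EFinP; exact: measurable_funTS.
- by move=> s _; rewrite lee_fin powR_ge0.
- by rewrite lee_fin gaussian_moment_ge0.
rewrite EFinM; apply: lee_wpmul2l; first by rewrite lee_fin gaussian_moment_ge0.
under eq_integral do rewrite -[X in X%:E]mulr1.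
apply: (@hoelder_le _ _ _ mu _ mI _ (fun=> 1) q p) => //; try by move=> *; exact: powR_ge0.
- by rewrite addrC.
- rewrite -powRrM mulVf ?gt_eqF// powRr1 ?rot_total_ge0// (rot_total_EFin og tP q0 a0).
  apply: ge0_le_integral => //.
  + by move=> s _; rewrite lee_fin powR_ge0.
  + by apply/measurable_EFinP; apply: measurable_funTS; apply: (measurableT_comp (measurable_powR _)).
  + by apply/measurable_EFinP; exact: measurable_funTS.
  + by move=> s _; rewrite lee_fin -powRrM mulVf ?gt_eqF// powRr1// rot_power_ge0.
- under eq_integral do rewrite powR1.
  rewrite integral_cst//= [X in (_ * X <= _)%E]lebesgue_segment// mul1e.
  by rewrite -powRrM mulVf ?gt_eqF// powRr1// ltW.
Qed.

Lemma field_norm_le_power : (\int[gamma]_x (`|P (coords g x)| `^ q)%:E <= (N `^ q)%:E)%E ->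
  (\int[gamma]_x (field_norm x `^ q)%:E <= ((gaussian_moment p * a * N) `^ q)%:E)%E.
Proof.
move=> PN; set C := gaussian_moment p; have C0 : 0 <= C by exact: gaussian_moment_ge0.
have mT := rot_total_measurable og tP q0 a0.
apply: (@le_trans _ _ (\int[gamma]_x ((C `^ q * (a `^ p^-1) `^ q)%:E * (rot_total gamma g P q a x)%:E))%E).
  apply: ge0_le_integral => //.
  - by move=> x _; rewrite lee_fin powR_ge0.
  - by apply/measurable_EFinP; apply: (measurableT_comp (measurable_powR _)); exact: field_norm_measurable.
  - by apply: emeasurable_funM => //; apply/measurable_EFinP.
  move=> x _; rewrite -EFinM lee_fin.
  apply: (@le_trans _ _ ((C * (rot_total gamma g P q a x `^ q^-1 * a `^ p^-1)) `^ q)).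
    apply: ge0_ler_powR; rewrite ?nnegrE ?(ltW q0) ?sqrtr_ge0 ?field_norm_power//.
    by rewrite !mulr_ge0 ?powR_ge0.
  have := rot_total_ge0 gamma g P q a x; move: (rot_total gamma g P q a x) => r r0.
  rewrite (powRM q C0 (mulr_ge0 (powR_ge0 _ _) (powR_ge0 _ _))).
  rewrite (powRM q (powR_ge0 _ _) (powR_ge0 _ _)) -(powRrM r).
  by rewrite mulVf ?gt_eqF// powRr1// -mulrA (mulrC r).
rewrite ge0_integralZl//; last 3 first.
- by apply/measurable_EFinP.
- by move=> x _; rewrite lee_fin rot_total_ge0.
- by rewrite lee_fin mulr_ge0 ?powR_ge0.
rewrite (rot_total_integral hX gamma_radon gamma_gauss og tP q0 a0).
apply: (@le_trans _ _ ((C `^ q * (a `^ p^-1) `^ q)%:E * (a%:E * (N `^ q)%:E))%E).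
  apply: lee_wpmul2l; first by rewrite lee_fin mulr_ge0 ?powR_ge0.
  by apply: lee_wpmul2l => //; rewrite lee_fin ltW.
(* The powers of [a] are q / p from Hoelder's inequality in s and 1 from the integral of
   [rot_total]; together q / p + 1 = q. *)
rewrite -!EFinM lee_fin !powRM ?mulr_ge0 ?(ltW a0)// mulrA ler_wpM2r ?powR_ge0//.
rewrite -mulrA ler_wpM2l ?powR_ge0// -powRrM -{2}(powRr1 (ltW a0)) -powRD.
  by rewrite (_ : p^-1 * q + 1 = q)//; rewrite -[X in _ + X = _](mulVf (lt0r_neq0 q0)) -mulrDl pq mul1r.
by apply/implyP => _; rewrite gt_eqF.
Qed.

End field_bound.

(** * The angle of the rotation and c_t *)

Section ou_time.
Context {R : realType}.
Notation mu := (@lebesgue_measure R).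

Let f (s : R) : R := expR (- s) / Num.sqrt (1 - expR (- (2 * s))).
Let F (s : R) : R := acos (expR (- s)).

Let f0 s : 0 <= f s.
Proof. by rewrite divr_ge0 ?expR_ge0 ?sqrtr_ge0. Qed.

Let sqE (s : R) : expR (- s) ^+ 2 = expR (- (2 * s)).
Proof. by rewrite -expRM_natl mulrN. Qed.

Let exp_lt1 (s : R) : 0 < s -> expR (- s) < 1.
Proof. by move=> s0; rewrite -[ltRHS]expR0 ltr_expR oppr_lt0. Qed.

Let dF (s : R) : 0 < s -> is_derive s (1 : R) F (f s).
Proof.
move=> s0; have x1 : -1 < expR (- s) < 1.
  by rewrite exp_lt1// andbT (lt_trans _ (expR_gt0 _))// ltrN10.
have dE : is_derive s (1 : R) (fun s => expR (- s)) (expR (- s) * -1).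
  exact: (@is_derive1_comp _ expR (fun s => - s) s).
have := @is_derive1_comp _ _ (fun s => expR (- s)) s _ _ (is_derive1_acos x1) dE.
by rewrite sqE mulrN1 mulrNN mulrC.
Qed.

Let f_continuous (s : R) : 0 < s -> {for s, continuous f}.
Proof.
move=> s0.
have ce c : continuous (fun s : R => expR (- (c * s))).
  move=> x; apply: (@continuous_comp _ _ _ (fun x => - (c * x)) expR); last exact: continuous_expR.
  apply: continuousN; apply: continuousM; [exact: cvg_cst|exact: cvg_id].
have ce1 : continuous (fun s : R => expR (- s)).
  by have := ce 1; under eq_fun do rewrite mul1r.
apply: continuousM; first exact: ce1.
apply: continuousV.
  rewrite sqrtr_eq0 -ltNge subr_gt0; apply: exp_lt1; exact: mulr_gt0.
have c1 : {for s, continuous (fun s : R => 1 - expR (- (2 * s)))}.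
  by apply: continuousB; [exact: cvg_cst|exact: ce].
exact: (continuous_comp c1 (@sqrt_continuous _ _)).
Qed.

Let f_measurable : measurable_fun (`]0, +oo[ : set (measurableTypeR R)) f.
Proof.
apply: open_continuous_measurable_fun; first exact: interval_open.
by move=> s; rewrite inE/= in_itv/= andbT; exact: f_continuous.
Qed.

Let integral_f a b : 0 < a -> a < b -> (\int[mu]_(s in `[a, b]) (f s)%:E = (F b - F a)%:E)%E.
Proof.
move=> a0 ab; rewrite (@continuous_FTC2 _ f F)//.
- apply: continuous_in_subspaceT => s; rewrite inE/= in_itv/= => /andP[s1 _].
  by apply: f_continuous; exact: lt_le_trans s1.
- have cF s : 0 < s -> {for s, continuous F}.
    by move=> s0; apply: differentiable_continuous; apply/derivable1_diffP; have [] := dF s0.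
  split.
  + move=> s; rewrite in_itv/= => /andP[s1 _].
    by have [] := dF (lt_trans a0 s1).
  + by apply/cvg_at_right_filter/cF.
  + by apply/cvg_at_left_filter/cF; exact: lt_trans ab.
- move=> s; rewrite in_itv/= => /andP[s1 _].
  by rewrite derive1E; have [] := dF (lt_trans a0 s1).
Qed.

(** [F] is a primitive of the integrand, which blows up at 0; both estimates are therefore made on
    segments away from 0. *)
Lemma acos_le_ou_time (t : R) : 0 < t -> acos (expR (- t)) <= ou_time t.
Proof.
move=> t0; rewrite /ou_time /Rintegral -/f.
have sub a : 0 < a -> `[a, t] `<=` (`]0, +oo[ : set (measurableTypeR R)).
  by move=> a0 s /=; rewrite !in_itv/= andbT => /andP[s1 _]; exact: lt_le_trans s1.
have sub0 : `]0, t] `<=` (`]0, +oo[ : set (measurableTypeR R)).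
  by move=> s /=; rewrite !in_itv/= andbT => /andP[].
have mf0 : measurable_fun (`]0, t] : set (measurableTypeR R)) (EFin \o f).
  apply/measurable_EFinP; apply: (measurable_funS _ sub0 f_measurable) => //.
set I := (\int[mu]_(s in _) _)%E.
have IE : I = (\int[mu]_(s in `]0%R, t]) (f s)%:E)%E by rewrite integral_itv_obnd_cbnd.
(* The real part of an infinite integral would be 0, so finiteness has to be shown first; an upper
   bound provides it. *)
have Ile : (I <= (F t)%:E)%E.
  (* Dividing by n + 2 makes the left end lie strictly below [t] already for n = 0. *)
  pose G n : set (measurableTypeR R) := `[t / n.+2%:R, t]%classic.
  have tn n : 0 < t / n.+2%:R by rewrite divr_gt0.
  have tn2 n : t / n.+2%:R < t by rewrite ltr_pdivrMr// ltr_pMr// ltr1n.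
  have UG : \bigcup_n G n = `]0, t]%classic.
    apply/seteqP; split=> [s [n _]|s]; rewrite /G /= !in_itv/=.
      by move=> /andP[s1 ->]; rewrite andbT; exact: lt_le_trans s1.
    move=> /andP[s0 st]; exists (Num.truncn (t / s)) => //=; rewrite in_itv/= st andbT.
    rewrite ler_pdivrMr// mulrC -ler_pdivrMr//.
    have := truncnS_gt (t / s) => h; apply: (le_trans (ltW h)).
    by rewrite ler_nat.
  have := @ge0_nondecreasing_set_cvg_integral _ _ R G (EFin \o f) mu.
  rewrite UG -IE => cvgI; apply: (cvge_to_le (cvgI _ _ _ _)).
  - apply/nondecreasing_seqP => n; apply/subsetPset => s; rewrite /G /= !in_itv/= => /andP[s1 ->].
    rewrite andbT (le_trans _ s1)// ler_wpM2l ?(ltW t0)// lef_pV2 ?posrE// ler_nat.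
    by [].
  - by move=> n; exact: measurable_itv.
  - by move=> n; apply/measurable_EFinP; exact: measurable_funS (sub _ (tn n)) f_measurable.
  - by move=> n s _; rewrite lee_fin.
  - apply: nearW => n; rewrite integral_f// lee_fin lerBlDr lerDl.
    by apply: acos_ge0; rewrite (ltW (exp_lt1 _))// andbT (le_trans _ (expR_ge0 _))// lerN10.
have I0 : (0 <= I)%E by apply: integral_ge0 => s _; rewrite lee_fin.
have Ifin : I \is a fin_num by rewrite ge0_fin_numE// (le_lt_trans Ile)// ltry.
have x1 : -1 <= expR (- t) < 1 by rewrite exp_lt1// andbT (le_trans _ (expR_ge0 _))// lerN10.
have Ft0 : 0 < F t by exact: acos_gt0.
have Ftpi : F t <= pi.
  by apply: acos_lepi; case/andP: x1 => -> /ltW ->.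
(* At the point [a = - ln (cos d)] chosen below, [F a = d], so the integral over [a, t] is
   [F t - d]; taking d at most half of [F t] ensures a < t. *)
apply/ler_addgt0Pr => e e0; pose d := Num.min e (F t / 2).
have d0 : 0 < d by rewrite lt_min e0 divr_gt0.
have dt : d < F t by rewrite gt_min; apply/orP; right; lra.
have cd1 : cos d < 1 by rewrite -(cos0 R) ltr_cos// in_itv/= ?lexx ?pi_ge0// ?(ltW d0) (ltW (lt_le_trans dt Ftpi)).
have cdt : expR (- t) < cos d.
  rewrite -[ltLHS]acosK ?ltr_cos//; rewrite ?in_itv/= ?(ltW d0) ?(ltW Ft0) ?(ltW (lt_le_trans dt Ftpi))//.
  by case/andP: x1 => -> /ltW ->.
have cd0 : 0 < cos d by exact: lt_trans (expR_gt0 _) cdt.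
pose a := - ln (cos d).
have a0 : 0 < a by rewrite oppr_gt0 ln_lt0// cd0.
have at_ : a < t by rewrite ltrNl -ltr_expR lnK ?posrE.
have Fa : F a = d.
  by rewrite /F opprK lnK ?posrE// cosK// in_itv/= (ltW d0) (ltW (lt_le_trans dt Ftpi)).
have : ((F t - d)%:E <= I)%E.
  rewrite -{1}Fa -(integral_f a0 at_) IE; apply: ge0_subset_integral => //.
    by move=> s _; rewrite lee_fin.
  by move=> s /=; rewrite !in_itv/= => /andP[s1 ->]; rewrite andbT; exact: lt_le_trans s1.
rewrite -[X in (_ <= X)%E](fineK Ifin) lee_fin => h.
have de : d <= e by rewrite ge_min lexx.
by rewrite -/(F t) -lerBlDr; apply: le_trans h; rewrite lerD2l lerN2.
Qed.

End ou_time.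

(** * Balls for the dual exponent *)

Lemma Lnorm_leP d (T : measurableType d) (R : realType) (nu : {measure set T -> \bar R})
    (r N : R) (u : T -> R) : 0 < r -> 0 <= N ->
  (\int[nu]_x (`|u x| `^ r)%:E <= (N `^ r)%:E)%E <-> (Lnorm nu r%:E (EFin \o u) <= N%:E)%E.
Proof.
move=> r0 N0; rewrite unlock /=; set I := (\int[nu]_x _)%E.
have I0 : (0 <= I)%E by apply: integral_ge0 => x _; rewrite lee_fin powR_ge0.
have mono (s : R) (x y : \bar R) : 0 < s -> (0 <= x)%E -> (0 <= y)%E -> (x <= y)%E -> (x `^ s <= y `^ s)%E.
  move=> s0 x0 y0; apply: gt0_ler_poweR; rewrite ?in_itv/= ?leey ?andbT//; exact: ltW.
have rV : r^-1 * r = 1 by rewrite mulVf// gt_eqF.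
split=> h.
  have := mono r^-1 _ _ _ I0 _ h; rewrite invr_gt0 => /(_ r0).
  by rewrite lee_fin powR_ge0 poweR_EFin -powRrM mulrC rV powRr1// => /(_ isT).
have := mono r _ _ r0 (poweR_ge0 _ _) _ h.
by rewrite lee_fin -poweRrM rV poweRe1// poweR_EFin => /(_ N0).
Qed.

Section dual_ball.
Context {R : realType} {X : tvsType R}.
Variable gamma : probability (borel X) R.
Variable p : R.
Hypothesis p1 : 1 <= p.

Let q := p / (p - 1).

(* The closed ball of radius [N] in [L^p'(gamma)], with the supremum in place
   of the essential supremum when [p = 1]. *)
Definition dual_ball (N : R) (u : X -> R) : Prop :=
  if p == 1 then forall x, `|u x| <= N else
  (\int[gamma]_x (`|u x| `^ q)%:E <= (N `^ q)%:E)%E.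

Let qE : p != 1 -> hoelder_conjugate p%:E = q%:E /\ 1 <= q.
Proof.
move=> pn1; have pp : 1 < p by rewrite lt_neqAle eq_sym pn1.
have p10 : p - 1 != 0 by rewrite subr_eq0.
split; last by rewrite /q ler_pdivlMr; lra.
rewrite /hoelder_conjugate !eqe/= gt_eqF; last lra.
by rewrite -EFinB inver (negbTE p10).
Qed.

Lemma dual_ballP N (u : X -> R) : p != 1 -> 0 <= N ->
  dual_ball N u <-> (Lnorm gamma q%:E (EFin \o (u : borel X -> R)) <= N%:E)%E.
Proof.
move=> pn1 N0; rewrite /dual_ball (negbTE pn1); apply: Lnorm_leP => //.
by have [_] := qE pn1; exact: lt_le_trans.
Qed.

Lemma dual_ball_Lnorm N (u : X -> R) : 0 <= N -> dual_ball N u ->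
  (Lnorm gamma (hoelder_conjugate p%:E) (fun x => (u x)%:E) <= N%:E)%E.
Proof.
move=> N0; have [pe|pn1] := eqVneq p 1; last first.
  by move=> /(dual_ballP _ pn1 N0); rewrite (qE pn1).1.
rewrite /dual_ball pe eqxx hoelder_conjugate1 unlock => h.
rewrite [X in if X then _ else _](_ : _ = true).
  by apply/ess_supP; apply: nearW => x; rewrite /= lee_fin.
by rewrite [X in (_ < X)%E](@probability_setT _ _ _ gamma) lte01.
Qed.

(** Minkowski's inequality with a pointwise domination. With [v = 0] it serves as monotonicity, with
    a constant [v] as stability under a uniform error. *)
Lemma dual_ball_add N M (u v w : X -> R) : 0 <= N -> 0 <= M ->
  measurable_fun setT (u : borel X -> R) -> measurable_fun setT (v : borel X -> R) ->
  measurable_fun setT (w : borel X -> R) ->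
  dual_ball N u -> dual_ball M v -> (forall x, `|w x| <= `|u x| + `|v x|) -> dual_ball (N + M) w.
Proof.
move=> N0 M0 mu mv mw; have [pe|pn1] := eqVneq p 1.
  rewrite /dual_ball pe eqxx => hu hv h x; apply: (le_trans (h x)); exact: lerD.
have [_ q1] := qE pn1; have q0 : 0 <= q by lra.
have norm_ball L (z : X -> R) : dual_ball L z -> dual_ball L (fun x => `|z x|).
  by rewrite /dual_ball (negbTE pn1); under [X in _ -> is_true (X <= _)%E]eq_integral do rewrite normr_id.
move=> /norm_ball hu /norm_ball hv h.
have mnu : measurable_fun setT (fun x : borel X => `|u x|) by exact: measurableT_comp.
have mnv : measurable_fun setT (fun x : borel X => `|v x|) by exact: measurableT_comp.
suff huv : dual_ball (N + M) (fun x => `|u x| + `|v x|).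
  move: huv; rewrite /dual_ball (negbTE pn1); apply: le_trans; apply: ge0_le_integral => //.
  - by apply/measurable_EFinP; apply: (measurableT_comp (measurable_powR _)); exact: measurableT_comp.
  - apply/measurable_EFinP; apply: (measurableT_comp (measurable_powR _)).
    by apply: measurableT_comp => //; exact: measurable_funD.
  - move=> x _; rewrite lee_fin ge0_ler_powR ?nnegrE//.
    by rewrite [leRHS]ger0_norm ?addr_ge0.
apply/(dual_ballP _ pn1) => //; first exact: addr_ge0.
apply: (le_trans (minkowski_EFin gamma mnu mnv q1)).
by rewrite EFinD; apply: leeD; apply/(dual_ballP _ pn1).
Qed.

Lemma dual_ball_cst N : 0 <= N -> dual_ball N (fun=> N).
Proof.
move=> N0; rewrite /dual_ball; case: ifP => [_ x|_]; first by rewrite ger0_norm.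
by rewrite integral_cst// [X in (_ * X <= _)%E](@probability_setT _ _ _ gamma) mule1 ger0_norm.
Qed.

End dual_ball.

(** * The Besov bound for trigonometric polynomials *)

Lemma seq_cvgMl {R : realType} (c : R) (u : nat -> R) (l : R) : u k @[k --> \oo] --> l ->
  c * u k @[k --> \oo] --> c * l.
Proof.
by move=> ul; have := cvgM (@cvg_cst _ c _ (\oo : set_system nat) _) ul; apply.
Qed.

Section cutoff_field.
Context {R : realType} {X : tvsType R} (hX : hausdorff_space X).
Variable gamma : probability (borel X) R.
Hypothesis gamma_radon : radon gamma.
Hypothesis gamma_gauss : centered_gaussian gamma.
Local Notation covar := (cov gamma).
Variables (n : nat) (g : 'I_n -> X -> R).
Hypothesis og : orthonormal gamma g.
Let dg := og.1.
Variables (S : 'I_n -> 'rV[R]_n -> R) (M : R).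
Hypothesis cS : forall j, cyl_smooth (S j).
Hypothesis SM : forall j y, `|S j y| <= M.

Definition field_div (x : X) : R :=
  \sum_j (partial j (S j) (coords g x) - g j x * S j (coords g x)).

Lemma cm_rep_sum (h : 'I_n -> X) (c : 'I_n -> R) : (forall i, cm_rep gamma (g i) (h i)) ->
  cm_rep gamma (fun x => \sum_i c i * g i x) (\sum_i c i *: h i).
Proof.
move=> rh l dl; rewrite covarC (covar_suml gamma_gauss)//.
elim/big_rec2: _ => [|i a b _ IH]; first exact: dual_zero.
by rewrite (dual_add _ _ dl) (dual_scale _ _ dl) IH (rh i l dl) covarC.
Qed.

(** The cutoff commutes with the divergence up to the sum of the derivatives of the cutoff times
    [S j], hence the error n B |M| / (k + 1). The norm of a combination of the [h i] is Euclidean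
    because they represent orthonormal forms. *)
Lemma cutoff_field : exists2 B, 0 <= B & forall k : nat, exists Phi : cyl_field gamma,
  [/\ forall x, cm_norm gamma (cyl_val Phi x) =
        (cutoff k.+1%:R (coords g x) * field_norm g S x)%:E,
      forall x, `|div_gamma Phi x - cutoff k.+1%:R (coords g x) * field_div x| <= B / k.+1%:R &
      measurable_fun setT (div_gamma Phi : borel X -> R)].
Proof.
have [B B0 hB] := @is_derive_cutoff R n.
have gcov i : covar (g i) (g i) = 1 by rewrite og.2 eqxx.
have [h hh] := choice (fun i => cm_vector hX gamma_radon gamma_gauss (dg i) (gcov i)).
(* The absolute value of [M] is taken because for n = 0 its sign is not determined. *)
exists (n%:R * (B * `|M|)) => [|k]; first by rewrite !mulr_ge0.
have k0 : 0 < k.+1%:R :> R by [].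
pose psi j y := cutoff k.+1%:R y * S j y.
have psi_smooth j : cyl_smooth (psi j) by apply: CylMul => //; exact: cyl_smooth_cutoff.
have hsm j : smooth_compact_support (psi j) by exact: cutoff_compact_support.
have hcm i : cameron_martin gamma (h i).
  exact: (cm_rep_cameron_martin hX gamma_radon gamma_gauss (dg i) (gcov i) (hh i)).
have hgo i j : (\int[gamma]_x (g i x * g j x)%:E = ((i == j)%:R)%:E)%E.
  rewrite -og.2 fineK//; apply: integrable_fin_num => //.
  exact: (dual_mul_integrable gamma_gauss (dg i) (dg j)).
have hho i j : cm_inner gamma (h i) (h j) = (i == j)%:R.
  by rewrite (cm_inner_rep gamma_gauss (dg i) (dg j) (hh i) (hh j)) og.2.
have hgh i j : g i (h j) = (i == j)%:R by rewrite (hh j _ (dg i)) og.2.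
exists (CylField hsm dg hcm hgo hho hgh); split => [x|x|].
- rewrite /cyl_val/= -/(coords g x).
  rewrite (cm_norm_rep gamma_gauss (dual_sum (fun i => psi i (coords g x)) dg)
    (cm_rep_sum (fun i => psi i (coords g x)) hh)).
  rewrite covar_sum_self// /psi; congr EFin; under eq_bigr do rewrite exprMn.
  by rewrite -mulr_sumr sqrtrM ?sqr_ge0// sqrtr_sqr ger0_norm// cutoff_ge0.
- rewrite /div_gamma/= -/(coords g x) /field_div mulr_sumr -sumrB.
  apply: (le_trans (ler_norm_sum _ _ _)).
  have -> : n%:R * (B * `|M|) / k.+1%:R = \sum_(j < n) B / k.+1%:R * `|M|.
    by rewrite sumr_const card_ord -mulr_natl; ring.
  apply: ler_sum => j _; have [d dd dB] := hB _ k0 j (coords g x).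
  have [S' _ dS] := cyl_smooth_partial j (cS j).
  have e1 : partial j (psi j) (coords g x) =
      cutoff k.+1%:R (coords g x) * S' (coords g x) + S j (coords g x) * d.
    by have [_] := is_deriveM dd (dS (coords g x)).
  have e2 : partial j (S j) (coords g x) = S' (coords g x) by have [_] := dS (coords g x).
  rewrite e1 e2 /psi.
  have -> : cutoff k.+1%:R (coords g x) * S' (coords g x) + S j (coords g x) * d -
      g j x * (cutoff k.+1%:R (coords g x) * S j (coords g x)) -
      cutoff k.+1%:R (coords g x) * (S' (coords g x) - g j x * S j (coords g x)) =
      d * S j (coords g x).
    by move: (cutoff _ _) (S' _) (S _ _) (g _ _) => *; ring.
  by rewrite normrM; apply: ler_pM => //; exact: le_trans (SM _ _) (ler_norm _).
- rewrite /div_gamma/=.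
  apply: (@measurable_sum _ _ R setT _ _ (fun j (x : borel X) =>
    partial j (psi j) (coords g x) - g j x * psi j (coords g x))) => j.
  apply: measurable_funB.
    have [f sf df] := cyl_smooth_partial j (psi_smooth j).
    rewrite (_ : partial j (psi j) = f); last by apply/funext => y; have [_] := df y.
    exact: (cyl_smooth_coords_measurable og).
  apply: measurable_funM; first exact: (dual_measurable (dg j)).
  exact: (cyl_smooth_coords_measurable og).
Qed.

End cutoff_field.

Section besov_bound.
Context {R : realType} {X : tvsType R} (hX : hausdorff_space X).
Variable gamma : probability (borel X) R.
Hypothesis gamma_radon : radon gamma.
Hypothesis gamma_gauss : centered_gaussian gamma.
Variables (p alpha : R) (f : X -> R) (C : R).
Hypotheses (p1 : 1 <= p) (alpha0 : 0 < alpha) (alpha1 : alpha <= 1).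
Hypothesis intf : gamma.-integrable setT (EFin \o (f : borel X -> R)).
Hypothesis fC : besov_const gamma p alpha f C.
Variables (n : nat) (g : 'I_n -> X -> R) (P : 'rV[R]_n -> R) (a N : R).
Hypothesis og : orthonormal gamma g.
Hypothesis tP : trig_poly (@lin_forms R n) P.
Hypotheses (a0 : 0 < a) (N0 : 0 <= N).
Hypothesis PN1 : p = 1 -> forall y, `|P y| <= N.
Hypothesis PN : dual_ball gamma p N (fun x => P (coords g x)).
Let q := p / (p - 1).

Let q_conj : p != 1 -> [/\ 0 < p, 0 < q & p^-1 + q^-1 = 1].
Proof.
move=> pn1; have pp : 1 < p by rewrite lt_neqAle eq_sym pn1.
have p0 : p != 0 by rewrite gt_eqF//; lra.
have p10 : p - 1 != 0 by rewrite subr_eq0.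
split; [lra|by rewrite divr_gt0//; lra|].
by rewrite /q invf_div -{1}[p^-1]mul1r -mulrDl addrC subrK divff.
Qed.

Lemma rot_mean_ball : dual_ball gamma p N (rot_mean gamma g P a).
Proof.
rewrite /dual_ball; have [pe|pn1] := eqVneq p 1.
  move=> x; apply: le_norm_Rintegral => //.
    by exact: (bounded_measurable_integrable gamma (trig_rot_bounded og a x tP)).
  by move=> y; exact: PN1.
have [p0 q0 pq] := q_conj pn1.
have := PN; rewrite /dual_ball (negbTE pn1); apply: le_trans.
exact: (rot_mean_norm hX gamma_radon gamma_gauss og tP q0 p0 pq).
Qed.

(** The Besov inequality is applied to the cutoff fields. Their divergences are uniformly bounded
    and [f] is integrable, so dominated convergence applies; the strict inequality [N < N'] absorbs
    the cutoff error from some k on. *)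
Lemma besov_bound N' : N < N' ->
  \int[gamma]_x (f x * (rot_mean gamma g P a x - P (coords g x))) <=
  C * ((gaussian_moment p * a * N') `^ alpha * (2 * N') `^ (1 - alpha)).
Proof.
move=> NN'; have [C0 hC] := fC.
have [S [cS [M SM] divS SE]] := rotation_field gamma_gauss og a0 tP.
have [B B0 hB] := cutoff_field hX gamma_radon gamma_gauss og cS SM.
have [Phi hPhi] := choice hB.
pose D x := rot_mean gamma g P a x - P (coords g x).
have DE x : field_div g S x = D x by exact: divS.
have mrot : measurable_fun setT (rot_mean gamma g P a : borel X -> R).
  exact: (rot_mean_measurable hX gamma_radon og tP).
have [mPg _] := trig_bounded_measurable (trig_coords og tP).
have c0 := @gaussian_moment_ge0 R p.
have caN0 : 0 <= gaussian_moment p * a * N by rewrite !mulr_ge0// ltW.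
have [MP MP0 PMP] := trig_lin_bounded tP.
have rotM x : `|rot_mean gamma g P a x| <= MP.
  apply: le_norm_Rintegral => //.
  by exact: (bounded_measurable_integrable gamma (trig_rot_bounded og a x tP)).
have DM x : `|D x| <= 2 * MP.
  apply: (le_trans (ler_normB _ _)); rewrite mulr_natl mulr2n; exact: lerD.
have chi1 k x : `|cutoff k.+1%:R (coords g x)| <= 1.
  by rewrite ger0_norm ?cutoff_ge0// cutoff_le1.
have divk k x : `|div_gamma (Phi k) x| <= `|D x| + B / k.+1%:R.
  have [_ h2 _] := hPhi k; have := h2 x; rewrite DE => h.
  rewrite -[X in `|X|](subrK (cutoff k.+1%:R (coords g x) * D x)) addrC.
  apply: (le_trans (ler_normD _ _)); apply: lerD => //.
  by rewrite normrM -[leRHS]mul1r ler_wpM2r.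
have mdiv k : measurable_fun setT (div_gamma (Phi k) : borel X -> R) by have [] := hPhi k.
have ballS : dual_ball gamma p (gaussian_moment p * a * N) (field_norm g S).
  rewrite /dual_ball; have [pe|pn1] := eqVneq p 1.
    move=> x; rewrite ger0_norm ?sqrtr_ge0// pe.
    exact: (field_norm_le_sup gamma_gauss og tP a0 N0 SE x (PN1 pe)).
  have [p0 q0 pq] := q_conj pn1.
  have := PN; rewrite /dual_ball (negbTE pn1) => h.
  have := field_norm_le_power hX gamma_radon gamma_gauss og tP a0 N0 cS SE p0 q0 pq h.
  by under eq_integral do rewrite -[X in X `^ _]ger0_norm ?sqrtr_ge0//.
have mcut k : measurable_fun setT (fun x : borel X => cutoff k.+1%:R (coords g x)).
  by apply: (cyl_smooth_coords_measurable og); exact: cyl_smooth_cutoff.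
have mS := field_norm_measurable og cS.
have ballPhi k : dual_ball gamma p (gaussian_moment p * a * N)
    (fun x => cutoff k.+1%:R (coords g x) * field_norm g S x).
  rewrite -[X in dual_ball _ _ X]addr0.
  have z0 : 0 <= 0 :> R by [].
  have mz : measurable_fun setT (fun _ : borel X => 0 : R) by exact: measurable_cst.
  apply: (dual_ball_add p1 caN0 z0 mS mz _ ballS (dual_ball_cst gamma p z0)).
    exact: measurable_funM.
  by move=> x; rewrite normr0 addr0 normrM -[leRHS]mul1r ler_wpM2r.
have Bk k : 0 <= B / k.+1%:R by rewrite divr_ge0.
have mD : measurable_fun setT (D : borel X -> R) by exact: measurable_funB.
have ballD : dual_ball gamma p (N + N) D.
  apply: (dual_ball_add p1 N0 N0 mrot mPg mD rot_mean_ball PN) => x.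
  exact: ler_normB.
have ballDiv k : dual_ball gamma p (N + N + B / k.+1%:R) (div_gamma (Phi k)).
  apply: (dual_ball_add p1 (addr_ge0 N0 N0) (Bk k) mD (measurable_cst _) (mdiv k) ballD
    (dual_ball_cst _ _ (Bk k))) => x.
  by rewrite /cst (ger0_norm (Bk k)).
have mf : measurable_fun setT (f : borel X -> R) by case/integrableP : intf => /measurable_EFinP.
have fdivk k x : `|f x * div_gamma (Phi k) x| <= (2 * MP + B) * `|f x|.
  rewrite normrM mulrC ler_wpM2r//; apply: (le_trans (divk k x)); apply: lerD => //.
  by rewrite ler_pdivrMr// ler_peMr// ler1n.
have intG : gamma.-integrable setT (EFin \o (fun x : borel X => (2 * MP + B) * `|f x|)).
  by apply: integrable_realZl => //; exact: (integrable_norm intf).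
have intk k : gamma.-integrable setT (EFin \o (fun x : borel X => f x * div_gamma (Phi k) x)).
  apply: (le_integrable measurableT _ _ intG).
    by apply/measurable_EFinP; exact: measurable_funM.
  by move=> x _; rewrite !abse_EFin lee_fin [leRHS]ger0_norm// mulr_ge0// addr_ge0// mulr_ge0// ltW.
have bound k : N + N + B / k.+1%:R <= 2 * N' ->
    (\int[gamma]_x (f x * div_gamma (Phi k) x)%:E <=
    (C * ((gaussian_moment p * a * N') `^ alpha * (2 * N') `^ (1 - alpha)))%:E)%E.
  move=> hk; apply: (le_trans (hC (Phi k))).
  have [h1 _ _] := hPhi k.
  have N'0 : 0 <= N' by rewrite (le_trans N0)// ltW.
  rewrite -muleA EFinM; apply: lee_wpmul2l; first by rewrite lee_fin.
  rewrite EFinM -!poweR_EFin; apply: lee_pmul; try exact: poweR_ge0.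
    apply: gt0_ler_poweR; rewrite ?in_itv/= ?leey ?andbT ?Lnorm_ge0 ?lee_fin ?(ltW alpha0)//.
      by rewrite !mulr_ge0// ltW.
    under eq_fun do rewrite h1.
    apply: (le_trans (dual_ball_Lnorm p1 caN0 (ballPhi k))).
    by rewrite lee_fin ler_wpM2l ?(ltW NN')// mulr_ge0// ltW.
  apply: gt0_ler_poweR; rewrite ?in_itv/= ?leey ?andbT ?Lnorm_ge0 ?lee_fin ?subr_ge0//.
    by rewrite mulr_ge0.
  apply: (le_trans (dual_ball_Lnorm p1 _ (ballDiv k))); first by rewrite !addr_ge0.
  by rewrite lee_fin.
have cvgB : (fun k => B / k.+1%:R) @ \oo --> (0 : R).
  by have := @seq_cvgMl R B _ _ (@cvg_harmonic R); rewrite mulr0.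
have cvgdiv x : (fun k => (f x * div_gamma (Phi k) x)%:E) @ \oo --> (f x * D x)%:E.
  apply: cvg_EFin; first exact: nearW.
  apply: seq_cvgMl.
  have -> : (fun k => div_gamma (Phi k) x) = (fun k => cutoff k.+1%:R (coords g x) * D x +
      (div_gamma (Phi k) x - cutoff k.+1%:R (coords g x) * D x)).
    by apply/funext => k; rewrite addrC subrK.
  rewrite -[X in _ --> X]addr0 -[X in _ --> X + _]mul1r; apply: cvgD.
    rewrite [X in _ --> X]mulrC; under eq_fun do rewrite mulrC.
    by apply: seq_cvgMl; exact: cutoff_cvg.
  apply/cvgr0Pnorm_le => e e0; move/cvgr0Pnorm_le : cvgB => /(_ e e0).
  apply: filterS => k; rewrite ger0_norm// => hk; apply: le_trans hk.
  by have [_ + _] := hPhi k => /(_ x); rewrite DE.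
have mfk k : measurable_fun setT (fun x : borel X => (f x * div_gamma (Phi k) x)%:E).
  by case/integrableP : (intk k).
have mfD : measurable_fun setT (fun x : borel X => (f x * D x)%:E).
  by apply/measurable_EFinP; exact: measurable_funM.
have ae1 : {ae gamma, forall x : borel X, setT x ->
    (fun k => (f x * div_gamma (Phi k) x)%:E) @ \oo --> (f x * D x)%:E}.
  by apply: aeW => x _; exact: cvgdiv.
have ae2 : {ae gamma, forall (x : borel X) (k : nat), setT x ->
    (`|(f x * div_gamma (Phi k) x)%:E| <= (EFin \o (fun x : borel X => (2 * MP + B) * `|f x|)%R) x)%E}.
  by apply: aeW => x k _; rewrite abse_EFin lee_fin.
have [iD _ cvgI] := dominated_convergence measurableT mfk mfD ae1 intG ae2.
rewrite -lee_fin fineK; last exact: integrable_fin_num.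
apply: (cvge_to_le cvgI).
have e0 : 0 < 2 * (N' - N) by rewrite mulr_gt0// subr_gt0.
move/cvgr0Pnorm_le : cvgB => /(_ _ e0); apply: filterS => k; rewrite ger0_norm// => hk.
by apply: bound; move: (B / _) hk => b hk; lra.
Qed.

End besov_bound.

(** * Symmetry of the semigroup and duality *)

Section symmetry.
Context {R : realType} {X : tvsType R} (hX : hausdorff_space X).
Variable gamma : probability (borel X) R.
Hypothesis gamma_radon : radon gamma.
Hypothesis gamma_gauss : centered_gaussian gamma.
Local Notation covar := (cov gamma).
Variable a : R.

Definition rot_op (f : X -> R) (x : X) : R := \int[gamma]_y f (rot a x y).

Lemma rot_op_bounded (f : X -> R) : bounded_measurable (f : borel X -> R) ->
  bounded_measurable (rot_op f : borel X -> R).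
Proof.
move=> bf; exact: (bounded_measurable_slice_integral hX gamma_radon (@rot_continuous _ _ a) bf).
Qed.

Lemma rot_op_boundedD (u v : X -> R) : bounded_measurable (u : borel X -> R) ->
  bounded_measurable (v : borel X -> R) ->
  rot_op (fun x => u x + v x) = fun x => rot_op u x + rot_op v x.
Proof.
move=> bu bv; apply/funext => x; apply: bRintegralD.
  exact: (bounded_measurable_slice (@rot_continuous _ _ a) x bu).
exact: (bounded_measurable_slice (@rot_continuous _ _ a) x bv).
Qed.

(** The product-to-sum formula makes the mean explicit; exchanging the two cosines changes only the
    sign of [th - d], which the cosine ignores. *)
Let cos_rot (l k : X -> R) b c th d : dual l -> dual k ->
  \int[gamma]_x (b * cos (l x + th) * rot_op (fun x => c * cos (k x + d)) x) =
  b * c / 2 * (cos (th + d) * expR (- ((covar l l + 2 * cos a * covar l k + covar k k) / 2)) +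
    cos (th - d) * expR (- ((covar l l - 2 * cos a * covar l k + covar k k) / 2))).
Proof.
move=> dl dk; have dak := dualZ (cos a) dk; have dNak := dualZ (- cos a) dk.
pose l1 x := cos a * k x + l x; pose l2 x := - cos a * k x + l x.
have d1 : dual l1 by exact: dual_lincomb.
have d2 : dual l2 by exact: dual_lincomb.
pose E := expR (- (sin a ^+ 2 * covar k k / 2)).
transitivity (\int[gamma]_x (b * c / 2 * E * (cos (l1 x + (th + d)) + cos (l2 x + (th - d))))).
  apply: eq_Rintegral => x _; rewrite /rot_op bRintegralZ; last first.
    exact: (bounded_measurable_slice (@rot_continuous _ _ a) x (cos_dual_bounded d dk)).
  rewrite rot_cos// -/E.
  have -> : l1 x + (th + d) = (l x + th) + (cos a * k x + d) by rewrite /l1; ring.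
  have -> : l2 x + (th - d) = (l x + th) - (cos a * k x + d) by rewrite /l2; ring.
  rewrite (cosD (l x + th) (cos a * k x + d)) (cosB (l x + th) (cos a * k x + d)).
  move: (cos (l x + th)) (cos (cos a * k x + d)) (sin (l x + th)) (sin (cos a * k x + d)) => *.
  by field.
have b1 := cos_dual_bounded (th + d) d1; have b2 := cos_dual_bounded (th - d) d2.
rewrite bRintegralZ; last exact: bounded_measurableD.
rewrite (bRintegralD gamma b1 b2) (dual_char gamma_gauss _ d1) (dual_char gamma_gauss _ d2).
rewrite (covar_self_lincomb gamma_gauss _ dk dl) (covar_self_lincomb gamma_gauss _ dk dl).
rewrite (covarC gamma k l) -[LHS]mulrA mulrDr; congr (_ * (_ + _)); rewrite mulrCA /E -expRD;
  congr (_ * expR _); have := cos2Dsin2 a; move: (covar l l) (covar k k) (covar l k) => A B D h;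
  rewrite (_ : sin a ^+ 2 = 1 - cos a ^+ 2); [field => //|by rewrite -h addrC addKr|field => //|by rewrite -h addrC addKr].
Qed.

Lemma rot_op_trig_symmetric (u v : X -> R) : trig_poly dual u -> trig_poly dual v ->
  \int[gamma]_x (u x * rot_op v x) = \int[gamma]_x (v x * rot_op u x).
Proof.
have bop w : trig_poly dual w -> bounded_measurable (rot_op w : borel X -> R).
  by move=> tw; apply: rot_op_bounded; exact: trig_bounded_measurable.
move=> tu tv; elim: tu => [b l th dl|{}u w tu hu tw hw]; last first.
  have bu := trig_bounded_measurable tu; have bw := trig_bounded_measurable tw.
  have bv := trig_bounded_measurable tv; rewrite (rot_op_boundedD bu bw).
  under eq_Rintegral do rewrite mulrDl; under [RHS]eq_Rintegral do rewrite mulrDr.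
  rewrite (bRintegralD gamma (bounded_measurableM bu (bop _ tv)) (bounded_measurableM bw (bop _ tv))).
  by rewrite (bRintegralD gamma (bounded_measurableM bv (bop _ tu)) (bounded_measurableM bv (bop _ tw))) hu hw.
elim: tv => [c k d dk|{}v w tv hv tw hw]; last first.
  have bv := trig_bounded_measurable tv; have bw := trig_bounded_measurable tw.
  have tl := TrigCos b th dl; have bl := trig_bounded_measurable tl; rewrite (rot_op_boundedD bv bw).
  under eq_Rintegral do rewrite mulrDr; under [RHS]eq_Rintegral do rewrite mulrDl.
  rewrite (bRintegralD gamma (bounded_measurableM bl (bop _ tv)) (bounded_measurableM bl (bop _ tw))).
  by rewrite (bRintegralD gamma (bounded_measurableM bv (bop _ tl)) (bounded_measurableM bw (bop _ tl))) hv hw.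
rewrite (cos_rot _ _ _ _ dl dk) (cos_rot _ _ _ _ dk dl) (covarC gamma k l) (addrC d th).
rewrite -(opprB th d) cosN.
rewrite (mulrC c b); move: (covar l l) (covar k k) => A B.
have E s : B + s + A = A + s + B by ring.
by rewrite (E (2 * cos a * covar l k)) (E (- (2 * cos a * covar l k))).
Qed.

Section integrable.
Variable f : X -> R.
Hypothesis intf : gamma.-integrable setT (EFin \o (f : borel X -> R)).

Let mf : measurable_fun setT (f : borel X -> R).
Proof. by case/integrableP : intf => /measurable_EFinP. Qed.

Let mfe : measurable_fun setT (EFin \o (f : borel X -> R)).
Proof. exact/measurable_EFinP. Qed.

Let mrot x : measurable_fun setT (fun y : borel X => (rot a x y : borel X)).
Proof. by apply: continuous_borel2; exact: (slice_continuous (@rot_continuous _ _ a)). Qed.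

Lemma rot_op_measurable : measurable_fun setT (rot_op f : borel X -> R).
Proof.
apply: (@measurableT_comp _ _ _ _ _ _ (@fine R)) => //.
rewrite (_ : (fun x => _) = fun x : borel X =>
  (\int[gamma]_y (EFin \o f)^\+ (rot a x y) - \int[gamma]_y (EFin \o f)^\- (rot a x y))%E); last first.
  by apply/funext => x; rewrite integralE; congr (_ - _)%E; apply: eq_integral => y _; rewrite ?funeposE ?funenegE.
apply: emeasurable_funB; apply: (measurable_slice_integral hX gamma_radon (@rot_continuous _ _ a)) => //.
  by apply: measurable_funepos.
by apply: measurable_funeneg.
Qed.

Let mabs : measurable_fun setT (fun x : borel X => (`|f x|)%:E).
Proof. by apply/measurable_EFinP; exact: measurableT_comp. Qed.

Lemma rot_op_integral_norm :
  (\int[gamma]_x \int[gamma]_y (`|f (rot a x y)|)%:E = \int[gamma]_x (`|f x|)%:E)%E.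
Proof.
by apply: (@ge0_integral_rot _ _ hX gamma gamma_radon gamma_gauss a (fun x => (`|f x|)%:E)).
Qed.

Lemma rot_op_ae_integrable : {ae gamma, forall x : borel X,
  gamma.-integrable setT (EFin \o (fun y : borel X => f (rot a x y)))}.
Proof.
have mI : measurable_fun setT (fun x : borel X => \int[gamma]_y (`|f (rot a x y)|)%:E)%E.
  exact: (measurable_slice_integral hX gamma_radon (@rot_continuous _ _ a) (f := fun x => (`|f x|)%:E)).
have iI : gamma.-integrable setT (fun x : borel X => \int[gamma]_y (`|f (rot a x y)|)%:E)%E.
  apply/integrableP; split => //.
  under eq_integral do rewrite gee0_abs ?integral_ge0//.
  by rewrite rot_op_integral_norm; case/integrableP : intf.
move: (integrable_ae measurableT iI); apply: filterS => x /(_ I) h.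
apply/integrableP; split; first by apply/measurable_EFinP; exact: (measurableT_comp mf (mrot x)).
by rewrite ltey_eq h.
Qed.

Lemma rot_op_norm x : ((`|rot_op f x|)%:E <= \int[gamma]_y (`|f (rot a x y)|)%:E)%E.
Proof.
have mfx := measurableT_comp mf (mrot x).
have [h|h] := boolP ((\int[gamma]_y (`|f (rot a x y)|)%:E)%E \is a fin_num); last first.
  have := h; rewrite ge0_fin_numE ?integral_ge0// -leNgt leye_eq => /eqP ->.
  exact: leey.
rewrite -(fineK h) lee_fin; apply: le_norm_Rintegral_norm => //; last by rewrite fineK.
by rewrite fine_ge0// integral_ge0.
Qed.

Lemma rot_op_contraction : (\int[gamma]_x (`|rot_op f x|)%:E <= \int[gamma]_x (`|f x|)%:E)%E.
Proof.
rewrite -rot_op_integral_norm; apply: ge0_le_integral => //.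
- by apply/measurable_EFinP; apply: measurableT_comp => //; exact: rot_op_measurable.
- exact: (measurable_slice_integral hX gamma_radon (@rot_continuous _ _ a) (f := fun x => (`|f x|)%:E)).
- by move=> x _; exact: rot_op_norm.
Qed.

Lemma rot_op_integrable : gamma.-integrable setT (EFin \o (rot_op f : borel X -> R)).
Proof.
apply/integrableP; split; first by apply/measurable_EFinP; exact: rot_op_measurable.
by apply: (le_lt_trans rot_op_contraction); case/integrableP : intf.
Qed.

End integrable.

Lemma bounded_mul_integrable (u v : X -> R) : gamma.-integrable setT (EFin \o (u : borel X -> R)) ->
  bounded_measurable (v : borel X -> R) ->
  gamma.-integrable setT (EFin \o (fun x : borel X => u x * v x)).
Proof.
move=> iu [mv [M vM]]; have mu : measurable_fun setT (u : borel X -> R).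
  by case/integrableP : iu => /measurable_EFinP.
apply: (le_integrable measurableT (g := EFin \o (fun x : borel X => M * u x))).
- by apply/measurable_EFinP; exact: measurable_funM.
- move=> x _; rewrite !abse_EFin lee_fin !normrM mulrC ler_wpM2r//.
  exact: le_trans (vM x) (ler_norm _).
- exact: integrable_realZl.
Qed.

Lemma norm_Rintegral_mul_le (u v : X -> R) (e M : R) : measurable_fun setT (u : borel X -> R) ->
  (\int[gamma]_x (`|u x|)%:E <= e%:E)%E -> 0 <= e ->
  measurable_fun setT (v : borel X -> R) -> (forall x, `|v x| <= M) -> 0 <= M ->
  `|\int[gamma]_x (u x * v x)| <= e * M.
Proof.
move=> mu ue e0 mv vM M0.
apply: le_norm_Rintegral_norm; [exact: mulr_ge0|exact: measurable_funM|].
apply: (@le_trans _ _ (\int[gamma]_x (M%:E * (`|u x|)%:E))%E).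
  apply: ge0_le_integral => //.
  - by apply/measurable_EFinP; apply: measurableT_comp => //; exact: measurable_funM.
  - by apply: emeasurable_funM => //; apply/measurable_EFinP; exact: measurableT_comp.
  - by move=> x _; rewrite -EFinM lee_fin normrM mulrC ler_wpM2r.
rewrite ge0_integralZl//; last by apply/measurable_EFinP; exact: measurableT_comp.
by rewrite mulrC EFinM; apply: lee_wpmul2l.
Qed.

(** Both sides are continuous in [f] for the L^1 norm: [phi] and its image are bounded, and [rot_op]
    contracts L^1. Trigonometric polynomials are dense there, and for them symmetry is explicit. *)
Lemma rot_op_symmetric (f phi : X -> R) : gamma.-integrable setT (EFin \o (f : borel X -> R)) ->
  trig_poly dual phi ->
  \int[gamma]_x (f x * rot_op phi x) = \int[gamma]_x (rot_op f x * phi x).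
Proof.
move=> intf tphi; have bphi := trig_bounded_measurable tphi.
have bTphi := rot_op_bounded bphi.
have [mphi [M0 phiM0]] := bphi; have [mTphi [M1 TphiM1]] := bTphi.
pose M := `|M0| + `|M1|.
have phiM x : `|phi x| <= M.
  by apply: (le_trans (phiM0 x)); rewrite (le_trans (ler_norm _))// lerDl.
have TphiM x : `|rot_op phi x| <= M.
  by apply: (le_trans (TphiM1 x)); rewrite (le_trans (ler_norm _))// lerDr.
have Mp : 0 <= M by rewrite addr_ge0.
apply/eqP; rewrite -subr_eq0 -normr_eq0 eq_le normr_ge0 andbT; apply/ler_addgt0Pr => e e0.
rewrite add0r; pose e1 := e / (2 * M + 1).
have e10 : 0 < e1 by rewrite divr_gt0//; lra.
have [psi tpsi psie] := trig_dense hX gamma_radon intf e10.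
have bpsi := trig_bounded_measurable tpsi.
have ipsi := bounded_measurable_integrable gamma bpsi.
have iT := rot_op_integrable intf; have iTpsi := rot_op_integrable ipsi.
pose w x := f x - psi x.
have iw : gamma.-integrable setT (EFin \o (w : borel X -> R)) by exact: integrable_realB.
have mw : measurable_fun setT (w : borel X -> R) by case/integrableP : iw => /measurable_EFinP.
(* Linearity holds almost everywhere only: at exceptional points the rotated [f] may fail to be
   integrable in y. *)
have Tw : ae_eq gamma setT (fun x : borel X => rot_op f x - rot_op psi x) (rot_op w).
  move: (rot_op_ae_integrable intf); apply: filterS => x ix _.
  rewrite /rot_op /w RintegralB//.
  by apply: bounded_measurable_integrable; exact: (bounded_measurable_slice (@rot_continuous _ _ a) x bpsi).
have mdT : measurable_fun setT (fun x : borel X => rot_op f x - rot_op psi x).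
  by apply: measurable_funB; [case/integrableP : iT => /measurable_EFinP|case/integrableP : iTpsi => /measurable_EFinP].
have h2 : (\int[gamma]_x (`|rot_op f x - rot_op psi x|)%:E <= e1%:E)%E.
  apply: le_trans psie; apply: le_trans (rot_op_contraction iw).
  rewrite le_eqVlt; apply/orP; left; apply/eqP; apply: ae_eq_integral => //.
  - by apply/measurable_EFinP; exact: measurableT_comp.
  - by apply/measurable_EFinP; apply: measurableT_comp => //; exact: (rot_op_measurable iw).
  - by move: Tw; apply: filterS => x /(_ I) -> _.
have E1 := norm_Rintegral_mul_le mw psie (ltW e10) mTphi TphiM Mp.
have E2 := norm_Rintegral_mul_le mdT h2 (ltW e10) mphi phiM Mp.
have q1 : \int[gamma]_x (w x * rot_op phi x) =
    \int[gamma]_x (f x * rot_op phi x) - \int[gamma]_x (psi x * rot_op phi x).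
  rewrite -RintegralB//; try exact: bounded_mul_integrable.
  by apply: eq_Rintegral => x _; rewrite mulrBl.
have q2 : \int[gamma]_x ((rot_op f x - rot_op psi x) * phi x) =
    \int[gamma]_x (rot_op f x * phi x) - \int[gamma]_x (rot_op psi x * phi x).
  rewrite -RintegralB//; try exact: bounded_mul_integrable.
  by apply: eq_Rintegral => x _; rewrite mulrBl.
have q3 : \int[gamma]_x (psi x * rot_op phi x) = \int[gamma]_x (rot_op psi x * phi x).
  by rewrite rot_op_trig_symmetric//; apply: eq_Rintegral => x _; rewrite mulrC.
have -> : \int[gamma]_x (f x * rot_op phi x) - \int[gamma]_x (rot_op f x * phi x) =
    \int[gamma]_x (w x * rot_op phi x) - \int[gamma]_x ((rot_op f x - rot_op psi x) * phi x).
  by rewrite q1 q2 q3; ring.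
apply: (le_trans (ler_normB _ _)); apply: (le_trans (lerD E1 E2)).
have -> : e1 * M + e1 * M = e * (2 * M / (2 * M + 1)) by rewrite /e1; field; rewrite gt_eqF//; lra.
rewrite -[leRHS]mulr1 ler_wpM2l ?(ltW e0)// ler_pdivrMr ?mul1r; first lra.
by lra.
Qed.

End symmetry.

(** * L^p norms tested on trigonometric polynomials *)

Section duality.
Context {R : realType} {X : tvsType R} (hX : hausdorff_space X).
Variable gamma : probability (borel X) R.
Hypothesis gamma_radon : radon gamma.

(** As [u] is merely integrable, L^1 closeness of [phi] to [w] is not enough. It is split through a
    bounded [psi]: [u - psi] is small in L^1 against the bounded [w - phi], and [psi] is bounded
    against the L^1-small [w - phi]. *)
Lemma trig_test_approx (u w : X -> R) (M e : R) :
  gamma.-integrable setT (EFin \o (u : borel X -> R)) ->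
  measurable_fun setT (w : borel X -> R) -> (forall x, `|w x| <= M) -> 0 <= M -> 0 < e ->
  exists phi : X -> R, [/\ trig_poly dual phi, forall x, `|phi x| <= M + e,
    (\int[gamma]_x (`|phi x - w x|)%:E <= e%:E)%E &
    \int[gamma]_x (u x * w x) <= \int[gamma]_x (u x * phi x) + e].
Proof.
move=> iu mw wM M0 e0.
have d0 : 0 < 2 * (2 * M + e + 1) by lra.
pose e1 := e / (2 * (2 * M + e + 1)).
have e10 : 0 < e1 by rewrite divr_gt0.
have [psi tpsi psie] := trig_dense hX gamma_radon iu e10.
have bpsi := trig_bounded_measurable tpsi; have [mpsi [B0 psiB0]] := bpsi.
pose B := `|B0| + 1; have B1 : 1 <= B by rewrite lerDr.
have Bp : 0 < B by lra.
have psiB x : `|psi x| <= B.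
  by apply: (le_trans (psiB0 x)); rewrite (le_trans (ler_norm _))// lerDl.
pose e2 := Num.min e (e / (2 * B)).
have e20 : 0 < e2 by rewrite lt_min e0 divr_gt0//; lra.
have [phi [tphi phiM phie]] := trig_dense_bounded hX gamma_radon mw wM e20.
have e2e : e2 <= e by rewrite ge_min lexx.
have e2B : e2 * B <= e / 2.
  apply: (@le_trans _ _ (e / (2 * B) * B)); first by rewrite ler_wpM2r ?(ltW Bp)// /e2 ge_min lexx orbT.
  by rewrite le_eqVlt; apply/orP; left; apply/eqP; field; rewrite gt_eqF.
have bphi := trig_bounded_measurable tphi; have [mphi _] := bphi.
have mu : measurable_fun setT (u : borel X -> R) by case/integrableP : iu => /measurable_EFinP.
exists phi; split=> //.
- by move=> x; apply: (le_trans (phiM x)); rewrite lerD2l.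
- apply: le_trans (_ : (e2%:E <= _)%E); last by rewrite lee_fin.
  by apply: le_trans phie; under eq_integral do rewrite distrC.
have bw : bounded_measurable (w : borel X -> R) by split=> //; exists M.
have bd : bounded_measurable (fun x : borel X => w x - phi x) by exact: bounded_measurableB.
have mup : measurable_fun setT (fun x : borel X => u x - psi x) by exact: measurable_funB.
have dM x : `|w x - phi x| <= 2 * M + e.
  apply: (le_trans (ler_normB _ _)); have := phiM x; have := wM x; lra.
have dM0 : 0 <= 2 * M + e by lra.
have E1 := norm_Rintegral_mul_le mup psie (ltW e10) (bd.1) dM dM0.
have E2 := norm_Rintegral_mul_le (bd.1) phie (ltW e20) mpsi psiB (ltW Bp).
have iup : gamma.-integrable setT (EFin \o (fun x : borel X => u x - psi x)).
  by apply: integrable_realB => //; exact: bounded_measurable_integrable.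
have q1 : \int[gamma]_x (u x * w x) - \int[gamma]_x (u x * phi x) =
    \int[gamma]_x ((u x - psi x) * (w x - phi x)) + \int[gamma]_x ((w x - phi x) * psi x).
  rewrite -RintegralB//; [|exact: bounded_mul_integrable|exact: bounded_mul_integrable].
  rewrite -RintegralD//; [|exact: bounded_mul_integrable|].
    by apply: eq_Rintegral => x _; ring.
  by apply: bounded_measurable_integrable; exact: bounded_measurableM.
have e1M : e1 * (2 * M + e) <= e / 2.
  rewrite /e1 mulrAC ler_pdivrMr//.
  have -> : e / 2 * (2 * (2 * M + e + 1)) = e * (2 * M + e + 1) by field.
  by rewrite ler_wpM2l ?(ltW e0)//; lra.
rewrite addrC -lerBlDr q1.
have := le_trans (ler_norm _) E1; have := le_trans (ler_norm _) E2.
move: (\int[gamma]_x _) (\int[gamma]_x _) => I1 I2; lra.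
Qed.

Variable p : R.
Hypothesis p1 : 1 <= p.

(** Interpolation between the supremum and L^1 norms: |z - w|^q <= M^(q - 1) |z - w|. *)
Lemma dual_ball_approx (w z : X -> R) (M N eta : R) : p != 1 -> 0 <= N -> 0 < eta -> 0 < M ->
  measurable_fun setT (w : borel X -> R) -> measurable_fun setT (z : borel X -> R) ->
  dual_ball gamma p N w -> (forall x, `|z x - w x| <= M) ->
  (\int[gamma]_x (`|z x - w x|)%:E <=
    (eta `^ (p / (p - 1)) / M `^ (p / (p - 1) - 1))%:E)%E ->
  dual_ball gamma p (N + eta) z.
Proof.
move=> pn1 N0 e0 M0 mw mz bw dM de.
have pp : 1 < p by rewrite lt_neqAle eq_sym pn1.
set q := p / (p - 1) in de *; have q1 : 0 <= q - 1.
  by rewrite subr_ge0 /q ler_pdivlMr; lra.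
have md : measurable_fun setT (fun x : borel X => z x - w x) by exact: measurable_funB.
have mnd : measurable_fun setT (fun x : borel X => `|z x - w x|) by exact: measurableT_comp.
apply: (dual_ball_add p1 N0 (ltW e0) mw md mz bw) => [|x]; last first.
  by rewrite -{1}(subrK (w x) (z x)) addrC ler_normD.
rewrite /dual_ball (negbTE pn1).
apply: (@le_trans _ _ (\int[gamma]_x ((M `^ (q - 1))%:E * (`|z x - w x|)%:E))%E).
  apply: ge0_le_integral => //.
  - by apply/measurable_EFinP; apply: (measurableT_comp (measurable_powR _)).
  - by apply: emeasurable_funM => //; exact/measurable_EFinP.
  - move=> x _; rewrite -EFinM lee_fin -[in leLHS](subrK 1 (p / (p - 1))) -/q powRD; last first.
      by apply/implyP => /eqP h; exfalso; move: h q1; lra.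
    by rewrite powRr1// ler_wpM2r// ge0_ler_powR// nnegrE// ltW.
rewrite ge0_integralZl//; [|exact/measurable_EFinP|by rewrite lee_fin powR_ge0].
apply: (le_trans (lee_wpmul2l _ de)); first by rewrite lee_fin powR_ge0.
by rewrite -EFinM mulrCA divff ?mulr1// gt_eqF// powR_gt0.
Qed.

Variables (u : X -> R) (K : R).
Hypothesis iu : gamma.-integrable setT (EFin \o (u : borel X -> R)).
Hypothesis K0 : 0 <= K.
Hypothesis uK : forall (phi : X -> R) (N N' : R), trig_poly dual phi -> 0 <= N ->
  dual_ball gamma p N phi -> N < N' -> \int[gamma]_x (u x * phi x) <= K * N'.

Let mu : measurable_fun setT (u : borel X -> R).
Proof. by case/integrableP : iu => /measurable_EFinP. Qed.

Lemma bounded_test_le (w : X -> R) (M N : R) : 0 <= M -> 0 <= N ->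
  measurable_fun setT (w : borel X -> R) -> (forall x, `|w x| <= M) -> dual_ball gamma p N w ->
  \int[gamma]_x (u x * w x) <= K * N.
Proof.
move=> M0 N0 mw wM bw.
(* One [eta] is the growth of the ball under approximation, the second provides the strict
   inequality asked by [uK], and the last is the error of the integral. *)
suff H eta : 0 < eta -> \int[gamma]_x (u x * w x) <= K * (N + 2 * eta) + eta.
  apply/ler_addgt0Pr => e e0; have d0 : 0 < 2 * K + 1 by rewrite ltr_wpDl// mulr_ge0.
  have := H _ (divr_gt0 e0 d0); move/le_trans; apply.
  rewrite le_eqVlt; apply/orP; left; apply/eqP; field; by rewrite gt_eqF.
move=> eta0; have [pe|pn1] := eqVneq p 1.
  have wN x : `|w x| <= N by move: bw; rewrite /dual_ball pe eqxx; apply.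
  have [phi [tphi phiN _ h]] := trig_test_approx iu mw wN N0 eta0.
  apply: (le_trans h); rewrite lerD2r; apply: (uK (N := N + eta)) => //.
  - by rewrite addr_ge0// ltW.
  - by rewrite /dual_ball pe eqxx.
  - lra.
(* The L^1 tolerance required by [dual_ball_approx]; [2 * M + 1] bounds the difference because the
   accuracy below is at most 1. *)
set b := eta `^ (p / (p - 1)) / (2 * M + 1) `^ (p / (p - 1) - 1).
have M1 : 0 < 2 * M + 1 by lra.
have b0 : 0 < b by rewrite divr_gt0// powR_gt0.
pose e := Num.min 1 (Num.min eta b).
have e0 : 0 < e by rewrite /e !lt_min ltr01 eta0 b0.
have e1 : e <= 1 by rewrite /e ge_min lexx.
have ee : e <= eta by rewrite /e !ge_min lexx !orbT.
have eb : e <= b by rewrite /e !ge_min lexx !orbT.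
have [phi [tphi phiM phiw h]] := trig_test_approx iu mw wM M0 e0.
have [mphi _] := trig_bounded_measurable tphi.
apply: (le_trans h); apply: lerD => //; apply: (uK (N := N + eta)) => //.
- by rewrite addr_ge0// ltW.
- apply: (dual_ball_approx pn1 N0 eta0 M1 mw mphi bw) => [x|].
    by apply: (le_trans (ler_normB _ _)); have := phiM x; have := wM x; lra.
  by apply: (le_trans phiw); rewrite lee_fin.
- lra.
Qed.

Let sg (x : X) : R := if 0 <= u x then 1 else -1.

Let sgE x : u x * sg x = `|u x|.
Proof.
rewrite /sg; case: ifPn => h; first by rewrite mulr1 ger0_norm.
by rewrite mulrN1 ler0_norm// ltW// ltNge.
Qed.

Let sg1 x : `|sg x| = 1.
Proof. by rewrite /sg; case: ifP; rewrite ?normrN1 ?normr1. Qed.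

Let msg : measurable_fun setT (sg : borel X -> R).
Proof. by apply: measurable_fun_ifT => //; exact: measurable_fun_ler. Qed.

Let truncated (k : nat) : set (borel X) := [set x | `|u x| <= k%:R].

Let mtruncated k : measurable (truncated k).
Proof.
have mle : measurable_fun setT (fun x : borel X => `|u x| <= k%:R).
  by apply: measurable_fun_ler => //; exact: measurableT_comp.
rewrite -[truncated k]setTI.
by have := mle measurableT [set true]; rewrite setTI; apply.
Qed.

(** The test function is the extremal sign(u) |u|^(p - 1) of Hoelder's inequality, cut to |u| <= k
    so that it is bounded and [J] is finite. The bound reads J <= K J^(1 - 1/p), which is divided by
    the power of [J]. *)
Let truncated_integral_le k : p != 1 ->
  (\int[gamma]_(x in truncated k) (`|u x| `^ p)%:E <= (K `^ p)%:E)%E.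
Proof.
move=> pn1; have pp : 1 < p by rewrite lt_neqAle eq_sym pn1.
have p0 : 0 < p by lra.
pose v x := if `|u x| <= k%:R then `|u x| `^ p else 0.
pose w x := if `|u x| <= k%:R then sg x * `|u x| `^ (p - 1) else 0.
have mnu : measurable_fun setT (fun x : borel X => `|u x|) by exact: measurableT_comp.
have mle : measurable_fun setT (fun x : borel X => `|u x| <= k%:R) by exact: measurable_fun_ler.
have mw : measurable_fun setT (w : borel X -> R).
  apply: measurable_fun_ifT => //; apply: measurable_funM => //.
  exact: (measurableT_comp (measurable_powR _)).
have wM x : `|w x| <= k%:R `^ (p - 1).
  rewrite /w; case: ifPn => h; last by rewrite normr0 powR_ge0.
  rewrite normrM sg1 mul1r ger0_norm ?powR_ge0// ge0_ler_powR ?nnegrE//; lra.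
have uw x : u x * w x = v x.
  rewrite /w /v; case: ifPn => h; last by rewrite mulr0.
  have pE : 1 + (p - 1) = p by rewrite addrC subrK.
  by rewrite mulrA sgE -{1}(powRr1 (normr_ge0 (u x))) -powRD pE// gt_eqF.
have wq x : `|w x| `^ (p / (p - 1)) = v x.
  rewrite /w /v; case: ifPn => h; last first.
    by rewrite normr0 powR0// gt_eqF// divr_gt0//; lra.
  rewrite normrM sg1 mul1r ger0_norm ?powR_ge0// -powRrM mulrCA divff ?mulr1//.
  by rewrite gt_eqF//; lra.
have v0 x : 0 <= v x by rewrite -wq powR_ge0.
have mv : measurable_fun setT (v : borel X -> R).
  by rewrite (_ : v = fun x => u x * w x); [exact: measurable_funM|apply/funext => x; rewrite uw].
pose J := \int[gamma]_x v x.
have iv : gamma.-integrable setT (EFin \o (v : borel X -> R)).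
  have := bounded_mul_integrable iu (conj mw (ex_intro _ _ wM) : bounded_measurable (w : borel X -> R)).
  by rewrite (_ : (fun x : borel X => u x * w x) = v)//; apply/funext => x; rewrite uw.
have JE : (\int[gamma]_x (v x)%:E)%E = J%:E by rewrite fineK//; exact: integrable_fin_num.
have J0 : 0 <= J by rewrite -lee_fin -JE; apply: integral_ge0 => x _; rewrite lee_fin.
have -> : (\int[gamma]_(x in truncated k) (`|u x| `^ p)%:E = J%:E)%E.
  rewrite integral_mkcond -JE; apply: eq_integral => x _.
  have -> : v x = if x \in truncated k then `|u x| `^ p else 0.
    by rewrite /v; congr (if _ then _ else _); apply/idP/idP; rewrite inE.
  by rewrite patchE; case: ifP.
have q0 : 0 < p / (p - 1) by rewrite divr_gt0//; lra.
have qV : (p / (p - 1))^-1 = 1 - p^-1 by field; rewrite !gt_eqF//; lra.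
have bw : dual_ball gamma p (J `^ (1 - p^-1)) w.
  rewrite /dual_ball (negbTE pn1); under eq_integral do rewrite wq.
  by rewrite JE lee_fin -powRrM -qV mulVf ?powRr1// gt_eqF.
have := bounded_test_le (powR_ge0 _ _) (powR_ge0 _ _) mw wM bw.
under eq_Rintegral do rewrite uw.
rewrite -/J lee_fin => h; have [->|Jn0] := eqVneq J 0; first exact: powR_ge0.
have Jp : 0 < J by rewrite lt_neqAle eq_sym Jn0.
have hJ : J `^ p^-1 <= K.
  rewrite -(ler_pM2r (powR_gt0 (1 - p^-1) Jp)) -powRD; last by rewrite Jn0 implybT.
  by rewrite addrC subrK powRr1.
rewrite -[leLHS]powRr1// -[X in J `^ X](mulVf (x := p)) ?gt_eqF// powRrM.
by rewrite ge0_ler_powR ?nnegrE ?powR_ge0// ltW.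
Qed.

Lemma Lnorm_le_dual : (Lnorm gamma p%:E (EFin \o (u : borel X -> R)) <= K%:E)%E.
Proof.
have p0 : 0 < p by exact: lt_le_trans p1.
apply/(Lnorm_leP _ _ p0 K0); have [pe|pn1] := eqVneq p 1.
  rewrite pe powRr1//.
  have b1 : dual_ball gamma p 1 sg by rewrite /dual_ball pe eqxx => x; rewrite sg1.
  have sg1' x : `|sg x| <= 1 by rewrite sg1.
  have := bounded_test_le ler01 ler01 msg sg1' b1.
  under eq_Rintegral do rewrite sgE.
  under [X in _ -> is_true (X <= _)%E]eq_integral do rewrite powRr1//.
  rewrite mulr1 -lee_fin fineK//; apply: integrable_fin_num => //.
  exact: (integrable_norm iu).
have UT : \bigcup_k truncated k = setT.
  apply/seteqP; split=> // x _; exists (Num.truncn `|u x|).+1 => //=.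
  exact: ltW (truncnS_gt _).
have := @ge0_nondecreasing_set_cvg_integral _ _ R truncated (fun x : borel X => (`|u x| `^ p)%:E) gamma.
rewrite UT => cvgI; apply: (cvge_to_le (cvgI _ _ _ _)).
- apply/nondecreasing_seqP => n; apply/subsetPset => x; rewrite /truncated /= => h.
  by apply: (le_trans h); rewrite ler_nat.
- by move=> n; exact: mtruncated.
- move=> n; apply: (@measurable_funTS); apply/measurable_EFinP.
  by apply: (measurableT_comp (measurable_powR _)); exact: measurableT_comp.
- by move=> n x _; rewrite lee_fin powR_ge0.
- by apply: nearW => n; exact: truncated_integral_le.
Qed.

End duality.

(** * The estimate for one admissible constant, and the infimum *)

Section main.
Context {R : realType} {X : tvsType R} (hX : hausdorff_space X).
Variable gamma : probability (borel X) R.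
Hypothesis gamma_radon : radon gamma.
Hypothesis gamma_gauss : centered_gaussian gamma.
Variables (p alpha : R) (f : X -> R) (C a : R).
Hypotheses (p1 : 1 <= p) (alpha0 : 0 < alpha) (alpha1 : alpha <= 1).
Hypothesis intf : gamma.-integrable setT (EFin \o (f : borel X -> R)).
Hypothesis fC : besov_const gamma p alpha f C.
Hypothesis a0 : 0 < a.

Lemma rot_op_Lnorm_le :
  (Lnorm gamma p%:E (fun x : borel X => (f x - rot_op gamma a f x)%:E)
   <= (2 `^ (1 - alpha) * gaussian_moment p `^ alpha * a `^ alpha * C)%:E)%E.
Proof.
have [C0 _] := fC; have c0 := @gaussian_moment_ge0 R p.
have iT := rot_op_integrable hX gamma_radon gamma_gauss a intf.
have iu : gamma.-integrable setT (EFin \o (fun x : borel X => f x - rot_op gamma a f x)).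
  exact: integrable_realB.
have mu : measurable_fun setT (fun x : borel X => f x - rot_op gamma a f x).
  by case/integrableP : iu => /measurable_EFinP.
apply: (Lnorm_le_dual hX gamma_radon p1 iu); first by rewrite !mulr_ge0 ?powR_ge0.
move=> phi N N' tphi N0 bphi NN'.
have [n [g [P [og tP phiE PM]]]] := trig_poly_cylindrical hX gamma_radon gamma_gauss tphi.
have tPg := trig_coords og tP.
have [mphi _] := trig_bounded_measurable tphi.
have bPg := trig_bounded_measurable tPg; have [mPg _] := bPg.
have bT := rot_op_bounded hX gamma_radon a bPg.
have -> : \int[gamma]_x ((f x - rot_op gamma a f x) * phi x) =
    \int[gamma]_x ((f x - rot_op gamma a f x) * P (coords g x)).
  rewrite /Rintegral; congr fine; apply: ae_eq_integral => //.
  - by apply/measurable_EFinP; exact: measurable_funM.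
  - by apply/measurable_EFinP; exact: measurable_funM.
  - by move: phiE; apply: filterS => x -> _.
(* Symmetry moves the operator from [f] to [P]. The divergence of the field has the opposite sign,
   so the field is built from [- P]. *)
have -> : \int[gamma]_x ((f x - rot_op gamma a f x) * P (coords g x)) =
    \int[gamma]_x (f x * (rot_mean gamma g (fun y => -1 * P y) a x - -1 * P (coords g x))).
  transitivity (\int[gamma]_x (f x * P (coords g x)) -
      \int[gamma]_x (f x * rot_op gamma a (fun x => P (coords g x)) x)).
    rewrite (rot_op_symmetric hX gamma_radon gamma_gauss a intf tPg).
    rewrite -RintegralB//; [|exact: bounded_mul_integrable|exact: bounded_mul_integrable].
    by apply: eq_Rintegral => x _; rewrite mulrBl.
  rewrite -RintegralB//; [|exact: bounded_mul_integrable|exact: bounded_mul_integrable].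
  apply: eq_Rintegral => x _; rewrite /rot_mean bRintegralZ; last exact: (trig_rot_bounded og a x tP).
  by rewrite /rot_op; ring.
have P1 : p = 1 -> forall y, `|-1 * P y| <= N.
  move=> pe y; rewrite mulN1r normrN; apply: PM => x.
  by move: bphi; rewrite /dual_ball pe eqxx; apply.
have bP : dual_ball gamma p N (fun x => -1 * P (coords g x)).
  rewrite /dual_ball; case: eqVneq => [pe x|pn1]; first exact: P1.
  move: bphi; rewrite /dual_ball (negbTE pn1); apply: le_trans.
  rewrite le_eqVlt; apply/orP; left; apply/eqP; apply: ae_eq_integral => //.
  - apply/measurable_EFinP; apply: (measurableT_comp (measurable_powR _)).
    by apply: measurableT_comp => //; exact: measurable_funM.
  - apply/measurable_EFinP; apply: (measurableT_comp (measurable_powR _)).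
    exact: measurableT_comp.
  - by move: phiE; apply: filterS => x -> _; rewrite mulN1r normrN.
have N'0 : 0 < N' by exact: le_lt_trans NN'.
apply: (le_trans (besov_bound hX gamma_radon gamma_gauss p1 alpha0 alpha1 intf fC og
  (trig_polyZ (-1) tP) a0 N0 P1 bP NN')).
rewrite !powRM ?mulr_ge0 ?(ltW a0) ?(ltW N'0)//.
(* The two Besov factors carry the powers alpha and 1 - alpha of [N'], so the estimate is linear in
   [N'], as duality requires. *)
have E : N' `^ alpha * N' `^ (1 - alpha) = N'.
  by rewrite -powRD ?(gt_eqF N'0) ?implybT// addrC subrK powRr1// ltW.
rewrite -[X in _ <= _ * X]E; move: (_ `^ _) (_ `^ _) (_ `^ _) (_ `^ _) (_ `^ _) => x1 x2 x3 x4 x5.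
by rewrite le_eqVlt; apply/orP; left; apply/eqP; ring.
Qed.

End main.

Theorem theorem6p5 (R : realType) (X : tvsType R) (hX : hausdorff_space X)
    (gamma : probability (borel X) R)
    (gamma_radon : radon gamma) (gamma_gauss : centered_gaussian gamma)
    (p alpha : R) (hp : 1 <= p) (halpha0 : 0 < alpha) (halpha1 : alpha <= 1)
    (f : X -> R) (hf : besov gamma p alpha f) (t : R) (ht : 0 <= t) :
  (Lnorm gamma p%:E (fun x => (f x - ornstein_uhlenbeck gamma t f x)%:E)
   <= (2 `^ (1 - alpha) * gaussian_moment p `^ alpha * ou_time t `^ alpha
       * besov_norm gamma p alpha f)%:E)%E.
Proof.
have [fp [C0 fC0]] := hf; have c0 := @gaussian_moment_ge0 R p.
have V0 : 0 <= besov_norm gamma p alpha f.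
  by apply: lb_le_inf; [exists C0|move=> C []].
(* At t = 0 the angle is 0, whereas the field is built on a segment of positive length; here the
   semigroup is the identity and the left side is 0. *)
have [->|tn0] := eqVneq t 0.
  rewrite (_ : (fun x => _) = cst 0%E); first by rewrite Lnorm0 ?lee_fin ?mulr_ge0 ?powR_ge0// gt_eqF ?lte_fin ?(lt_le_trans _ hp).
  apply/funext => x; rewrite /ornstein_uhlenbeck mulr0 oppr0 expR0 subrr sqrtr0.
  under eq_Rintegral do rewrite scale1r scale0r addr0.
  by rewrite Rintegral_cst// [X in _ * fine X](@probability_setT _ _ _ gamma) mulr1 subrr.
have t0 : 0 < t by rewrite lt_neqAle eq_sym tn0.
pose a := acos (expR (- t)).
have e1 : expR (- t) < 1 by rewrite -[ltRHS]expR0 ltr_expR oppr_lt0.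
have e01 : -1 <= expR (- t) <= 1 by rewrite (ltW e1) andbT (le_trans _ (expR_ge0 _))// lerN10.
have a0 : 0 < a by apply: acos_gt0; rewrite e1 andbT; case/andP : e01.
have aou : a <= ou_time t by exact: acos_le_ou_time.
have OUE : ornstein_uhlenbeck gamma t f = rot_op gamma a f.
  apply/funext => x; apply: eq_Rintegral => y _; rewrite /rot acosK ?in_itv//.
  by rewrite sin_acos// -expRM_natl mulrN.
have intf : gamma.-integrable setT (EFin \o (f : borel X -> R)).
  apply/Lfun1_integrable; move: fp; apply: Lfun_subset; rewrite ?lee_fin//.
  by rewrite [X in X \is a _](@probability_setT _ _ _ gamma).
rewrite OUE.
set L := Lnorm _ _ _.
pose A : R := 2 `^ (1 - alpha) * gaussian_moment p `^ alpha * a `^ alpha.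
have LA C : besov_const gamma p alpha f C -> (L <= (A * C)%:E)%E.
  move=> fC; exact: (rot_op_Lnorm_le hX gamma_radon gamma_gauss hp halpha0 halpha1 intf fC a0).
have A0 : 0 <= A by rewrite !mulr_ge0 ?powR_ge0.
have L0 : (0 <= L)%E by exact: Lnorm_ge0.
have Lfin : L \is a fin_num by rewrite ge0_fin_numE// (le_lt_trans (LA _ fC0))// ltry.
have LV : (L <= (A * besov_norm gamma p alpha f)%:E)%E.
  (* The estimate holds for every admissible constant; division by [A] carries it to the infimum,
     with [A = 0] treated apart. *)
  rewrite -(fineK Lfin) lee_fin; have [A00|An0] := eqVneq A 0.
    by have := LA _ fC0; rewrite A00 !mul0r -(fineK Lfin) lee_fin.
  have Ap : 0 < A by rewrite lt_neqAle eq_sym An0.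
  rewrite mulrC -ler_pdivrMr//; apply: lb_le_inf; first by exists C0.
  by move=> C /LA; rewrite -{1}(fineK Lfin) lee_fin ler_pdivrMr// mulrC.
apply: (le_trans LV); rewrite lee_fin ler_wpM2r// ler_wpM2l ?mulr_ge0 ?powR_ge0//.
by rewrite ge0_ler_powR ?nnegrE ?(ltW halpha0) ?(ltW a0)// (le_trans (ltW a0)).
Qed.
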